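(* There exists a symplectic $C^1$ twist map $f:\mathbb{T}\times\mathbb{R}\rightarrow\mathbb{T}\times\mathbb{R}$ of the annulus that has an essential invariant curve $\Gamma$ (so $f(\Gamma)=\Gamma$), which is the graph of a map $\gamma:\mathbb{T}\rightarrow\mathbb{R}$, such that: (1) $\Gamma$ contains no periodic points of $f$; (2) the restriction $f_{|\Gamma}$ is $C^0$-conjugated (conjugated by a homeomorphism $\Gamma\to\mathbb{T}$) to a Denjoy counter-example; (3) there is one orbit $\{f^k(p): k\in\mathbb{Z}\}$ with $p\in\Gamma$ such that $\gamma$ is $C^1$ at every point of $\mathbb{T}$ except at the points of the projection $\{\pi(f^k(p)):k\in\mathbb{Z}\}$ of this orbit, and at each point of this projection $\gamma$ has a right derivative and a left derivative, which are distinct.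
   Context: $\mathbb{T}=\mathbb{R}/\mathbb{Z}$ is the circle. The annulus is $\mathbb{T}\times\mathbb{R}$, with points $(\theta,r)$, endowed with the symplectic form $\omega=d\theta\wedge dr$; $\pi:\mathbb{T}\times\mathbb{R}\to\mathbb{T}$ is the first projection and $\tilde\pi:\mathbb{R}^2\to\mathbb{R}$ its lift. A map is symplectic if it preserves $\omega$. Twist map: a $C^1$ diffeomorphism $f$ of the annulus that is isotopic to the identity is a positive (resp. negative) twist map if for any given lift $\tilde f:\mathbb{R}^2\to\mathbb{R}^2$ and every $\tilde\theta\in\mathbb{R}$, the map $r\mapsto\tilde\pi\circ\tilde f(\tilde\theta,r)$ is an increasing (resp. decreasing) diffeomorphism of $\mathbb{R}$. A twist map is a positive or negative twist map. An essential curve is a simple loop in the annulus that is not homotopic to a point. (By a theorem of G.D. Birkhoff, any essential curve invariant by a symplectic twist map is the graph of a Lipschitz map $\mathbb{T}\to\mathbb{R}$.) $C^1$ at a point: a continuous map $\gamma:\mathbb{T}\to\mathbb{R}$ is $C^1$ at $\theta\in\mathbb{T}$ if there exists a number $\gamma'(\theta)\in\mathbb{R}$ such that for all sequences $(\theta_n^1)$, $(\theta_n^2)$ of points of $\mathbb{T}$ converging to $\theta$ with $\theta_n^1\neq\theta_n^2$ for all $n$, one has $\lim_{n\to\infty}\frac{\gamma(\theta_n^1)-\gamma(\theta_n^2)}{\theta_n^1-\theta_n^2}=\gamma'(\theta)$, where $\theta_n^1-\theta_n^2$ denotes its unique representative in $]-\frac12,\frac12]$. A Denjoy counter-example is an orientation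 preserving $C^1$ diffeomorphism $g:\mathbb{T}\to\mathbb{T}$ with irrational rotation number (no periodic points) whose non-wandering set is a Cantor subset $K\subsetneq\mathbb{T}$ such that $g_{|K}$ is minimal. *)

(* Defs.v *)
From HB Require Import structures.
From mathcomp Require Import all_boot all_order all_algebra.
From mathcomp Require Import all_classical all_reals all_analysis.
From mathcomp Require Import lra.

Set Implicit Arguments.
Unset Strict Implicit.
Unset Printing Implicit Defensive.

Import Order.TTheory GRing.Theory Num.Theory.
Import numFieldNormedType.Exports.

Local Open Scope classical_set_scope.
Local Open Scope ring_scope.
Local Open Scope quotient_scope.

Section CircleAndAnnulus.
Variable R : realType.

Definition int_zmod : zmodClosed R :=
  GRing.ZmodClosed.clone R (@Num.int_num_subdef R) _.
Definition RmodZ : Type := Quotient.quot int_zmod.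
HB.instance Definition _ := EqQuotient.on RmodZ.

Definition circle : Type := quotient_topology RmodZ.
HB.instance Definition _ := Topological.on circle.
HB.instance Definition _ := Quotient.on circle.
(* Copying the whole group structure of RmodZ would bring a choice structure
   that clashes with the one of quotient_topology; only the laws are reused. *)
HB.instance Definition _ := GRing.isZmodule.Build circle
  (@Quotient.addqA R int_zmod) (@Quotient.addqC R int_zmod)
  (@Quotient.add0q R int_zmod) (@Quotient.addNq R int_zmod).

Definition annulus : Type := (circle * R)%type.

Definition T_proj (x : R) : circle := \pi_circle x.
Definition A_proj (z : R * R) : annulus := (T_proj z.1, z.2).

(* The representative of t in ]-1/2, 1/2]; see T_repK and T_rep_itv. *)
Definition T_rep (t : circle) : R := repr t - (Num.ceil (repr t - 2^-1))%:~R.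

Lemma T_projB x y : T_proj (x - y) = T_proj x - T_proj y.
Proof. exact: (@pi_is_zmod_morphism _ _ _ RmodZ). Qed.

Lemma T_proj_eq x y : T_proj x = T_proj y <-> x - y \is a Num.int.
Proof.
have E := @Quotient.idealrBE R int_zmod x y.
split=> [h|h]; last by have : x - y \in int_zmod := h; rewrite E => /eqP.
by have /eqP : \pi_RmodZ x = \pi_RmodZ y := h; rewrite -E.
Qed.

Lemma T_repK t : T_proj (T_rep t) = t.
Proof.
rewrite -[RHS]reprK; apply/T_proj_eq.
by rewrite /T_rep addrAC subrr add0r rpredN intr_int.
Qed.

Lemma T_rep_itv t : - 2^-1 < T_rep t <= 2^-1.
Proof.
rewrite /T_rep; set x := repr t.
have /andP[h1 h2] := ceil_itv (x - 2^-1).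
by rewrite intrB in h1; apply/andP; split; lra.
Qed.

End CircleAndAnnulus.

Section Topology.
Implicit Types X Y : topologicalType.

Definition homeomorphism_on {X Y} (A : set X) (h : X -> Y) :=
  {within A, continuous h} /\
  exists k : Y -> X, [/\ continuous k, (forall y, A (k y)),
    cancel k h & {in A, cancel h k}].

Definition C0_conjugated_on {X Y} (A : set X) (f : X -> X) (g : Y -> Y) :=
  exists h : X -> Y,
    homeomorphism_on A h /\ forall x, A x -> h (f x) = g (h x).

Definition nonwandering {X} (g : X -> X) : set X :=
  [set x | forall U, nbhs x U ->
     exists n, (0 < n)%N /\ (iter n g @` U) `&` U !=set0].

Definition cantor_set {X} (K : set X) :=
  [/\ K !=set0, compact K, perfect_set K & totally_disconnected K].

Definition minimal_on {X} (g : X -> X) (K : set X) :=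
  g @` K = K /\
  forall M, closed M -> M !=set0 -> M `<=` K -> g @` M `<=` M -> M = K.

(* For a bijection f this is {f^k p | k in Z}: the equation f^n q = p says that
   q = f^(-n) p. *)
Definition full_orbit {T : Type} (f : T -> T) (p : T) : set T :=
  [set q | exists n, q = iter n f p \/ iter n f q = p].

End Topology.

Definition diffeo {M : Type} (C1 : (M -> M) -> Prop) (f : M -> M) :=
  exists g, [/\ cancel f g, cancel g f, C1 f & C1 g].

Section Dynamics.
Variable R : realType.
Local Notation T := (circle R).
Local Notation A := (annulus R).

(* Only used for V finite dimensional, where continuity of the differential in
   the operator norm is the same as its pointwise continuity. *)
Definition C1 {V W : normedModType R} (F : V -> W) :=
  (forall x, differentiable F x) /\ forall v, continuous (fun x => 'd F x v).

Definition T_lift (G : R -> R) (g : T -> T) :=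
  continuous G /\ forall x, T_proj (G x) = g (T_proj x).
Definition A_lift (F : R * R -> R * R) (f : A -> A) :=
  continuous F /\ forall z, A_proj (F z) = f (A_proj z).

(* The covering projections are local charts, so smoothness can be read on a
   lift; two lifts of the same map differ by a constant. *)
Definition T_C1 (g : T -> T) := exists G, T_lift G g /\ C1 G.
Definition A_C1 (f : A -> A) := exists F, A_lift F f /\ C1 F.

(* d theta /\ d r on the tangent vectors u and v. *)
Definition omega (u v : R * R) : R := u.1 * v.2 - u.2 * v.1.

Definition symplectic (f : A -> A) :=
  exists F, [/\ A_lift F f, C1 F &
    forall z u v, omega ('d F z u) ('d F z v) = omega u v].

Definition isotopic_to_id (f : A -> A) :=
  exists h : R -> A -> A,
    [/\ {within `[0, 1]%classic `*` [set: A],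
           continuous (fun tz : R * A => h tz.1 tz.2)},
        (forall t, `[0, 1]%classic t -> diffeo A_C1 (h t)),
        h 0 = id & h 1 = f].

Definition pos_twist_map (f : A -> A) :=
  [/\ diffeo A_C1 f, isotopic_to_id f &
    forall F, A_lift F f -> forall theta : R,
      let phi r := (F (theta, r)).1 in
      {homo phi : r s / r < s} /\ diffeo C1 phi].

Definition neg_twist_map (f : A -> A) :=
  [/\ diffeo A_C1 f, isotopic_to_id f &
    forall F, A_lift F f -> forall theta : R,
      let phi r := (F (theta, r)).1 in
      {homo phi : r s / r < s >-> s < r} /\ diffeo C1 phi].

Definition twist_map (f : A -> A) := pos_twist_map f \/ neg_twist_map f.

Definition null_homotopic (c : T -> A) :=
  exists h : R -> T -> A,
    [/\ {within `[0, 1]%classic `*` [set: T],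
           continuous (fun tx : R * T => h tx.1 tx.2)},
        h 0 = c & exists z, forall x, h 1 x = z].

Definition essential_curve (Gamma : set A) :=
  exists c : T -> A,
    [/\ continuous c, injective c, range c = Gamma & ~ null_homotopic c].

Definition graph_of (gamma : T -> R) : set A := [set z | z.2 = gamma z.1].

Definition C1_at (gamma : T -> R) (theta : T) :=
  exists d : R, forall u v : nat -> T,
    u @ \oo --> theta -> v @ \oo --> theta -> (forall n, u n <> v n) ->
    (fun n => (gamma (u n) - gamma (v n)) / T_rep (u n - v n)) @ \oo --> d.

Definition right_derivative (gamma : T -> R) (theta : T) (d : R) :=
  (fun s : R => (gamma (theta + T_proj s) - gamma theta) / s) @ 0^'+ --> d.
Definition left_derivative (gamma : T -> R) (theta : T) (d : R) :=
  (fun s : R => (gamma (theta + T_proj s) - gamma theta) / s) @ 0^'- --> d.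

Definition orientation_preserving (g : T -> T) :=
  forall G, T_lift G g -> forall x, 0 < derive1 G x.

Definition rotation_number (g : T -> T) (rho : T) :=
  exists G a, [/\ T_lift G g, T_proj a = rho &
    forall x, (fun n => (iter n G x - x) / n%:R) @ \oo --> a].

Definition irrational_angle (rho : T) :=
  forall a, T_proj a = rho -> irrational a.

Definition denjoy_counterexample (g : T -> T) :=
  [/\ diffeo T_C1 g, orientation_preserving g,
    (exists rho, rotation_number g rho /\ irrational_angle rho) &
    exists K, [/\ K `<` [set: T], nonwandering g = K,
      cantor_set K & minimal_on g K]].

End Dynamics.

(* Main.v *)
(* The map f(x, r) = (x + r, r + Phi(x + r)) leaves the graph of G - id
   invariant as soon as Phi = G + G^-1 - 2 id, and acts on it as G. So it
   suffices to find a circle homeomorphism G that is conjugate to a Denjoy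
   diffeomorphism and broken exactly along one orbit, while G + G^-1 is C^1.

   Blow up an orbit of the rotation by rho = pi into gaps of lengths ~ |k|^-3,
   leaving a set of positive measure. Map each gap to the next one tangentially
   to the identity at the ends; since the ratios of lengths tend to 1, such maps
   have derivative 1 on the Cantor set. Let G be broken in the middle of the
   k-th gap, with one-sided derivatives alpha k. Then G + G^-1 is differentiable
   there if alpha (k + 1) + (alpha k)^-1 is the same on both sides. This holds
   when alpha k = m (k + 1) / m k for two solutions m of one linear recurrence
   m (k + 1) + m (k - 1) = c k * m k; choosing c = 2 off 0, both solutions grow
   linearly at both ends, so that alpha tends to 1 and G' is continuous on the
   Cantor set. Unbroken gap maps give a Denjoy diffeomorphism on the same Cantor
   set, conjugate to G gap by gap. *)
From HB Require Import structures.
Require Import Defs.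
From mathcomp Require Import all_boot all_order all_algebra.
From mathcomp Require Import all_classical all_reals all_analysis.
From mathcomp Require Import ring lra zify.

Set Implicit Arguments.
Unset Strict Implicit.
Unset Printing Implicit Defensive.

Import Order.TTheory GRing.Theory Num.Theory.
Import numFieldNormedType.Exports.

Local Open Scope classical_set_scope.
Local Open Scope ring_scope.

(** A point of the blown-up line is recorded by its level [y] and by one number [s k] for each gap.
    These numbers grow linearly in [k], so lengths of cubic decay leave terms of order [mag k ^- 2],
    summable with explicit tails. In these coordinates [gmap] is the identity plus a constant plus a
    sum of displacements, one per gap, so that Lipschitz bounds and derivatives are obtained term by
    term.

    The obstacle is regularity on the Cantor set, where the broken points accumulate. Strict
    differentiability is suited to it: it is an estimate on pairs of nearby points, which can be
    summed over the gaps, restricted to half-lines at a break and transported to inverses.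
    Continuity of the derivative comes at the end, wherever the estimate holds at every point.

    The exceptional site 0 of the recurrence cannot be avoided with factor 2 elsewhere: if the
    factor were 2 everywhere, solutions would be affine, the positive ones constant, and both
    one-sided slopes equal to 1. Bending at 0 by the same factor 83/40 admits two positive
    solutions, with growth rates 1 and 2 exchanged between the two ends. *)

(** * Strict differentiability relative to a subset of the line *)

Section StrongDerivative.
Variable R : realType.
Implicit Types (A B : set R) (F G : R -> R) (x d e : R).

(* Strict differentiability along A; along setT it is the notion of being C^1
   at x, and holding everywhere it means being of class C^1. *)
Definition sderiv A F x d := forall e, 0 < e ->
  exists2 r : R, 0 < r & forall u v, A u -> A v -> `|u - x| < r -> `|v - x| < r ->
    `|F u - F v - d * (u - v)| <= e * `|u - v|.

Lemma sderiv_subset A B F x d : B `<=` A -> sderiv A F x d -> sderiv B F x d.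
Proof.
move=> BA h e /h[r r0 H]; exists r => // u v Bu Bv; exact: H (BA _ Bu) (BA _ Bv).
Qed.

(** Only increments are compared, so [F] and [G] may differ by a constant, as two lifts of one
    circle map do. *)
Lemma sderiv_eq_near A F G x d r : 0 < r ->
  (forall u v, A u -> A v -> `|u - x| < r -> `|v - x| < r ->
     F u - F v = G u - G v) ->
  sderiv A G x d -> sderiv A F x d.
Proof.
move=> r0 FG h e /h[s s0 H]; exists (Num.min r s); first by rewrite lt_min r0 s0.
move=> u v Au Av; rewrite !lt_min => /andP[ur us] /andP[vr vs].
by rewrite FG//; apply: H.
Qed.

Lemma sderiv_cst A (c : R) x : sderiv A (fun=> c) x 0.
Proof.
move=> e e0; exists 1 => // u v _ _ _ _.
by rewrite subrr mul0r subrr normr0 mulr_ge0// ltW.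
Qed.

Lemma sderiv_id A x : sderiv A id x 1.
Proof.
move=> e e0; exists 1 => // u v _ _ _ _.
by rewrite mul1r subrr normr0 mulr_ge0// ltW.
Qed.

Lemma sderivD A F G x d d' : sderiv A F x d -> sderiv A G x d' ->
  sderiv A (fun u => F u + G u) x (d + d').
Proof.
move=> hF hG e e0; have e2 : 0 < e / 2 by rewrite divr_gt0.
have [r r0 HF] := hF _ e2; have [s s0 HG] := hG _ e2.
exists (Num.min r s); first by rewrite lt_min r0 s0.
move=> u v Au Av; rewrite !lt_min => /andP[ur us] /andP[vr vs].
have -> : F u + G u - (F v + G v) - (d + d') * (u - v) =
  (F u - F v - d * (u - v)) + (G u - G v - d' * (u - v)) by ring.
rewrite (le_trans (ler_normD _ _))// [e]splitr mulrDl lerD//.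
  exact: HF.
exact: HG.
Qed.

Lemma sderivZ A F x d (k : R) : sderiv A F x d ->
  sderiv A (fun u => k * F u) x (k * d).
Proof.
move=> hF e e0; have k0 : 0 < `|k| + 1 by rewrite ltr_wpDl.
have [r r0 HF] := hF _ (divr_gt0 e0 k0).
exists r => // u v Au Av ur vr.
have -> : k * F u - k * F v - k * d * (u - v) = k * (F u - F v - d * (u - v)) by ring.
rewrite normrM (@le_trans _ _ ((`|k| + 1) * (e / (`|k| + 1) * `|u - v|)))//.
  by apply: ler_pM => //; [rewrite lerDl|apply: HF].
by rewrite mulrA mulrCA divff ?gt_eqF// mulr1.
Qed.

Lemma sderivN A F x d : sderiv A F x d -> sderiv A (fun u => - F u) x (- d).
Proof.
move=> /(@sderivZ _ _ _ _ (-1)); rewrite mulN1r => h.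
by apply: sderiv_eq_near ltr01 _ h => u v _ _ _ _; rewrite !mulN1r.
Qed.

(** A pair straddling [x] is cut at [x]; the two errors add up without loss since
    [|u - x| + |x - v|] is then [|u - v|]. *)
Lemma sderiv_glue F x d : sderiv [set u | x <= u] F x d ->
  sderiv [set u | u <= x] F x d -> sderiv setT F x d.
Proof.
move=> hr hl e e0; have [r r0 Hr] := hr _ e0; have [s s0 Hl] := hl _ e0.
exists (Num.min r s); first by rewrite lt_min r0 s0.
have main (u v : R) : u <= v -> `|u - x| < Num.min r s -> `|v - x| < Num.min r s ->
    `|F u - F v - d * (u - v)| <= e * `|u - v|.
  rewrite !lt_min => uv /andP[ur us] /andP[vr vs].
  have [xu|ux] := leP x u; first by apply: Hr => //=; lra.
  have [vx|xv] := leP v x; first by apply: Hl => //=; lra.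
  have h1 : `|F u - F x - d * (u - x)| <= e * `|u - x|.
    by apply: Hl => //=; rewrite ?subrr ?normr0 ?ltW.
  have h2 : `|F x - F v - d * (x - v)| <= e * `|x - v|.
    by apply: Hr => //=; rewrite ?subrr ?normr0 ?ltW.
  have -> : F u - F v - d * (u - v) =
   (F u - F x - d * (u - x)) + (F x - F v - d * (x - v)) by ring.
  rewrite (le_trans (ler_normD _ _))// (le_trans (lerD h1 h2))// -mulrDr.
  rewrite (ler_wpM2l (ltW e0))// ltr0_norm ?subr_lt0// ltr0_norm ?subr_lt0//.
  by rewrite ltr0_norm; lra.
move=> u v _ _ hu hv; have [uv|vu] := leP u v; first exact: main.
have -> : F u - F v - d * (u - v) = - (F v - F u - d * (v - u)) by ring.
by rewrite normrN [`|u - v|]distrC; apply: main => //; apply: ltW.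
Qed.

Lemma sderiv_affine A F (a k x d : R) : 0 < k -> sderiv A F a d ->
  sderiv [set u | A (a + k * (u - x))] (fun u => F (a + k * (u - x))) x (k * d).
Proof.
move=> k0 hF e e0; have [r r0 H] := hF _ (divr_gt0 e0 k0).
exists (r / k); first by rewrite divr_gt0.
move=> u v /= Au Av ur vr.
have kE w : `|w - x| < r / k -> `|a + k * (w - x) - a| < r.
  move=> h; rewrite addrAC subrr add0r normrM gtr0_norm//.
  by rewrite -ltr_pdivlMl// mulrC.
have /(_ Au Av (kE _ ur) (kE _ vr)) := H (a + k * (u - x)) (a + k * (v - x)).
have -> : a + k * (u - x) - (a + k * (v - x)) = k * (u - v) by ring.
rewrite [d * _]mulrA [d * k]mulrC [`|k * (u - v)|]normrM (gtr0_norm k0).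
by rewrite [leRHS]mulrA mulrVK ?unitfE ?gt_eqF.
Qed.

Lemma sderiv_abs_pos F x d : 0 < d -> F x = 0 -> sderiv setT F x d ->
  sderiv [set u | x <= u] (fun u => `|F u|) x d /\
  sderiv [set u | u <= x] (fun u => `|F u|) x (- d).
Proof.
move=> d0 Fx0 h.
(* The tolerance [d] is already enough: comparing [u] with [x] shows that near [x] the value [F u]
   never has the sign opposite to [u - x]. *)
have [r r0 H] := h _ d0.
have sgn u : `|u - x| < r -> `|F u - d * (u - x)| <= d * `|u - x|.
  have := H u x I I; rewrite subrr normr0 Fx0 subr0 => Hu ur; exact: Hu.
split.
  apply: (@sderiv_eq_near _ _ F _ _ r) => //; last exact: sderiv_subset h.
  have pos u : x <= u -> `|u - x| < r -> `|F u| = F u.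
    move=> xu /sgn; rewrite (@ger0_norm _ (u - x)) ?subr_ge0// ler_norml => /andP[+ _].
    by move=> h1; apply: ger0_norm; lra.
  by move=> u v /= xu xv ur vr; rewrite !pos.
apply: (@sderiv_eq_near _ _ (fun u => - F u) _ _ r) => //.
  have neg u : u <= x -> `|u - x| < r -> `|F u| = - F u.
    move=> xu /sgn; rewrite (@ler0_norm _ (u - x)) ?subr_le0// ler_norml => /andP[_ +].
    by move=> h1; apply: ler0_norm; lra.
  by move=> u v /= xu xv ur vr; rewrite !neg.
exact/sderivN/(sderiv_subset _ h).
Qed.

Lemma sderiv_continuous F x d : sderiv setT F x d ->
  forall e, 0 < e -> exists2 r : R, 0 < r & forall u, `|u - x| < r -> `|F u - F x| < e.
Proof.
move=> h e e0; have [r r0 H] := h _ ltr01.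
have k0 : 0 < `|d| + 1 by rewrite ltr_wpDl.
exists (Num.min r (e / (`|d| + 1))); first by rewrite lt_min r0 divr_gt0.
move=> u; rewrite lt_min => /andP[ur us].
have /(_ I I ur) := H u x; rewrite subrr normr0 => /(_ r0) h1.
have -> : F u - F x = (F u - F x - d * (u - x)) + d * (u - x) by ring.
rewrite (le_lt_trans (ler_normD _ _))// (@le_lt_trans _ _ ((`|d| + 1) * `|u - x|))//.
  by rewrite normrM mulrDl addrC lerD.
by rewrite -ltr_pdivlMl// mulrC.
Qed.

(* Where F vanishes to first order or not at all, taking absolute values does
   no harm. *)
Lemma sderiv_abs_smooth F x d : (F x = 0 -> d = 0) -> sderiv setT F x d ->
  exists d', sderiv setT (fun u => `|F u|) x d' /\ (F x = 0 -> d' = 0).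
Proof.
move=> Fd h; have [Fx0|Fx0] := eqVneq (F x) 0.
  exists 0; split => // e e0; have [r r0 H] := h _ e0; exists r => // u v _ _ ur vr.
  rewrite mul0r subr0 (le_trans (ler_dist_dist _ _))//.
  by have := H u v I I ur vr; rewrite (Fd Fx0) mul0r subr0.
have aF : 0 < `|F x| by rewrite normr_gt0.
have [r r0 H] := sderiv_continuous h aF.
have [Fp|Fn] := ltP 0 (F x).
  exists d; split; last by move/eqP; rewrite (negPf Fx0).
  apply: sderiv_eq_near r0 _ h => u v _ _ /H hu /H hv.
  move: hu hv; rewrite (gtr0_norm Fp) !ltr_norml => /andP[hu _] /andP[hv _].
  by rewrite !gtr0_norm//; lra.
exists (- d); split; last by move/eqP; rewrite (negPf Fx0).
apply: sderiv_eq_near r0 _ (sderivN h) => u v _ _ /H hu /H hv.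
move: hu hv; rewrite (ler0_norm Fn) !ltr_norml => /andP[_ hu] /andP[_ hv].
by rewrite !ltr0_norm//; lra.
Qed.

(** Relative to [A], so that at a break each one-sided derivative can be inverted on its own. The
    Lipschitz bound keeps [G u] near [G x] and absorbs the error, whence the tolerance
    [e * d / L]. *)
Lemma sderiv_inv A F G x d (L : R) : 0 < L -> cancel G F -> 0 < d ->
  (forall u v, `|G u - G v| <= L * `|u - v|) ->
  sderiv A F (G x) d -> sderiv [set u | A (G u)] G x d^-1.
Proof.
move=> L0 GK d0 lipG h e e0.
have [r r0 H] := h (e * d / L) (divr_gt0 (mulr_gt0 e0 d0) L0).
exists (r / L); first by rewrite divr_gt0.
have cG w : `|w - x| < r / L -> `|G w - G x| < r.
  by move=> h1; rewrite (le_lt_trans (lipG _ _))// -ltr_pdivlMl// mulrC.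
move=> u v /= Au Av ur vr.
have := H _ _ Au Av (cG _ ur) (cG _ vr); rewrite !GK => h1.
have -> : G u - G v - d^-1 * (u - v) = - d^-1 * (u - v - d * (G u - G v)).
  by field; rewrite gt_eqF.
rewrite normrM normrN (@gtr0_norm _ d^-1) ?invr_gt0// ler_pdivrMl//.
apply: (le_trans h1).
have -> : d * (e * `|u - v|) = (e * d / L) * (L * `|u - v|) by field; rewrite gt_eqF.
by rewrite ler_wpM2l// divr_ge0 ?mulr_ge0 ?ltW.
Qed.

Lemma sderiv_is_derive F x d : sderiv setT F x d -> is_derive x 1 F d.
Proof.
move=> h.
have cv : (fun k => k^-1 *: (F (k *: 1 + x) - F x)) @ 0^' --> d.
  apply/cvgrPdist_le => e e0; have [r r0 H] := h _ e0.
  near=> k.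
  have k0 : k != 0 by near: k; apply: nbhs_dnbhs_neq.
  have kr : `|k| < r by near: k; apply: dnbhs0_lt.
  have := H (k + x) x I I; rewrite addrK subrr normr0 => /(_ kr r0) h1.
  rewrite /GRing.scale /= mulr1 distrC.
  have -> : k^-1 * (F (k + x) - F x) - d = k^-1 * (F (k + x) - F x - d * k) by field.
  by rewrite normrM normfV ler_pdivrMl ?normr_gt0// [leRHS]mulrC.
apply: DeriveDef; first by apply/cvg_ex; exists d.
exact/cvg_lim.
Unshelve. all: by end_near.
Qed.

Lemma is_derive_diffE F x d v : is_derive x 1 F d ->
  differentiable F x /\ 'd F x v = v * d.
Proof.
move=> h; have dF : differentiable F x by apply/derivable1_diffP; exact: ex_derive.
split=> //; have := @derive_val _ _ _ _ _ _ _ h; rewrite deriveE// => <-.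
by rewrite -[v in LHS]mulr1 -[v * 1]/(v *: 1) linearZ.
Qed.

Lemma sderiv_C1 F (F' : R -> R) :
  (forall x, sderiv setT F x (F' x)) -> C1 F /\ continuous F'.
Proof.
move=> h.
have cF' : continuous F'.
  move=> x; apply/cvgrPdist_le => e e0.
  have [r r0 H] := h x _ (divr_gt0 e0 (@ltr0Sn _ 1)).
  near=> y.
  have yr : `|y - x| < r / 2.
    near: y; exists (r / 2) => /=; first by rewrite divr_gt0.
    by move=> z /=; rewrite distrC.
  have [s s0 H'] := h y _ (divr_gt0 e0 (@ltr0Sn _ 1)).
  (* The pair [(y + t, y)] is near both points, so its difference quotient is within [e / 2] of
     [F' x] and of [F' y]. *)
  pose t := Num.min (r / 2) (s / 2).
  have t0 : 0 < t by rewrite lt_min !divr_gt0.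
  have tr : t <= r / 2 by rewrite ge_min lexx.
  have ts : t <= s / 2 by rewrite ge_min lexx orbT.
  have h1 := H (y + t) y I I; have h2 := H' (y + t) y I I.
  have yt : y + t - y = t by ring.
  rewrite yt subrr normr0 (gtr0_norm t0) in h1 h2.
  have {}h1 : `|F (y + t) - F y - F' x * t| <= e / 2 * t.
    apply: h1; last lra.
    by move: yr; rewrite !ltr_norml => /andP[? ?]; apply/andP; lra.
  have {}h2 : `|F (y + t) - F y - F' y * t| <= e / 2 * t by apply: h2 => //; lra.
  have : `|F' x - F' y| * t <= e * t.
    rewrite -{1}(gtr0_norm t0) -normrM.
    have -> : (F' x - F' y) * t = (F (y + t) - F y - F' y * t) -
                               (F (y + t) - F y - F' x * t) by ring.
    by rewrite (le_trans (ler_normB _ _))// [e in leRHS]splitr mulrDl lerD.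
  by rewrite ler_pM2r.
split=> //; split=> [x|v].
  by have [] := is_derive_diffE 0 (sderiv_is_derive (h x)).
have -> : (fun x => 'd F x v) = (fun x => v * F' x).
  by apply/funext => x; have [] := is_derive_diffE v (sderiv_is_derive (h x)).
move=> x; apply: cvgM; [exact: cvg_cst|exact: cF'].
Unshelve. all: by end_near.
Qed.

Lemma is_derive_sderiv F (F' : R -> R) :
  (forall x, is_derive x 1 F (F' x)) -> continuous F' ->
  forall x, sderiv setT F x (F' x).
Proof.
move=> dF cF' x e e0.
have /cvgrPdist_le /(_ _ e0)[r /= r0 H] := cF' x.
exists r => // u v _ _; wlog uv : u v / u <= v.
  move=> W; have [uv|vu] := leP u v; first exact: W.
  move=> ur vr; have := W v u (ltW vu) vr ur.
  have -> : F u - F v - F' x * (u - v) = - (F v - F u - F' x * (v - u)) by ring.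
  by rewrite normrN [`|u - v|]distrC.
move=> ur vr; have [<-|uv'] := eqVneq u v.
  by rewrite !subrr mulr0 subrr normr0 mulr0.
have {uv' uv} uv : u < v by rewrite lt_neqAle uv' uv.
have cF : {within `[u, v], continuous F}.
  apply: derivable_within_continuous => z _; exact: ex_derive.
have [z zuv Fz] := MVT uv (fun z _ => dF z) cF.
have -> : F u - F v - F' x * (u - v) = (F' x - F' z) * (v - u).
  by rewrite mulrBl -Fz; ring.
rewrite normrM [`|u - v|]distrC ler_wpM2r// H//=.
move: zuv; rewrite in_itv /= => /andP[uz zv].
by move: ur vr; rewrite !ltr_norml => /andP[? ?] /andP[? ?]; apply/andP; lra.
Qed.

Lemma is_derive_lip F (F' : R -> R) (K : R) :
  (forall x, is_derive x 1 F (F' x)) -> (forall x, `|F' x| <= K) ->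
  forall u v, `|F u - F v| <= K * `|u - v|.
Proof.
move=> dF bF u v; wlog uv : u v / u <= v.
  move=> W; have [uv|/ltW vu] := leP u v; first exact: W.
  by rewrite distrC [`|u - v|]distrC W.
have [<-|uv'] := eqVneq u v; first by rewrite !subrr normr0 mulr0.
have {uv' uv} uv : u < v by rewrite lt_neqAle uv' uv.
have cF : {within `[u, v], continuous F}.
  apply: derivable_within_continuous => z _; exact: ex_derive.
have [z zuv Fz] := MVT uv (fun z _ => dF z) cF.
by rewrite distrC Fz normrM distrC ler_wpM2r// [`|u - v|]distrC.
Qed.

End StrongDerivative.

(** * Sums over the integers with quadratic decay *)

Section IntSums.
Variable R : realType.
Implicit Types (f g : int -> R) (k : int) (n m : nat).

(* The offset 40 keeps all the gap maps below 1/2-close to the identity in the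
   Lipschitz sense. *)
Definition mag k : R := 40 + `|k%:~R|.

Lemma mag_ge40 k : 40 <= mag k. Proof. by rewrite lerDl. Qed.

Lemma mag_gt0 k : 0 < mag k. Proof. exact: lt_le_trans (mag_ge40 k). Qed.

Lemma magPosz n : mag (Posz n) = 40 + n%:R.
Proof. by rewrite /mag normr_nat. Qed.

Lemma magNegz n : mag (Negz n) = 41 + n%:R.
Proof. by rewrite /mag NegzE mulrNz normrN normr_nat -natr1; lra. Qed.

Lemma ler_mag_succ k : mag k <= 2 * mag (k + 1).
Proof.
have := ler_normB ((k + 1)%:~R : R) 1.
rewrite /mag intrD addrK normr1; have := normr_ge0 ((k%:~R : R) + 1); lra.
Qed.

Definition dominated f := exists C : R, forall k, `|f k| * mag k ^+ 2 <= C.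

(** As [Negz i] is [-(i + 1)], the window is [-n, ..., n - 1]. *)
Definition zpart f n : R := \sum_(i < n) (f (Posz i) + f (Negz i)).

Lemma zpartS f n : zpart f n.+1 = zpart f n + (f (Posz n) + f (Negz n)).
Proof. by rewrite /zpart big_ord_recr. Qed.

Definition zsum f : R := limn (zpart f).

(** Telescoping: [mag] is at least [40 + m] on both indices added at stage [m], and [(40 + m) ^- 2]
    is at most [(39 + m)^-1 - (40 + m)^-1]; hence the 39. *)
Lemma zpart_tail f (C : R) n m : (n <= m)%N ->
  (forall k, `|f k| * mag k ^+ 2 <= C) ->
  `|zpart f m - zpart f n| <= 2 * C / (39 + n%:R).
Proof.
move=> nm fC; have C0 : 0 <= C.
  by apply: le_trans (fC 0); rewrite mulr_ge0 ?sqr_ge0.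
suff : `|zpart f m - zpart f n| <= 2 * C * ((39 + n%:R)^-1 - (39 + m%:R)^-1).
  move=> /le_trans; apply; rewrite ler_wpM2l ?mulr_ge0// gerBl invr_ge0.
  by rewrite addr_ge0.
elim: m nm => [|m IH]; first by rewrite leqn0 => /eqP ->; rewrite !subrr normr0 mulr0.
rewrite leq_eqVlt => /predU1P[->|]; first by rewrite !subrr normr0 mulr0.
rewrite ltnS => /IH {}IH; rewrite zpartS addrAC.
rewrite (le_trans (ler_normD _ _))//.
have m0 : 0 <= m%:R :> R by [].
have bP : `|f (Posz m)| <= C * ((39 + m%:R)^-1 - (39 + m.+1%:R)^-1).
  have := fC (Posz m); rewrite magPosz -ler_pdivlMr ?exprn_gt0 ?ltr_wpDr//.
  move=> /le_trans; apply; rewrite ler_wpM2l//.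
  have -> : (39 + m%:R)^-1 - (39 + m.+1%:R)^-1 = ((39 + m%:R) * (40 + m%:R))^-1 :> R.
    by rewrite -natr1; field; rewrite !gt_eqF; lra.
  by rewrite lef_pV2 ?posrE ?expr2 ?mulr_gt0 ?ler_pM; lra.
have bN : `|f (Negz m)| <= C * ((39 + m%:R)^-1 - (39 + m.+1%:R)^-1).
  have := fC (Negz m); rewrite magNegz -ler_pdivlMr ?exprn_gt0 ?ltr_wpDr//.
  move=> /le_trans; apply; rewrite ler_wpM2l//.
  have -> : (39 + m%:R)^-1 - (39 + m.+1%:R)^-1 = ((39 + m%:R) * (40 + m%:R))^-1 :> R.
    by rewrite -natr1; field; rewrite !gt_eqF; lra.
  by rewrite lef_pV2 ?posrE ?expr2 ?mulr_gt0 ?ler_pM; lra.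
have := ler_normD (f (Posz m)) (f (Negz m)); lra.
Qed.

Lemma small_tail (C e : R) : 0 < e -> \forall n \near \oo, 2 * C / (39 + n%:R) < e.
Proof.
move=> e0; near=> n.
rewrite ltr_pdivrMr ?ltr_wpDr// mulrDr.
have : 2 * C / e < n%:R by near: n; exact: nbhs_infty_gtr.
by rewrite ltr_pdivrMr// [ltRHS]mulrC => h; lra.
Unshelve. all: by end_near. Qed.

Lemma is_cvg_zpart f : dominated f -> cvgn (zpart f).
Proof.
move=> [C fC]; apply/cauchy_cvgP/cauchy_exP => e e0.
have [n _ /(_ n (leqnn n)) nC] := small_tail C e0.
exists (zpart f n); exists n => // m /= nm.
by rewrite -ball_normE /= distrC (le_lt_trans (zpart_tail nm fC)).
Qed.

Lemma zsum_tail f (C : R) n : (forall k, `|f k| * mag k ^+ 2 <= C) ->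
  `|zsum f - zpart f n| <= 2 * C / (39 + n%:R).
Proof.
move=> fC; have cf : zpart f @ \oo --> zsum f by apply: is_cvg_zpart; exists C.
have cg : (fun m => `|zpart f m - zpart f n|) @ \oo --> `|zsum f - zpart f n|.
  by apply: cvg_norm; apply: cvgB => //; exact: cvg_cst.
rewrite -(cvg_lim _ cg)//; apply: limr_le; first by apply/cvg_ex; eexists; exact: cg.
by exists n => // m /= nm; exact: zpart_tail.
Qed.

Lemma zsum_unique f (L D : R) :
  (forall n, `|L - zpart f n| <= D / (39 + n%:R)) -> zsum f = L.
Proof.
move=> h; apply/cvg_lim => //; apply/cvgrPdist_lt => e e0.
near=> n; rewrite (le_lt_trans (h n))//.
have -> : D = 2 * (D / 2) by field.
by near: n; exact: small_tail.
Unshelve. all: by end_near. Qed.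

Lemma dominatedD f g : dominated f -> dominated g -> dominated (fun k => f k + g k).
Proof.
move=> [C fC] [D gD]; exists (C + D) => k.
by rewrite (le_trans _ (lerD (fC k) (gD k)))// -mulrDl ler_wpM2r ?sqr_ge0 ?ler_normD.
Qed.

Lemma dominatedZ f (a : R) : dominated f -> dominated (fun k => a * f k).
Proof.
by move=> [C fC]; exists (`|a| * C) => k; rewrite normrM -mulrA ler_wpM2l.
Qed.

Lemma dominatedN f : dominated f -> dominated (fun k => - f k).
Proof. by move=> [C fC]; exists C => k; rewrite normrN. Qed.

Lemma dominatedB f g : dominated f -> dominated g -> dominated (fun k => f k - g k).
Proof. by move=> df dg; apply: dominatedD => //; exact: dominatedN. Qed.

Lemma dominated_le f g : (forall k, `|f k| <= `|g k|) -> dominated g -> dominated f.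
Proof.
move=> fg [C gC]; exists C => k.
by apply: le_trans (gC k); rewrite ler_wpM2r ?sqr_ge0.
Qed.

Lemma dominated_delta k (a : R) : dominated (fun j => if j == k then a else 0).
Proof.
exists (`|a| * mag k ^+ 2) => j; case: eqP => [->//|_].
by rewrite normr0 mul0r mulr_ge0 ?sqr_ge0.
Qed.

Lemma dominated_succ f : dominated f -> dominated (fun k => f (k + 1)).
Proof.
move=> [C fC]; exists (4 * C) => k.
apply: (@le_trans _ _ (4 * (`|f (k + 1)| * mag (k + 1) ^+ 2))); last by rewrite ler_wpM2l.
rewrite /= [leRHS]mulrCA ler_wpM2l//.
have := ler_mag_succ k; have := mag_gt0 k; have := mag_gt0 (k + 1); nra.
Qed.

Lemma zpartD f g n : zpart (fun k => f k + g k) n = zpart f n + zpart g n.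
Proof. by rewrite /zpart -big_split; apply: eq_bigr => i _; rewrite addrACA. Qed.

Lemma zpartZ f (a : R) n : zpart (fun k => a * f k) n = a * zpart f n.
Proof. by rewrite /zpart mulr_sumr; apply: eq_bigr => i _; rewrite mulrDr. Qed.

Lemma ler_zpart f g n : (forall k, f k <= g k) -> zpart f n <= zpart g n.
Proof. by move=> fg; apply: ler_sum => i _; rewrite lerD. Qed.

Lemma zsumD f g : dominated f -> dominated g ->
  zsum (fun k => f k + g k) = zsum f + zsum g.
Proof.
move=> [C fC] [D gD]; apply: (@zsum_unique _ _ (2 * C + 2 * D)) => n.
rewrite zpartD opprD addrACA (le_trans (ler_normD _ _))// mulrDl lerD//.
  exact: zsum_tail.
exact: zsum_tail.
Qed.

Lemma zsumZ f (a : R) : dominated f -> zsum (fun k => a * f k) = a * zsum f.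
Proof.
move=> [C fC]; apply: (@zsum_unique _ _ (`|a| * (2 * C))) => n.
by rewrite zpartZ -mulrBr normrM -mulrA ler_wpM2l//; exact: zsum_tail.
Qed.

Lemma zsumN f : dominated f -> zsum (fun k => - f k) = - zsum f.
Proof.
move=> df; rewrite -mulN1r -zsumZ//; congr zsum; apply/funext => k.
by rewrite mulN1r.
Qed.

Lemma zsumB f g : dominated f -> dominated g ->
  zsum (fun k => f k - g k) = zsum f - zsum g.
Proof. by move=> df dg; rewrite zsumD ?zsumN//; exact: dominatedN. Qed.

Lemma ler_zsum f g : dominated f -> dominated g -> (forall k, f k <= g k) ->
  zsum f <= zsum g.
Proof.
move=> df dg fg; apply: ler_lim; [exact: is_cvg_zpart|exact: is_cvg_zpart|].
by exists 0%N => // n _ /=; exact: ler_zpart.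
Qed.

Lemma zsum_delta k (a : R) : zsum (fun j => if j == k then a else 0) = a.
Proof.
apply/cvg_lim => //; apply: cvg_near_cst; exists `|k|.+1%N => // n /= kn.
rewrite /zpart; case: k kn => m /= mn.
  rewrite (bigD1 (Ordinal mn))//= eqxx addr0 big1 ?addr0// => i im.
  by rewrite addr0 ifN//; apply: contra im => /eqP[im]; apply/eqP/val_inj.
have mn' : (m < n)%N by lia.
rewrite (bigD1 (Ordinal mn'))//= eqxx add0r big1 ?addr0// => i im.
by rewrite add0r ifN//; apply: contra im => /eqP[im]; apply/eqP/val_inj.
Qed.

Lemma zsum_ge_term f k : dominated f -> (forall k, 0 <= f k) -> f k <= zsum f.
Proof.
move=> df f0; rewrite -{1}(@zsum_delta k (f k)); apply: ler_zsum => //.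
  exact: dominated_delta.
by move=> j; case: ifP => // /eqP ->.
Qed.

Lemma ler_norm_zsum f g : dominated g -> (forall k, `|f k| <= g k) ->
  `|zsum f| <= zsum g.
Proof.
move=> dg fg; have df : dominated f.
  by apply: dominated_le dg => k; apply: le_trans (fg k) (ler_norm _).
rewrite ler_norml -zsumN//; apply/andP; split; apply: ler_zsum => //.
- exact: dominatedN.
- by move=> k; have := fg k; rewrite ler_norml => /andP[].
- by move=> k; have := fg k; rewrite ler_norml => /andP[].
Qed.

Lemma zsum_update f k (a : R) : dominated f ->
  zsum (fun j => if j == k then a else f j) = zsum f + (a - f k).
Proof.
move=> df; rewrite -[X in _ + X](zsum_delta k) -zsumD//; last exact: dominated_delta.
by congr zsum; apply/funext => j; case: eqP => [->|]; rewrite ?addr0// addrC subrK.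
Qed.

(** The shifted window gains the index [n] and loses [-n]; both boundary terms vanish in the limit,
    which makes [zsum] invariant under translation. *)
Lemma zpart_succ f n :
  zpart (fun k => f (k + 1)) n - zpart f n = f (Posz n) - f (- (Posz n)).
Proof.
elim: n => [|n IH]; first by rewrite /zpart !big_ord0 subrr; exact/esym/subrr.
rewrite !zpartS.
have -> : Posz n + 1 = Posz n.+1 by lia.
have -> : Negz n + 1 = - (Posz n) by lia.
rewrite /= NegzE; move: IH; set a := zpart _ n; set b := zpart _ n; lra.
Qed.

Lemma zsum_succ f : dominated f -> zsum (fun k => f (k + 1)) = zsum f.
Proof.
move=> [C fC]; apply: (@zsum_unique _ _ (2 * C + 2 * C)) => n.
have -> : zsum f - zpart (fun k => f (k + 1)) n =
  (zsum f - zpart f n) - (f (Posz n) - f (- (Posz n))) by rewrite -zpart_succ; ring.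
rewrite (le_trans (ler_normB _ _))// mulrDl lerD//; first exact: zsum_tail.
have h k : `|k%:~R| = n%:R :> R -> `|f k| <= C / (39 + n%:R).
  move=> kn; have := fC k; rewrite /mag kn => h; rewrite ler_pdivlMr ?ltr_wpDr//.
  apply: le_trans h; rewrite ler_wpM2l//.
  by have : 0 <= n%:R :> R by []; nra.
have h1 := h (Posz n) (normr_nat _ _).
have h2 : `|f (- Posz n)| <= C / (39 + n%:R) by apply: h; rewrite mulrNz normrN normr_nat.
rewrite (le_trans (ler_normB _ _))//; lra.
Qed.

(** Dominated convergence for terms that eventually equal their limits. This form suits [lo], whose
    integer values are constant on a small interval on either side of a level. *)
Lemma zsum_tannery (T : Type) (F : set_system T) (FF : ProperFilter F)
    (f : T -> int -> R) (g : int -> R) (C : R) :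
  (\forall u \near F, forall k, `|f u k| * mag k ^+ 2 <= C) ->
  (forall k, `|g k| * mag k ^+ 2 <= C) ->
  (forall k, \forall u \near F, f u k = g k) ->
  zsum (f u) @[u --> F] --> zsum g.
Proof.
move=> fC gC fg; apply/cvgrPdist_lt => e e0.
have [n _ /(_ n (leqnn n)) nC] := small_tail C (divr_gt0 e0 (@ltr0Sn _ 1)).
have eqn m : \forall u \near F, zpart (f u) m = zpart g m.
  elim: m => [|m IH]; first by near=> u; rewrite /zpart !big_ord0.
  near=> u; rewrite !zpartS.
  have -> : zpart (f u) m = zpart g m by near: u.
  have -> : f u (Posz m) = g (Posz m) by near: u; exact: fg.
  by have -> : f u (Negz m) = g (Negz m) by near: u; exact: fg.
near=> u.
have -> : zsum g - zsum (f u) =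
  (zsum g - zpart g n) - (zsum (f u) - zpart (f u) n).
  have -> : zpart (f u) n = zpart g n by near: u; exact: eqn.
  ring.
rewrite (le_lt_trans (ler_normB _ _))// [e]splitr ltrD//.
  exact: le_lt_trans (zsum_tail _ gC) _.
apply: le_lt_trans (zsum_tail n _) nC.
by near: u.
Unshelve. all: by end_near. Qed.

End IntSums.

(** * The blown-up line and its coordinates *)

Section Coordinates.
Variable R : realType.
Implicit Types (x y u v z : R) (s t : int -> R) (k j : int).

(** Three consecutive factors rather than a cube: in the ratio of two neighbouring lengths all but
    one factor cancels, which makes [dilat] elementary. *)
Definition wt k : R := (mag R k * (mag R k + 1) * (mag R k + 2))^-1.

Lemma wt_gt0 k : 0 < wt k.
Proof. by have := mag_gt0 R k => m0; rewrite invr_gt0 !mulr_gt0//; lra. Qed.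

Lemma wt_ge0 k : 0 <= wt k. Proof. exact/ltW/wt_gt0. Qed.

Lemma wt_mag k : wt k * mag R k ^+ 2 * mag R k <= 1.
Proof.
have m0 := mag_gt0 R k; rewrite /wt -mulrA ler_pdivrMl ?mulr1; last first.
  by rewrite !mulr_gt0//; lra.
by rewrite expr2; nra.
Qed.

Lemma wt_bound s (C : R) k : `|s k| <= C * mag R k -> `|wt k * s k| * mag R k ^+ 2 <= C.
Proof.
move=> h; have m0 := mag_gt0 R k; have w0 := wt_gt0 k.
have C0 : 0 <= C by rewrite -(pmulr_lge0 _ m0); apply: le_trans h.
rewrite normrM (gtr0_norm w0) (@le_trans _ _ (C * (wt k * mag R k ^+ 2 * mag R k)))//.
  have -> : C * (wt k * mag R k ^+ 2 * mag R k) = wt k * (C * mag R k) * mag R k ^+ 2.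
    by ring.
  by rewrite ler_wpM2r ?sqr_ge0// ler_wpM2l// ltW.
by rewrite -[leRHS]mulr1 ler_wpM2l// wt_mag.
Qed.

Lemma dominated_wt s (C : R) : (forall k, `|s k| <= C * mag R k) ->
  dominated (fun k => wt k * s k).
Proof. by move=> h; exists C => k; exact: wt_bound. Qed.

Lemma dominated_wt1 : dominated wt.
Proof.
have : dominated (fun k => wt k * 1).
  by apply: (@dominated_wt _ 1) => k; rewrite normr1 mul1r; have := mag_ge40 R k; lra.
by congr dominated; apply/funext => k; rewrite mulr1.
Qed.

(** What the gaps leave of a period of length 1. Its positivity makes [pt] strictly increasing in
    the level. *)
Definition slack : R := 1 - zsum wt.

Lemma slack_gt0 : 0 < slack.
Proof.
have : `|zsum wt - zpart wt 0| <= 2 * 1 / (39 + 0%:R).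
  apply: zsum_tail => k; rewrite gtr0_norm ?wt_gt0//.
  have := wt_mag k; have := mag_ge40 R k; have := wt_gt0 k => w0 m0 h.
  have : 0 <= wt k * mag R k ^+ 2 by rewrite mulr_ge0 ?sqr_ge0// ltW.
  by move=> h1; nra.
rewrite /zpart big_ord0 subr0 mulr0n addr0 ler_norml => /andP[_ h].
by rewrite /slack; lra.
Qed.

Lemma slack_ge0 : 0 <= slack. Proof. exact/ltW/slack_gt0. Qed.

Definition rho : R := pi.

Lemma rho_irrational (n m : int) : n%:~R * rho = m%:~R -> n = 0.
Proof.
move=> h; apply/eqP; apply: contra_notT (@pi_irrationnal R) => n0.
exists (m%:~R / n%:~R) => //; rewrite fmorph_div /= !ratr_int -h.
by rewrite mulrAC divff ?mul1r// intr_eq0.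
Qed.

Lemma rho_gt0 : 0 < rho. Proof. exact: pi_gt0. Qed.

(* For an integer n, [s k] lies between the least integer >= y - k * rho and
   the least integer > y - k * rho. *)
Definition valid y s := forall k (n : int),
  (n%:~R < y - k%:~R * rho -> n%:~R + 1 <= s k) /\
  (y - k%:~R * rho < n%:~R -> s k <= n%:~R).

(* Blow-up of the orbit of 0 under the rotation by rho: each point k * rho + n
   is replaced by an interval of length [wt k], called a translate of the gap k,
   and [s k] tells how far these translates have been travelled through. *)
Definition pt y s : R := slack * y + zsum (fun k => wt k * s k).

Lemma valid_itv y s k : valid y s -> y - k%:~R * rho <= s k <= y - k%:~R * rho + 1.
Proof.
move=> /(_ k) h; set z := y - _ in h *.
have /andP[f1 f2] := floor_itv z; have /andP[c1 c2] := ceil_itv z.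
have [_ /(_ f2)] := h (Num.floor z + 1); rewrite intrD => h1.
have [/(_ _)/(le_trans _) h2 _] := h (Num.ceil z - 1).
apply/andP; split; last by lra.
apply: (le_trans c2).
have [/(_ c1)] := h (Num.ceil z - 1); rewrite intrD; lra.
Qed.

Lemma valid_norm y s k : valid y s -> `|s k| <= (`|y| + rho + 1) * mag R k.
Proof.
move=> /(@valid_itv _ _ k) /andP[h1 h2].
have r0 := rho_gt0; have m40 := mag_ge40 R k.
have h3 : `|k%:~R| <= mag R k by rewrite lerDr.
have h4 : `|k%:~R * rho| <= rho * mag R k.
  by rewrite normrM (gtr0_norm r0) mulrC ler_wpM2l// ltW.
have h5 : `|y| <= `|y| * mag R k by rewrite ler_peMr//; lra.
have h6 : `|s k| <= `|y| + `|k%:~R * rho| + 1.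
  have := ler_norm y; have := ler_norm (- y); rewrite normrN.
  have := ler_norm (k%:~R * rho); have := ler_norm (- (k%:~R * rho)); rewrite normrN.
  by move=> *; rewrite ler_norml; apply/andP; split; lra.
by lra.
Qed.

Lemma dominated_valid y s : valid y s -> dominated (fun k => wt k * s k).
Proof. move=> h; apply: dominated_wt => k; exact: valid_norm. Qed.

(** The integer [floor (y - k * rho) + 1] separates: it bounds [s k] from above, and [t k] from
    below because [y'] is strictly larger. *)
Lemma valid_lt y y' s t k : valid y s -> valid y' t -> y < y' -> s k <= t k.
Proof.
move=> /(_ k) hs /(_ k) ht yy'.
have /andP[f1 f2] := floor_itv (y - k%:~R * rho).
have [_ /(_ f2) h1] := hs (Num.floor (y - k%:~R * rho) + 1).
apply: (le_trans h1); rewrite intrD.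
by have [/(_ (le_lt_trans f1 _)) + _] := ht (Num.floor (y - k%:~R * rho)); apply; lra.
Qed.

Lemma pt_lt y y' s t : valid y s -> valid y' t -> y < y' ->
  pt y s + slack * (y' - y) <= pt y' t.
Proof.
move=> hs ht yy'; rewrite /pt.
have : zsum (fun k => wt k * s k) <= zsum (fun k => wt k * t k).
  apply: ler_zsum; [exact: dominated_valid hs|exact: dominated_valid ht|].
  by move=> k; rewrite (ler_wpM2l (wt_ge0 k))//; exact: valid_lt yy'.
lra.
Qed.

Lemma valid_nint y s t k : valid y s -> valid y t -> s k != t k ->
  exists n : int, y - k%:~R * rho = n%:~R.
Proof.
move=> /(_ k) hs /(_ k) ht; set z := y - _ in hs ht *.
have /andP[f1 f2] := floor_itv z; move=> st; exists (Num.floor z).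
apply/eqP; move: f1; rewrite le_eqVlt => /predU1P[->//|f1].
have [_ /(_ f2) h1] := hs (Num.floor z + 1); have [/(_ f1) h2 _] := hs (Num.floor z).
have [_ /(_ f2) h3] := ht (Num.floor z + 1); have [/(_ f1) h4 _] := ht (Num.floor z).
rewrite intrD in h1 h3; case/eqP: st; lra.
Qed.

(** Irrationality of [rho]: the orbit of 0 visits each point of the circle at most once, so at most
    one gap is inserted at a given level. *)
Lemma level_unique y k j (n m : int) :
  y - k%:~R * rho = n%:~R -> y - j%:~R * rho = m%:~R -> k = j.
Proof.
move=> h1 h2; apply/eqP; rewrite -subr_eq0; apply/eqP.
by apply: (@rho_irrational _ (m - n)); rewrite !intrD !mulrNz mulrDl -h1 -h2; ring.
Qed.

Lemma valid_single y s t k j : valid y s -> valid y t -> s k != t k -> j != k ->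
  s j = t j.
Proof.
move=> hs ht st jk; apply/eqP; apply: contraNT jk => st'.
have [n hn] := valid_nint hs ht st; have [m hm] := valid_nint hs ht st'.
exact/eqP/(level_unique hm hn).
Qed.

Lemma pt_update y s k (a : R) : dominated (fun k => wt k * s k) ->
  pt y (fun j => if j == k then a else s j) = pt y s + wt k * (a - s k).
Proof.
move=> ds; rewrite /pt -addrA; congr (_ + _).
rewrite mulrBr -(zsum_update k (wt k * a) ds); congr zsum; apply/funext => j.
by case: eqP => // ->.
Qed.

Lemma pt_same y s t k : valid y s -> valid y t -> s k < t k ->
  pt y t = pt y s + wt k * (t k - s k).
Proof.
move=> hs ht st; rewrite -pt_update; last exact: dominated_valid hs.
congr pt; apply/funext => j; case: eqP => [->//|/eqP jk].
by apply/esym/(valid_single hs ht _ jk); rewrite lt_eqF.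
Qed.

(** [pt] is strictly increasing in the level and, at a fixed level, in the single coordinate on
    which two admissible families can differ. *)
Lemma pt_inj y y' s t : valid y s -> valid y' t -> pt y s = pt y' t ->
  y = y' /\ s =1 t.
Proof.
move=> hs ht e; have c0 := slack_gt0.
have yy' : y = y'.
  have [h|h|//] := ltgtP y y'.
    have := pt_lt hs ht h; have : 0 < slack * (y' - y) by apply: mulr_gt0 => //; rewrite subr_gt0.
    by lra.
  have := pt_lt ht hs h; have : 0 < slack * (y - y') by apply: mulr_gt0 => //; rewrite subr_gt0.
  by lra.
split=> // k; subst y'.
have [h|h|//] := ltgtP (s k) (t k).
  have := pt_same hs ht h; have : 0 < wt k * (t k - s k) by apply: mulr_gt0; rewrite ?wt_gt0// subr_gt0.
  by lra.
have := pt_same ht hs h; have : 0 < wt k * (s k - t k) by apply: mulr_gt0; rewrite ?wt_gt0// subr_gt0.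
by lra.
Qed.

(** [lo] and [hi] are the extreme admissible families at level [y]. They coincide off the orbit; on
    it, the segment between their two points is the inserted gap. *)
Definition lo y k : R := (Num.ceil (y - k%:~R * rho))%:~R.
Definition hi y k : R := (Num.floor (y - k%:~R * rho))%:~R + 1.

Lemma valid_lo y : valid y (lo y).
Proof.
move=> k n; rewrite /lo; split=> h.
  by rewrite -intrD1 ler_int lezD1 ceil_gt_int.
by rewrite ler_int ceil_le_int ltW.
Qed.

Lemma valid_hi y : valid y (hi y).
Proof.
move=> k n; rewrite /hi; split=> h.
  by rewrite lerD2r ler_int floor_ge_int ltW.
by rewrite -intrD1 ler_int lezD1 floor_lt_int.
Qed.

Lemma pt_convex y s t (a : R) : dominated (fun k => wt k * s k) ->
    dominated (fun k => wt k * t k) ->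
  pt y (fun k => s k + a * (t k - s k)) = pt y s + a * (pt y t - pt y s).
Proof.
move=> ds dt; rewrite /pt.
have -> : (fun k => wt k * (s k + a * (t k - s k))) =
    (fun k => wt k * s k + a * (wt k * t k - wt k * s k)).
  by apply/funext => k; ring.
rewrite zsumD//; last exact/dominatedZ/dominatedB.
rewrite zsumZ; last exact: dominatedB.
by rewrite zsumB//; ring.
Qed.

Lemma valid_convex y s t (a : R) : 0 <= a <= 1 -> valid y s -> valid y t ->
  valid y (fun k => s k + a * (t k - s k)).
Proof.
move=> /andP[a0 a1] hs ht k n; have [h1 h2] := hs k n; have [h3 h4] := ht k n.
by split=> h; [have := h1 h; have := h3 h|have := h2 h; have := h4 h]; nra.
Qed.

(** Each [s k] lies between [y - k * rho] and the same plus 1. For these two comparison families the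
    sum is explicit: the multiples of [y] recombine with [slack * y] to give [y], and the added 1
    costs [zsum wt], at most 1. *)
Lemma pt_growth : exists B : R, forall y s, valid y s -> y + B <= pt y s <= y + B + 1.
Proof.
have d1 := dominated_wt1.
have dk : dominated (fun k => wt k * k%:~R).
  by apply: (@dominated_wt _ 1) => k; rewrite mul1r lerDr.
exists (- rho * zsum (fun k => wt k * k%:~R)) => y s hs.
have E (a : R) : y - rho * zsum (fun k => wt k * k%:~R) + a * zsum wt =
  slack * y + zsum (fun k => wt k * (y - k%:~R * rho + a)).
  have -> : (fun k => wt k * (y - k%:~R * rho + a)) =
    (fun k => (y + a) * wt k + (- rho) * (wt k * k%:~R)).
    by apply/funext => k; ring.
  rewrite zsumD ?zsumZ//; try exact: dominatedZ.
  by rewrite /slack; ring.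
have da (a : R) : dominated (fun k => wt k * (y - k%:~R * rho + a)).
  have -> : (fun k => wt k * (y - k%:~R * rho + a)) =
    (fun k => (y + a) * wt k + (- rho) * (wt k * k%:~R)).
    by apply/funext => k; ring.
  by apply: dominatedD; exact: dominatedZ.
have ds := dominated_valid hs.
have w1 : zsum wt <= 1 by have := slack_gt0; rewrite /slack; lra.
apply/andP; split.
  have := E 0; rewrite mul0r addr0 mulNr => ->; rewrite lerD2l.
  apply: ler_zsum => // k; rewrite (ler_wpM2l (wt_ge0 k))//.
  by have /andP[? ?] := valid_itv k hs; lra.
apply: (@le_trans _ _ (y - rho * zsum (fun k => wt k * k%:~R) + 1 * zsum wt)); last by lra.
rewrite E /pt lerD2l.
apply: ler_zsum => // k; rewrite (ler_wpM2l (wt_ge0 k))//.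
by have /andP[? ?] := valid_itv k hs.
Qed.

Lemma valid_near_norm y s u k : `|u - y| < 1 -> valid u s ->
  `|wt k * s k| * mag R k ^+ 2 <= `|y| + rho + 2.
Proof.
move=> uy hs; apply: wt_bound; apply: le_trans (valid_norm k hs) _.
have m0 := mag_gt0 R k; rewrite ler_wpM2r ?ltW//.
have := ler_normD (u - y) y; rewrite subrK; lra.
Qed.

Lemma pt_lo_left y : pt u (lo u) @[u --> y^'-] --> pt y (lo y).
Proof.
apply: cvgD; first by apply: cvgM; [exact: cvg_cst|exact: cvg_at_left_filter cvg_id].
apply: (@zsum_tannery _ _ _ _ _ _ (`|y| + rho + 2)).
- near=> u => k; apply: valid_near_norm (@valid_lo u).
  have : u < y by near: u; exact: nbhs_left_lt.
  have : y - 1 < u by near: u; apply: nbhs_left_gt; lra.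
  by move=> *; rewrite ltr_norml; apply/andP; lra.
- by move=> k; apply: valid_near_norm (@valid_lo y); rewrite subrr normr0.
- move=> k; have /andP[c1 c2] := ceil_itv (y - k%:~R * rho); near=> u.
  congr (_ * _); rewrite /lo; congr (_%:~R); apply/eqP; rewrite ceil_eq.
  have : u < y by near: u; exact: nbhs_left_lt.
  have : (Num.ceil (y - k%:~R * rho) - 1)%:~R + k%:~R * rho < u.
    by near: u; apply: nbhs_left_gt; lra.
  by move=> *; apply/andP; lra.
Unshelve. all: by end_near. Qed.

(** The ceiling is continuous from the left, but from the right it tends to the floor plus 1: the
    limit is the far end of the gap. *)
Lemma pt_lo_right y : pt u (lo u) @[u --> y^'+] --> pt y (hi y).
Proof.
apply: cvgD; first by apply: cvgM; [exact: cvg_cst|exact: cvg_at_right_filter cvg_id].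
apply: (@zsum_tannery _ _ _ _ _ _ (`|y| + rho + 2)).
- near=> u => k; apply: valid_near_norm (@valid_lo u).
  have : y < u by near: u; exact: nbhs_right_gt.
  have : u < y + 1 by near: u; apply: nbhs_right_lt; lra.
  by move=> *; rewrite ltr_norml; apply/andP; lra.
- by move=> k; apply: valid_near_norm (@valid_hi y); rewrite subrr normr0.
- move=> k; have /andP[c1 c2] := floor_itv (y - k%:~R * rho); near=> u.
  rewrite /lo /hi -intrD1; congr (_ * _); congr (_%:~R); apply/eqP; rewrite ceil_eq addrK.
  have : y < u by near: u; exact: nbhs_right_gt.
  have : u < (Num.floor (y - k%:~R * rho) + 1)%:~R + k%:~R * rho.
    by near: u; apply: nbhs_right_lt; lra.
  by move=> *; apply/andP; lra.
Unshelve. all: by end_near. Qed.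

(** The level of [x] is the supremum of the levels whose lower point is at most [x]. The two
    one-sided limits place [x] between the ends of the fibre over it, and convex combinations of
    [lo] and [hi] fill this fibre. *)
Lemma coordinates_exist x : exists ys : R * (int -> R), valid ys.1 ys.2 /\ pt ys.1 ys.2 = x.
Proof.
have [B hB] := pt_growth.
pose S := [set y | pt y (lo y) <= x].
have hS : has_sup S.
  split.
    exists (x - B - 1); rewrite /S /=.
    by have /andP[_] := hB _ _ (@valid_lo (x - B - 1)); lra.
  by exists (x - B) => y; rewrite /S /=; have /andP[+ _] := hB _ _ (@valid_lo y); lra.
have h1 : pt (sup S) (lo (sup S)) <= x.
  apply: (cvgr_to_le (@pt_lo_left (sup S))).
  near=> u; have uS : u < sup S by near: u; exact: nbhs_left_lt.
  have uS' : 0 < sup S - u by lra.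
  have [y Sy uy] := sup_adherent uS' hS.
  rewrite (le_trans _ Sy)//; apply: le_trans (pt_lt (@valid_lo u) (@valid_lo y) _); last lra.
  by rewrite lerDl mulr_ge0 ?slack_ge0//; lra.
have h2 : x <= pt (sup S) (hi (sup S)).
  apply: (cvgr_to_ge (@pt_lo_right (sup S))).
  near=> u; have uS : sup S < u by near: u; exact: nbhs_right_gt.
  rewrite leNgt; apply/negP => /ltW Su.
  by have := ub_le_sup hS.2 Su; lra.
(* If the fibre is a single point the denominator is 0 and so is [a], which is still the right
   parameter. *)
pose a := (x - pt (sup S) (lo (sup S))) / (pt (sup S) (hi (sup S)) - pt (sup S) (lo (sup S))).
exists (sup S, fun k => lo (sup S) k + a * (hi (sup S) k - lo (sup S) k)); split.
  apply: valid_convex (@valid_lo _) (@valid_hi _).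
  apply/andP; split; first by rewrite divr_ge0; lra.
  have [e|e] := eqVneq (pt (sup S) (hi (sup S)) - pt (sup S) (lo (sup S))) 0.
    by rewrite /a e invr0 mulr0.
  by rewrite ler_pdivrMr ?mul1r; [lra|rewrite lt_neqAle eq_sym e; lra].
rewrite /= pt_convex; try by apply: dominated_valid; [exact: valid_lo|exact: valid_hi].
  have [e|e] := eqVneq (pt (sup S) (hi (sup S)) - pt (sup S) (lo (sup S))) 0.
    by rewrite /a e; lra.
  by rewrite /a divfK// addrC subrK.
exact: dominated_valid (@valid_lo _).
exact: dominated_valid (@valid_hi _).
Unshelve. all: by end_near. Qed.

(* [hc] collapses the gaps and semi-conjugates the maps below to the rotation;
   [sc k] is an integer off the translates of the gap k and affine of slope
   (wt k)^-1 on each of them. *)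
Definition coord x : R * (int -> R) := projT1 (cid (coordinates_exist x)).
Definition hc x : R := (coord x).1.
Definition sc k x : R := (coord x).2 k.

Lemma coord_valid x : valid (hc x) (sc^~ x).
Proof. by case: (projT2 (cid (coordinates_exist x))). Qed.

Lemma coordE x : pt (hc x) (sc^~ x) = x.
Proof. by case: (projT2 (cid (coordinates_exist x))). Qed.

Lemma coord_pt y s : valid y s -> hc (pt y s) = y /\ forall k, sc k (pt y s) = s k.
Proof.
by move=> h; have [-> e] := pt_inj (@coord_valid (pt y s)) h (coordE _); split.
Qed.

Lemma ler_hc x u : x <= u -> hc x <= hc u.
Proof.
move=> xu; rewrite leNgt; apply/negP => h.
have := pt_lt (@coord_valid u) (@coord_valid x) h; rewrite !coordE.
have : 0 < slack * (hc x - hc u) by apply: mulr_gt0; [exact: slack_gt0|rewrite subr_gt0].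
by lra.
Qed.

Lemma hc_lt x u : hc x < hc u -> x < u.
Proof. by rewrite !ltNge; apply: contra; exact: ler_hc. Qed.

Lemma ler_sc k x u : x <= u -> sc k x <= sc k u.
Proof.
move=> xu; have := ler_hc xu; rewrite le_eqVlt => /predU1P[e|h]; last first.
  exact: valid_lt (@coord_valid _) (@coord_valid _) h.
rewrite leNgt; apply/negP => h; have vx := @coord_valid x; rewrite e in vx.
have := pt_same (@coord_valid u) vx h; rewrite -{1}e !coordE.
have : 0 < wt k * (sc k x - sc k u) by apply: mulr_gt0; rewrite ?wt_gt0// subr_gt0.
by lra.
Qed.

Lemma dominated_sc x : dominated (fun k => wt k * sc k x).
Proof. exact: dominated_valid (@coord_valid x). Qed.

Lemma coordB x u : u - x = slack * (hc u - hc x) + zsum (fun k => wt k * (sc k u - sc k x)).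
Proof.
rewrite -{1}(coordE u) -{1}(coordE x) /pt.
have -> : (fun k => wt k * (sc k u - sc k x)) = (fun k => wt k * sc k u - wt k * sc k x).
  by apply/funext => k; ring.
by rewrite zsumB; [ring|exact: dominated_sc|exact: dominated_sc].
Qed.

Lemma dominated_scB x u : dominated (fun k => wt k * (sc k u - sc k x)).
Proof.
have -> : (fun k => wt k * (sc k u - sc k x)) = (fun k => wt k * sc k u - wt k * sc k x).
  by apply/funext => k; ring.
by apply: dominatedB; exact: dominated_sc.
Qed.

Lemma zsum_scB_le x u : x <= u -> zsum (fun k => wt k * (sc k u - sc k x)) <= u - x.
Proof.
move=> xu; rewrite coordB lerDr mulr_ge0 ?slack_ge0// subr_ge0; exact: ler_hc.
Qed.

(** For [x <= u], [coordB] writes [u - x] as a sum of nonnegative terms, one of which is the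
    left-hand side. *)
Lemma sc_lip k x u : wt k * `|sc k u - sc k x| <= `|u - x|.
Proof.
wlog xu : x u / x <= u.
  move=> W; have [h|/ltW h] := leP x u; first exact: W.
  by rewrite [`|sc k u - _|]distrC [`|u - x|]distrC; apply: W.
rewrite !ger0_norm ?subr_ge0 ?ler_sc//; apply: le_trans (zsum_scB_le xu).
apply: (@zsum_ge_term _ (fun k => wt k * (sc k u - sc k x)) k); first exact: dominated_scB.
by move=> j; rewrite mulr_ge0 ?subr_ge0 ?ler_sc ?wt_ge0.
Qed.

Lemma coord_addz x (m : int) :
  hc (x + m%:~R) = hc x + m%:~R /\ forall k, sc k (x + m%:~R) = sc k x + m%:~R.
Proof.
have v : valid (hc x + m%:~R) (fun k => sc k x + m%:~R).
  move=> k n; have [h1 h2] := @coord_valid x k (n - m).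
  by move: h1 h2; rewrite intrB; split=> h; [have := h1|have := h2]; lra.
suff e : pt (hc x + m%:~R) (fun k => sc k x + m%:~R) = x + m%:~R.
  by have := coord_pt v; rewrite e.
rewrite -{3}(coordE x) /pt.
have -> : (fun k => wt k * (sc k x + m%:~R)) = (fun k => wt k * sc k x + m%:~R * wt k).
  by apply/funext => k; ring.
rewrite zsumD; [|exact: dominated_sc|exact/dominatedZ/dominated_wt1].
by rewrite zsumZ; [rewrite /slack; ring|exact: dominated_wt1].
Qed.

(** A noninteger coordinate pins the level to [k * rho + n]. At that level the coordinate [k] may
    take any value in [[n, n + 1]] independently of the others, so moving inside the gap changes it
    alone. *)
Lemma sc_gap k x (n : int) u : n%:~R < sc k x < n%:~R + 1 ->
  n%:~R <= sc k x + (u - x) / wt k <= n%:~R + 1 ->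
  [/\ hc x = k%:~R * rho + n%:~R, hc u = hc x, sc k u = sc k x + (u - x) / wt k &
      forall j, j != k -> sc j u = sc j x].
Proof.
move=> /andP[n1 n2] /andP[m1 m2]; have vx := @coord_valid x.
have e : hc x - k%:~R * rho = n%:~R.
  have [h|h|//] := ltgtP (hc x - k%:~R * rho) n%:~R.
    by have [_ /(_ h)] := vx k n; lra.
  by have [/(_ h) + _] := vx k n; lra.
pose s j := if j == k then sc k x + (u - x) / wt k else sc j x.
have vs : valid (hc x) s.
  move=> j m; rewrite /s; have [->|_] := eqVneq j k; last exact: vx.
  rewrite e; split; rewrite ltr_int => mn.
    have : (m + 1)%:~R <= n%:~R :> R by rewrite ler_int; lia.
    by rewrite intrD; lra.
  have : (n + 1)%:~R <= m%:~R :> R by rewrite ler_int; lia.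
  by rewrite intrD; lra.
have us : pt (hc x) s = u.
  rewrite pt_update; last exact: dominated_sc.
  by rewrite coordE addrAC subrr add0r mulrC divfK ?gt_eqF ?wt_gt0// addrC subrK.
have := coord_pt vs; rewrite us => -[-> hs]; split=> //.
- lra.
- by rewrite hs /s eqxx.
- by move=> j jk; rewrite hs /s ifN.
Qed.

Lemma gap_window k x (n : int) : n%:~R < sc k x < n%:~R + 1 ->
  exists2 r : R, 0 < r & forall u, `|u - x| < r ->
    n%:~R <= sc k x + (u - x) / wt k <= n%:~R + 1.
Proof.
move=> /andP[n1 n2]; have w0 := wt_gt0 k.
exists (wt k * Num.min (sc k x - n%:~R) (n%:~R + 1 - sc k x)).
  by rewrite mulr_gt0// lt_min; apply/andP; lra.
move=> u; rewrite -ltr_pdivrMl// lt_min => /andP[h1 h2].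
have ux : `|(u - x) / wt k| = (wt k)^-1 * `|u - x|.
  by rewrite normrM mulrC (@gtr0_norm _ (wt k)^-1)// invr_gt0.
rewrite -ux ltr_norml in h1; rewrite -ux ltr_norml in h2.
by move: h1 h2 => /andP[? ?] /andP[? ?]; apply/andP; lra.
Qed.

(** A noninteger value determines the level and the position in the gap; by [level_unique] all other
    coordinates are forced by the level. This identifies the middle of a gap with a point of the
    singular orbit. *)
Lemma sc_inj k x u (n : int) : n%:~R < sc k x < n%:~R + 1 -> sc k u = sc k x -> u = x.
Proof.
move=> hn e; have nn : n%:~R <= sc k x + (x - x) / wt k <= n%:~R + 1.
  by rewrite subrr mul0r addr0; lra.
have [ex _ _ _] := sc_gap hn nn.
have nu : n%:~R <= sc k u + (u - u) / wt k <= n%:~R + 1.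
  by rewrite subrr mul0r addr0; lra.
rewrite -e in hn; have [eu _ _ _] := sc_gap hn nu.
have vx := @coord_valid x; have vu := @coord_valid u; rewrite eu -ex in vu.
rewrite -(coordE x) -(coordE u) eu -ex; congr pt; apply/funext => j.
have [->//|jk] := eqVneq j k.
apply/eqP; apply: contraNT jk => hj; have [m hm] := valid_nint vu vx hj.
have hm' : hc x - k%:~R * rho = n%:~R by lra.
by apply/eqP/(level_unique hm hm').
Qed.

End Coordinates.

(** * Trigonometric profiles on a gap of unit length *)

Section Profiles.
Variable R : realType.
Implicit Types (s : R).

Definition tau : R := pi *+ 2.

Lemma tau_gt0 : 0 < tau. Proof. by rewrite pmulrn_rgt0// pi_gt0. Qed.

Lemma tau_neq0 : tau != 0. Proof. by rewrite gt_eqF// tau_gt0. Qed.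

Definition ramp s : R := s - sin (tau * s) / tau.
(** The factor [cos - 1] flattens the zeros of the sine at the integers and leaves those at the
    half-integers simple; the denominator makes the slope there equal to 1. Its absolute value is
    thus broken at the half-integers only. *)
Definition wiggle s : R := sin (tau * s) * (cos (tau * s) - 1) / (2 * tau).

Definition ramp' s : R := 1 - cos (tau * s).
Definition wiggle' s : R := (2 * cos (tau * s) ^+ 2 - 1 - cos (tau * s)) / 2.

Lemma is_derive_tau s : is_derive s 1 (fun u => tau * u) tau.
Proof.
have h := is_deriveZ tau (is_derive_id s (1 : R)).
by apply: is_derive_eq; rewrite /GRing.scale /= mulr1.
Qed.

Lemma is_derive_sin_tau s : is_derive s 1 (fun u => sin (tau * u)) (tau * cos (tau * s)).
Proof.
have h := is_derive1_comp (is_derive_sin (tau * s)) (is_derive_tau s).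
by apply: is_derive_eq; rewrite mulrC.
Qed.

Lemma is_derive_cos_tau s : is_derive s 1 (fun u => cos (tau * u)) (- tau * sin (tau * s)).
Proof.
have h := is_derive1_comp (is_derive_cos (tau * s)) (is_derive_tau s).
by apply: is_derive_eq; rewrite mulrC mulrN mulNr.
Qed.

Lemma is_derive_ramp s : is_derive s 1 ramp (ramp' s).
Proof.
have h := is_deriveB (is_derive_id s (1 : R)) (is_deriveZ tau^-1 (is_derive_sin_tau s)).
have -> : ramp = id - tau^-1 \*: (fun u => sin (tau * u)).
  by apply/funext => u; rewrite /ramp fctE mulrC.
apply: is_derive_eq; rewrite /GRing.scale /= /ramp'.
by rewrite mulrA mulVf ?mul1r// tau_neq0.
Qed.

Lemma is_derive_wiggle s : is_derive s 1 wiggle (wiggle' s).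
Proof.
have h := is_deriveZ (2 * tau)^-1 (is_deriveM (is_derive_sin_tau s)
  (is_deriveB (is_derive_cos_tau s) (is_derive_cst (1 : R) s 1))).
have -> : wiggle = (2 * tau)^-1 \*: ((fun u => sin (tau * u)) * ((fun u => cos (tau * u)) - cst 1)).
  by apply/funext => u; rewrite /wiggle !fctE mulrC.
apply: is_derive_eq; rewrite /GRing.scale /= /wiggle' !fctE.
have := sin2cos2 (tau * s); set c := cos _; set z := sin _ => e.
have -> : z * (- tau * z - 0) + (c - 1) * (tau * c) = tau * (c ^+ 2 - c - z ^+ 2) by ring.
by rewrite e; move: tau tau_neq0 => T T0; field.
Qed.

Lemma continuous_cos_tau : continuous (fun s => cos (tau * s)).
Proof.
move=> s; apply: differentiable_continuous; apply/derivable1_diffP.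
by have [] := is_derive_cos_tau s.
Qed.

Lemma sderiv_ramp s : sderiv setT ramp s (ramp' s).
Proof.
apply: is_derive_sderiv; first exact: is_derive_ramp.
by move=> u; apply: cvgB; [exact: cvg_cst|exact: continuous_cos_tau].
Qed.

Lemma sderiv_wiggle s : sderiv setT wiggle s (wiggle' s).
Proof.
apply: is_derive_sderiv; first exact: is_derive_wiggle.
have c := continuous_cos_tau.
move=> u; apply: cvgMl; apply: cvgB; last exact: c.
apply: cvgB; last exact: cvg_cst.
by apply: cvgM; [exact: cvg_cst|rewrite expr2; apply: cvgM; exact: c].
Qed.

Lemma ramp_lip u v : `|ramp u - ramp v| <= 2 * `|u - v|.
Proof.
apply: (is_derive_lip is_derive_ramp) => s.
rewrite /ramp' ler_norml; have := cos_le1 (tau * s); have := cos_geN1 (tau * s).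
by move=> *; apply/andP; lra.
Qed.

Lemma wiggle_lip u v : `|wiggle u - wiggle v| <= `|u - v|.
Proof.
rewrite -[leRHS]mul1r; apply: (is_derive_lip is_derive_wiggle) => s.
rewrite /wiggle' ler_norml; have := cos_le1 (tau * s); have := cos_geN1 (tau * s).
by set c := cos _ => *; apply/andP; split; nra.
Qed.

Lemma cos_tauD1 s : cos (tau * (s + 1)) = cos (tau * s).
Proof. by rewrite mulrDr mulr1 cosD2pi. Qed.

Lemma sin_tauD1 s : sin (tau * (s + 1)) = sin (tau * s).
Proof. by rewrite mulrDr mulr1 sinD2pi. Qed.

Lemma ramp_succ s : ramp (s + 1) = ramp s + 1.
Proof. by rewrite /ramp sin_tauD1; ring. Qed.

Lemma wiggle_succ s : wiggle (s + 1) = wiggle s.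
Proof. by rewrite /wiggle sin_tauD1 cos_tauD1. Qed.

Lemma periodic_int (f : R -> R) : (forall s, f (s + 1) = f s) ->
  forall s (n : int), f (s + n%:~R) = f s.
Proof.
move=> h s n; have hn : forall t (m : nat), f (t + m%:R) = f t.
  by move=> t; elim=> [|m IH]; rewrite ?addr0// -natr1 addrA h.
case: n => n; first exact: hn.
by rewrite NegzE mulrNz -[LHS](hn _ n.+1) subrK.
Qed.

Lemma ramp0 : ramp 0 = 0.
Proof. by rewrite /ramp mulr0 sin0 mul0r subr0. Qed.

Lemma wiggle0 : wiggle 0 = 0.
Proof. by rewrite /wiggle mulr0 sin0 !mul0r. Qed.

Lemma tau_half : tau * 2^-1 = pi.
Proof. by rewrite /tau -mulr_natr; field. Qed.

Lemma ramp_half : ramp 2^-1 = 2^-1.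
Proof. by rewrite /ramp tau_half sinpi mul0r subr0. Qed.

Lemma wiggle_half : wiggle 2^-1 = 0.
Proof. by rewrite /wiggle tau_half sinpi !mul0r. Qed.

Lemma ramp'_int (n : int) : ramp' n%:~R = 0.
Proof.
by rewrite /ramp' -[n%:~R]add0r (periodic_int cos_tauD1) mulr0 cos0 subrr.
Qed.

Lemma wiggle'_int (n : int) : wiggle' n%:~R = 0.
Proof.
rewrite /wiggle' -[n%:~R]add0r !(periodic_int cos_tauD1) mulr0 cos0; lra.
Qed.

Definition center s := exists n : int, s = n%:~R + 2^-1.

Lemma center_cos s : center s -> cos (tau * s) = -1.
Proof. by move=> [n ->]; rewrite addrC (periodic_int cos_tauD1) tau_half cospi. Qed.

Lemma cos_center s : cos (tau * s) = -1 -> center s.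
Proof.
move=> h; exists (Num.floor s).
have /andP[f1 f2] := floor_itv s; rewrite intrD in f2.
set n := Num.floor s in f1 f2 *; pose t := s - n%:~R.
have st : s = t + n%:~R by rewrite subrK.
rewrite st (periodic_int cos_tauD1) in h.
have pi0 := pi_gt0 R.
(* Half-angle formula; [pi * t] lies in [[0, pi]], where the cosine is injective. *)
have h2 : cos (pi * t) = 0.
  apply/eqP; rewrite -sqrf_eq0; apply/eqP.
  have := cos_mulr2n (pi * t); rewrite -mulrnAl -/tau h; lra.
have : pi * t = pi / 2.
  apply: cos_inj; last by rewrite h2 cos_pihalf.
    by rewrite in_itv /=; apply/andP; rewrite /t; split; nra.
  by rewrite in_itv /=; apply/andP; lra.
by move/(mulfI (lt0r_neq0 pi0)); rewrite /t; lra.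
Qed.

Lemma ramp'_center s : center s -> ramp' s = 2.
Proof. by move/center_cos => h; rewrite /ramp' h; lra. Qed.

Lemma wiggle'_center s : center s -> wiggle' s = 1.
Proof. by move/center_cos => h; rewrite /wiggle' h; lra. Qed.

Lemma wiggle_center s : center s -> wiggle s = 0.
Proof. by move=> [n ->]; rewrite addrC (periodic_int wiggle_succ) wiggle_half. Qed.

Lemma wiggle_crit s : ~ center s -> wiggle s = 0 -> wiggle' s = 0.
Proof.
move=> nc w0; suff c1 : cos (tau * s) = 1 by rewrite /wiggle' c1; lra.
have : sin (tau * s) * (cos (tau * s) - 1) == 0.
  have -> : sin (tau * s) * (cos (tau * s) - 1) = wiggle s * (2 * tau).
    by rewrite /wiggle divfK// mulf_neq0// tau_neq0.
  by rewrite w0 mul0r.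
rewrite mulf_eq0 => /orP[/eqP s0|]; last by rewrite subr_eq0 => /eqP.
have /eqP := cos2Dsin2 (tau * s); rewrite s0 expr0n /= addr0 sqrf_eq1 => /orP[/eqP//|/eqP].
by move/cos_center.
Qed.

End Profiles.

(** * Lipschitz perturbations of the identity *)

Section NearIdentity.
Variable R : realType.
Implicit Types (F : R -> R).

Definition near_id F := forall u v, `|(F u - u) - (F v - v)| <= 2^-1 * `|u - v|.

Lemma near_id_incr F u v : near_id F -> u <= v -> 2^-1 * (v - u) <= F v - F u.
Proof.
move=> h uv; have := h v u.
by rewrite (@ger0_norm _ (v - u)) ?subr_ge0// ler_norml => /andP[+ _]; lra.
Qed.

Lemma near_id_lt F : near_id F -> {homo F : u v / u < v}.
Proof. by move=> h u v uv; have := near_id_incr h (ltW uv); lra. Qed.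

Lemma near_id_lip F u v : near_id F -> `|F u - F v| <= 2 * `|u - v|.
Proof.
move=> h; have := h u v; have := ler_normD ((F u - u) - (F v - v)) (u - v).
have -> : F u - u - (F v - v) + (u - v) = F u - F v by ring.
by have := normr_ge0 (u - v); lra.
Qed.

Lemma lip_continuous F (L : R) : (forall u v, `|F u - F v| <= L * `|u - v|) -> continuous F.
Proof.
move=> h x; have L1 : 0 < `|L| + 1 by rewrite ltr_wpDl.
apply/cvgrPdist_lt => e e0; exists (e / (`|L| + 1)) => /=; first by rewrite divr_gt0.
move=> y /=; rewrite ltr_pdivlMr// => xy; apply: le_lt_trans xy.
apply: le_trans (h _ _) _; rewrite mulrC ler_wpM2l// (le_trans (ler_norm _))// lerDl//.
Qed.

Lemma near_id_bij F : near_id F -> exists G, [/\ cancel F G, cancel G F &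
  forall u v, `|G u - G v| <= 2 * `|u - v|].
Proof.
move=> h; have cF : continuous F by apply: lip_continuous => u v; exact: near_id_lip.
have surj y : exists x, F x = y.
  (* [F] grows with slope at least 1/2, so moving by [w] from 0 changes it by at least [|y - F 0|]
     and the intermediate value theorem applies on [[-w, w]]. *)
  pose w := 2 * `|y - F 0|; have w0 : 0 <= w by rewrite mulr_ge0.
  have ww : - w <= w by lra.
  have h1 := near_id_incr h w0; have w0' : - w <= 0 by lra.
  have h2 := near_id_incr h w0'.
  have h3 := ler_norm (y - F 0); have h4 := ler_norm (- (y - F 0)).
  rewrite normrN in h4.
  have [||x _ Fx] := @IVT _ F (- w) w y ww; last by exists x.
    exact: continuous_subspaceT.
  by rewrite ge_min le_max; apply/andP; split; apply/orP; [left|right]; rewrite /w in h1 h2 *; lra.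
have [G GK] := choice surj.
have lt_mono : {mono F : u v / u <= v}.
  by apply: le_mono => u v; exact: near_id_lt.
have FG : cancel F G by move=> x; apply: (inc_inj lt_mono); rewrite GK.
exists G; split=> // u v.
wlog uv : u v / G v <= G u.
  move=> W; have [/W//|/ltW/W] := leP (G v) (G u).
  by rewrite distrC [`|v - u|]distrC.
have := near_id_incr h uv; rewrite !GK ger0_norm ?subr_ge0//.
by have := ler_norm (u - v); lra.
Qed.

Lemma near_id_sderiv_gt0 F x d : near_id F -> sderiv setT F x d -> 0 < d.
Proof.
(* Difference quotients are at least 1/2, so any tolerance below 1/2 keeps [d] positive. *)
move=> h; move=> /(_ 4^-1) [|r r0 H]; first by rewrite invr_gt0.
have r2 : `|x + r / 2 - x| < r by rewrite addrAC subrr add0r gtr0_norm; lra.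
have /(_ I I r2) := H (x + r / 2) x; rewrite subrr normr0 => /(_ r0).
have xr : x <= x + r / 2 by lra.
have := near_id_incr h xr.
have -> : x + r / 2 - x = r / 2 by ring.
rewrite ler_norml (gtr0_norm (_ : 0 < r / 2)); last by lra.
by move=> h1 /andP[_ h2]; rewrite ltNge; apply/negP => d0; nra.
Qed.

End NearIdentity.

(** * Maps of the line assembled from gap maps *)

Section GapMaps.
Variable R : realType.
Implicit Types (b : int -> R -> R) (x u s : R) (k : int).

(* [b k] is the displacement of a map of the gap [k] onto the gap [k + 1], in
   the coordinate [sc k], lifted to the line. *)
Record gap_family b : Prop := GapFamily {
  gap0 : forall k, b k 0 = 0;
  gap_succ : forall k s, b k (s + 1) = b k s + (wt R (k + 1) - wt R k);
  gap_lip : forall k s t, `|b k s - b k t| <= 20 / mag R k * wt R k * `|s - t| }.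

Definition psi b k s : R := (wt R k * s + b k s) / wt R (k + 1).

(** Given as a displacement to allow estimates term by term; [gmapE] recovers the geometric meaning,
    namely the level raised by [rho] and the coordinate [k] sent by [psi b k] to the coordinate
    [k + 1]. *)
Definition gmap b x : R := x + slack R * rho R + zsum (fun k => b k (sc k x)).

Variables (b : int -> R -> R) (gb : gap_family b).

Lemma psiE k s : wt R (k + 1) * psi b k s = wt R k * s + b k s.
Proof. by rewrite mulrC divfK// gt_eqF// wt_gt0. Qed.

Lemma psi_succ k s : psi b k (s + 1) = psi b k s + 1.
Proof.
apply: (mulfI (lt0r_neq0 (wt_gt0 R (k + 1)))).
by rewrite mulrDr !psiE gap_succ//; ring.
Qed.

Lemma psi_addz k s (n : int) : psi b k (s + n%:~R) = psi b k s + n%:~R.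
Proof.
have h u : psi b k (u + 1) - (u + 1) = psi b k u - u by rewrite psi_succ; ring.
have := periodic_int h s n; lra.
Qed.

Lemma psi_int k (n : int) : psi b k n%:~R = n%:~R.
Proof.
rewrite -[in LHS](add0r n%:~R) psi_addz -[RHS]add0r; congr (_ + _).
by rewrite /psi mulr0 gap0// addr0 mul0r.
Qed.

Lemma gap_half_lip k s t : `|b k s - b k t| <= 2^-1 * (wt R k * `|s - t|).
Proof.
apply: le_trans (gap_lip gb k s t) _; rewrite -mulrA ler_wpM2r//.
  by rewrite mulr_ge0// wt_ge0.
rewrite ler_pdivrMr ?mag_gt0//; have := mag_ge40 R k; lra.
Qed.

(** Both gaps are measured in the length of the gap [k]; undoing the change of length turns [psi]
    into the identity plus the small displacement. *)
Lemma psi_near_id k : near_id (fun s => psi b k s * wt R (k + 1) / wt R k).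
Proof.
move=> s t; have w0 := wt_gt0 R k.
have -> : psi b k s * wt R (k + 1) / wt R k - s - (psi b k t * wt R (k + 1) / wt R k - t)
  = (wt R k)^-1 * (b k s - b k t).
  by rewrite ![psi _ _ _ * _]mulrC !psiE; field; rewrite gt_eqF.
have w1 : 0 < (wt R k)^-1 by rewrite invr_gt0.
rewrite normrM (gtr0_norm w1) ler_pdivrMl//.
by apply: le_trans (gap_half_lip _ _ _) _; rewrite mulrCA.
Qed.

Lemma psi_bij k : exists psi', cancel (psi b k) psi' /\ cancel psi' (psi b k).
Proof.
have [g [h1 h2 _]] := near_id_bij (psi_near_id k).
have w0 := lt0r_neq0 (wt_gt0 R k); have w1 := lt0r_neq0 (wt_gt0 R (k + 1)).
exists (fun s => g (s * wt R (k + 1) / wt R k)); split=> [s|s]; first exact: h1.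
by have := h2 (s * wt R (k + 1) / wt R k) => /(mulIf (invr_neq0 w0))/(mulIf w1).
Qed.

Lemma psi_lt k : {homo psi b k : s t / s < t}.
Proof.
move=> s t /(near_id_lt (psi_near_id k)).
have w0 := wt_gt0 R k; have w1 : 0 < (wt R k)^-1 by rewrite invr_gt0.
by rewrite (ltr_pM2r w1) ltr_pM2r// wt_gt0.
Qed.

Lemma psi_le k : {homo psi b k : s t / s <= t}.
Proof. exact/ltW_homo/psi_lt. Qed.

(** Admissibility only compares coordinates with integers, so it survives any nondecreasing change
    of coordinate that fixes the integers. *)
Lemma valid_fill y (s : int -> R) (phi : int -> R -> R) : (forall k (n : int), phi k n%:~R = n%:~R) ->
  (forall k, {homo phi k : u v / u <= v}) ->
  valid y s -> valid y (fun k => phi k (s k)).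
Proof.
move=> phin phile hs k n; have [h1 h2] := hs k n; split=> h.
  by have := phile k _ _ (h1 h); rewrite -intrD1 phin.
by have := phile k _ _ (h2 h); rewrite phin.
Qed.

Lemma valid_shift y (s : int -> R) : valid y s -> valid (y + rho R) (fun k => s (k - 1)).
Proof.
move=> hs k n; have := hs (k - 1) n; rewrite intrB.
by have -> : y - (k%:~R - 1) * rho R = y + rho R - k%:~R * rho R by ring.
Qed.

Lemma valid_gmap x : valid (hc x + rho R) (fun k => psi b (k - 1) (sc (k - 1) x)).
Proof.
apply: (@valid_shift (hc x) (fun k => psi b k (sc k x))).
by apply: valid_fill (coord_valid x); [exact: psi_int|exact: psi_le].
Qed.

Lemma dominated_gap x : dominated (fun k => b k (sc k x)).
Proof.
apply: dominated_le (dominated_sc x) => k.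
have := gap_half_lip k (sc k x) 0; rewrite gap0// !subr0 => /le_trans; apply.
by rewrite normrM (gtr0_norm (wt_gt0 R k)); have := mulr_ge0 (wt_ge0 R k) (normr_ge0 (sc k x)); lra.
Qed.

Lemma gmapE x : gmap b x = pt (hc x + rho R) (fun k => psi b (k - 1) (sc (k - 1) x)).
Proof.
rewrite /pt -(zsum_succ (dominated_valid (valid_gmap x))).
have -> : (fun k => wt R (k + 1) * psi b (k + 1 - 1) (sc (k + 1 - 1) x)) =
   (fun k => wt R k * sc k x + b k (sc k x)).
  by apply/funext => k; rewrite addrK psiE.
rewrite zsumD; [|exact: dominated_sc|exact: dominated_gap].
by rewrite /gmap -{1}(coordE x) /pt; ring.
Qed.

Lemma hc_gmap x : hc (gmap b x) = hc x + rho R.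
Proof. by rewrite gmapE; have [] := coord_pt (valid_gmap x). Qed.

Lemma sc_gmap k x : sc (k + 1) (gmap b x) = psi b k (sc k x).
Proof. by rewrite gmapE; have [_ ->] := coord_pt (valid_gmap x); rewrite addrK. Qed.

Lemma gmap_diff u v : (gmap b u - u) - (gmap b v - v) =
  zsum (fun k => b k (sc k u) - b k (sc k v)).
Proof. by rewrite zsumB /gmap; [ring|exact: dominated_gap|exact: dominated_gap]. Qed.

Lemma dominated_abs_scB u v : dominated (fun k => wt R k * `|sc k u - sc k v|).
Proof.
apply: dominated_le (dominated_scB v u) => k.
by rewrite !normrM normr_id.
Qed.

Lemma zsum_abs_scB u v : zsum (fun k => wt R k * `|sc k u - sc k v|) <= `|u - v|.
Proof.
wlog uv : u v / v <= u.
  move=> W; have [h|/ltW h] := leP v u; first exact: W.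
  rewrite distrC; apply: le_trans (W _ _ h); rewrite le_eqVlt; apply/orP; left; apply/eqP.
  by congr zsum; apply/funext => k; rewrite distrC.
rewrite ger0_norm ?subr_ge0//; apply: le_trans (zsum_scB_le uv).
rewrite le_eqVlt; apply/orP; left; apply/eqP.
by congr zsum; apply/funext => k; rewrite ger0_norm// subr_ge0 ler_sc.
Qed.

Lemma gmap_near_id : near_id (gmap b).
Proof.
move=> u v; rewrite gmap_diff.
apply: (@le_trans _ _ (zsum (fun k => 2^-1 * (wt R k * `|sc k u - sc k v|)))).
  apply: ler_norm_zsum => [|k]; last exact: gap_half_lip.
  exact/dominatedZ/dominated_abs_scB.
by rewrite zsumZ ?ler_wpM2l ?zsum_abs_scB//; exact: dominated_abs_scB.
Qed.

Lemma gmap_addz x (m : int) : gmap b (x + m%:~R) = gmap b x + m%:~R.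
Proof.
have h u : gmap b (u + 1) - (u + 1) = gmap b u - u.
  have [_ e] := coord_addz u 1.
  rewrite -[LHS](subrK (gmap b u - u)) gmap_diff.
  (* Over a period each gap adds its change of length; these changes sum to 0 by translation
     invariance. *)
  have -> : (fun k => b k (sc k (u + 1)) - b k (sc k u)) = (fun k => wt R (k + 1) - wt R k).
    by apply/funext => k; rewrite (e k) gap_succ//; ring.
  rewrite zsumB ?(zsum_succ (dominated_wt1 R)) ?subrr ?add0r//.
    exact/dominated_succ/dominated_wt1.
  exact: dominated_wt1.
have := periodic_int h x m; lra.
Qed.

(* At a point of the minimal set all gap coordinates are integers; there the
   displacement is flat because the gaps nearby are either far out, hence
   almost undistorted, or seen close to their flat ends. *)
Lemma sderiv_gmap_flat x : (forall k (n : int), sderiv setT (b k) n%:~R 0) ->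
  (forall k, exists n : int, sc k x = n%:~R) -> sderiv setT (gmap b) x 1.
Proof.
move=> flat ints e e0.
suff [r r0 H] : exists2 r : R, 0 < r & forall u, `|u - x| < r -> forall v, `|v - x| < r ->
    forall k, `|b k (sc k u) - b k (sc k v)| <= e * (wt R k * `|sc k u - sc k v|).
  exists r => // u v _ _ ur vr.
  have -> : gmap b u - gmap b v - 1 * (u - v) = (gmap b u - u) - (gmap b v - v) by ring.
  rewrite gmap_diff.
  apply: (@le_trans _ _ (zsum (fun k => e * (wt R k * `|sc k u - sc k v|)))).
    apply: ler_norm_zsum => [|k]; last exact: H.
    exact/dominatedZ/dominated_abs_scB.
  by rewrite zsumZ ?ler_wpM2l ?zsum_abs_scB ?ltW//; exact: dominated_abs_scB.
have one k : exists2 r : R, 0 < r & forall u, `|u - x| < r -> forall v, `|v - x| < r ->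
    `|b k (sc k u) - b k (sc k v)| <= e * (wt R k * `|sc k u - sc k v|).
  have [n hn] := ints k; have w0 := wt_gt0 R k.
  have [r r0 H] := flat k n _ (mulr_gt0 e0 w0).
  exists (wt R k * r) => [|u ur v vr]; first exact: mulr_gt0.
  have near w : `|w - x| < wt R k * r -> `|sc k w - n%:~R| < r.
    by move=> wr; rewrite -(ltr_pM2l w0) -hn (le_lt_trans (sc_lip _ _ _)).
  have := H _ _ I I (near _ ur) (near _ vr).
  by rewrite mul0r subr0 mulrA.
have all n : exists2 r : R, 0 < r & forall u, `|u - x| < r -> forall v, `|v - x| < r ->
    forall k, (`|k| < n)%N ->
    `|b k (sc k u) - b k (sc k v)| <= e * (wt R k * `|sc k u - sc k v|).
  elim: n => [|n [r r0 H]]; first by exists 1.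
  have [s s0 Hs] := one (Posz n); have [t t0 Ht] := one (- Posz n).
  exists (Num.min r (Num.min s t)); first by rewrite !lt_min r0 s0 t0.
  move=> u; rewrite !lt_min => /and3P[ur us ut] v; rewrite !lt_min => /and3P[vr vs vt] k.
  rewrite ltnS leq_eqVlt => /orP[/eqP kn|]; last exact: H.
  have [->|->] : k = Posz n \/ k = - Posz n by lia.
    exact: Hs.
  exact: Ht.
(* Past this cut-off [20 / mag k] is at most [e], so the Lipschitz bound of the family suffices;
   only finitely many gaps need the flatness at their ends. *)
have [r r0 H] := all (Num.truncn (20 / e)).+1.
exists r => // u ur v vr k.
have [kn|kn] := ltnP `|k|%N (Num.truncn (20 / e)).+1; first exact: H.
apply: le_trans (gap_lip gb k _ _) _; rewrite -mulrA ler_wpM2r//.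
  by rewrite mulr_ge0// wt_ge0.
rewrite ler_pdivrMr ?mag_gt0// mulrC -ler_pdivrMr//.
have := truncnS_gt (20 / e); move=> /ltW/le_trans; apply.
rewrite /mag -intr_norm -abszE; apply: (@le_trans _ _ (`|k|%N)%:R); first by rewrite ler_nat.
by rewrite lerDr.
Qed.

Lemma gmap_gap_local k x (n : int) : n%:~R < sc k x < n%:~R + 1 ->
  exists2 r : R, 0 < r & forall u, `|u - x| < r ->
    gmap b u = gmap b x + (u - x) +
      (b k (sc k x + (wt R k)^-1 * (u - x)) - b k (sc k x)).
Proof.
move=> hn; have [r r0 win] := gap_window hn; exists r => // u /win hu.
have [_ _ e1 e2] := sc_gap hn hu.
have := gmap_diff u x.
have -> : (fun j => b j (sc j u) - b j (sc j x)) =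
  (fun j => if j == k then b k (sc k x + (wt R k)^-1 * (u - x)) - b k (sc k x) else 0).
  apply/funext => j; have [->|jk] := eqVneq j k.
    by rewrite e1 [(u - x) / _]mulrC.
  by rewrite e2// subrr.
rewrite zsum_delta => h; lra.
Qed.

Lemma sderiv_gmap_gap k x (n : int) (A : set R) d : n%:~R < sc k x < n%:~R + 1 ->
  sderiv A (b k) (sc k x) d ->
  sderiv [set u | A (sc k x + (wt R k)^-1 * (u - x))] (gmap b) x (1 + (wt R k)^-1 * d).
Proof.
move=> hn hb; have [r r0 H] := gmap_gap_local hn.
have w0 : 0 < (wt R k)^-1 by rewrite invr_gt0 wt_gt0.
have h := sderivD (sderiv_id _ x) (sderiv_affine x w0 hb).
apply: (sderiv_eq_near r0) h => u v _ _ ur vr.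
by rewrite (H _ ur) (H _ vr); ring.
Qed.

End GapMaps.

(** * The broken and the unbroken families, and the kick [G + G^-1 - 2 id] *)

Section Families.
Variable R : realType.
Implicit Types (P Q : int -> R) (k : int) (s x u : R).

Definition dilat k : R := wt R (k + 1) / wt R k - 1.

Lemma int_sign k : 0 <= (k%:~R : R) \/ (k%:~R : R) <= -1.
Proof.
have [k0|k0] := leP 0 k; [left; by rewrite ler0z|right].
by rewrite (_ : -1 = (-1)%:~R)// ler_int; lia.
Qed.

Lemma mag_succ k : mag R (k + 1) = mag R k + 1 /\ 0 <= (k%:~R : R) \/
  mag R (k + 1) = mag R k - 1 /\ (k%:~R : R) <= -1.
Proof.
rewrite /mag intrD; have [k0|k0] := int_sign k; [left|right]; split=> //.
  by rewrite !ger0_norm//; lra.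
by rewrite !ler0_norm//; lra.
Qed.

Lemma dilat_bound k : `|dilat k| <= 4 / mag R k.
Proof.
have m40 := mag_ge40 R k; rewrite /dilat /wt.
have [[-> _]|[-> _]] := mag_succ k; move: (mag R k) m40 => M M40.
  have -> : ((M + 1) * (M + 1 + 1) * (M + 1 + 2))^-1 / (M * (M + 1) * (M + 2))^-1 - 1
    = - (3 / (M + 3)) by field; rewrite !gt_eqF; lra.
  rewrite normrN ger0_norm ?divr_ge0//; last by lra.
  by rewrite ler_pdivrMr; [rewrite mulrAC ler_pdivlMr; lra|lra].
have -> : ((M - 1) * (M - 1 + 1) * (M - 1 + 2))^-1 / (M * (M + 1) * (M + 2))^-1 - 1
  = 3 / (M - 1) by field; rewrite !gt_eqF; lra.
rewrite ger0_norm ?divr_ge0//; last by lra.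
by rewrite ler_pdivrMr; [rewrite mulrAC ler_pdivlMr; lra|lra].
Qed.

(* [ramp] carries the gap onto the next one; [wiggle] adjusts the slope in the
   middle and its absolute value breaks it there. All are flat at the ends. *)
Definition gapfam P Q k s : R :=
  wt R k * (dilat k * ramp s + P k * wiggle s + Q k * `|wiggle s|).

(** The 20 of [gap_lip] is [4 * 2 + 10 + 2]: [ramp] is 2-Lipschitz with a coefficient bounded by
    [4 / mag], and [wiggle] and its absolute value are 1-Lipschitz. *)
Lemma gapfam_family P Q : (forall k, `|P k| <= 10 / mag R k) ->
  (forall k, `|Q k| <= 2 / mag R k) -> gap_family (gapfam P Q).
Proof.
move=> hP hQ; split=> [k|k s|k s t].
- by rewrite /gapfam ramp0 wiggle0 normr0 !mulr0 !addr0 mulr0.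
- rewrite /gapfam ramp_succ wiggle_succ /dilat; field; by rewrite gt_eqF ?wt_gt0.
rewrite /gapfam -mulrBr normrM (gtr0_norm (wt_gt0 R k)) [20 / _ * _]mulrC -mulrA.
rewrite ler_wpM2l ?wt_ge0//.
have -> : dilat k * ramp s + P k * wiggle s + Q k * `|wiggle s| -
  (dilat k * ramp t + P k * wiggle t + Q k * `|wiggle t|) =
  dilat k * (ramp s - ramp t) + P k * (wiggle s - wiggle t) +
  Q k * (`|wiggle s| - `|wiggle t|) by ring.
have h1 : `|dilat k * (ramp s - ramp t)| <= 4 / mag R k * (2 * `|s - t|).
  by rewrite normrM ler_pM ?dilat_bound ?ramp_lip.
have h2 : `|P k * (wiggle s - wiggle t)| <= 10 / mag R k * `|s - t|.
  by rewrite normrM ler_pM ?wiggle_lip.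
have h3 : `|Q k * (`|wiggle s| - `|wiggle t|)| <= 2 / mag R k * `|s - t|.
  by rewrite normrM ler_pM// (le_trans (ler_dist_dist _ _)) ?wiggle_lip.
apply: le_trans (ler_normD _ _) _; apply: le_trans (lerD (ler_normD _ _) (lexx _)) _.
lra.
Qed.

Section Regularity.
Variables (P Q : int -> R).

Lemma sderiv_gapfam_smooth k s d : sderiv setT (fun u => `|wiggle u|) s d ->
  sderiv setT (gapfam P Q k) s (wt R k * (dilat k * ramp' s + P k * wiggle' s + Q k * d)).
Proof.
move=> h; apply/sderivZ/sderivD; last exact: sderivZ.
by apply: sderivD; apply: sderivZ; [exact: sderiv_ramp|exact: sderiv_wiggle].
Qed.

Lemma sderiv_gapfam_int k (n : int) : sderiv setT (gapfam P Q k) n%:~R 0.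
Proof.
have w0 : wiggle (n%:~R : R) = 0.
  by rewrite -[n%:~R]add0r (periodic_int (@wiggle_succ R)) wiggle0.
have [d [h1 h2]] := @sderiv_abs_smooth R _ _ _ (fun _ => @wiggle'_int R n)
  (sderiv_wiggle n%:~R).
have := sderiv_gapfam_smooth k h1.
by rewrite (h2 w0) ramp'_int wiggle'_int !mulr0 !addr0 mulr0.
Qed.

Lemma sderiv_gapfam k s : ~ center s -> exists d, sderiv setT (gapfam P Q k) s d.
Proof.
move=> nc; have [d [h1 _]] := sderiv_abs_smooth (wiggle_crit nc) (sderiv_wiggle s).
by eexists; exact: sderiv_gapfam_smooth h1.
Qed.

Lemma sderiv_gapfam_center k s : center s ->
  sderiv [set u | s <= u] (gapfam P Q k) s (wt R k * (2 * dilat k + P k + Q k)) /\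
  sderiv [set u | u <= s] (gapfam P Q k) s (wt R k * (2 * dilat k + P k - Q k)).
Proof.
move=> cs; have w0 : 0 < wiggle' s by rewrite (wiggle'_center cs).
have [hr hl] := sderiv_abs_pos w0 (wiggle_center cs) (sderiv_wiggle s).
have base A : sderiv A (fun u => dilat k * ramp u + P k * wiggle u) s
    (dilat k * ramp' s + P k * wiggle' s).
  apply: sderivD; apply: sderivZ.
    exact: sderiv_subset (sderiv_ramp s).
  exact: sderiv_subset (sderiv_wiggle s).
rewrite (wiggle'_center cs) in hr hl base; rewrite (ramp'_center cs) in base.
split.
  have := sderivZ (wt R k) (sderivD (base _) (sderivZ (Q k) hr)).
  by rewrite !mulr1 [_ * 2]mulrC.
have := sderivZ (wt R k) (sderivD (base _) (sderivZ (Q k) hl)).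
by rewrite mulrN !mulr1 [_ * 2]mulrC.
Qed.

End Regularity.

(* Positive sequences with [m (k + 1) + m (k - 1) = 2 * m k] except at [k = 0],
   where both satisfy it with the same factor in place of 2. *)
Definition slopeR k : R := mag R k + (`|k%:~R| - k%:~R) / 2.
Definition slopeL k : R := mag R k + (`|k%:~R| + k%:~R) / 2.

Definition alphaR k : R := slopeR (k + 1) / slopeR k.
Definition alphaL k : R := slopeL (k + 1) / slopeL k.

Lemma mag_le_slopeR k : mag R k <= slopeR k.
Proof. by rewrite lerDl divr_ge0// subr_ge0 ler_norm. Qed.

Lemma mag_le_slopeL k : mag R k <= slopeL k.
Proof.
rewrite lerDl divr_ge0//; have := ler_norm (- (k%:~R : R)); rewrite normrN; lra.
Qed.

Lemma slopeR_gt0 k : 0 < slopeR k.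
Proof. exact: lt_le_trans (mag_gt0 _ _) (mag_le_slopeR _). Qed.

Lemma slopeL_gt0 k : 0 < slopeL k.
Proof. exact: lt_le_trans (mag_gt0 _ _) (mag_le_slopeL _). Qed.

Lemma slope_succ k :
  [/\ 0 <= (k%:~R : R), slopeR (k + 1) = slopeR k + 1, slopeL (k + 1) = slopeL k + 2 &
      slopeL k = slopeR k + k%:~R] \/
  [/\ (k%:~R : R) <= -1, slopeR (k + 1) = slopeR k - 2, slopeL (k + 1) = slopeL k - 1 &
      slopeR k = slopeL k - k%:~R].
Proof.
rewrite /slopeR /slopeL /mag intrD; have [k0|k0] := int_sign k; [left|right].
  by rewrite !ger0_norm//; [split=> //; lra|lra].
by rewrite !ler0_norm//; [split=> //; lra|lra|lra].
Qed.

(** Either side is [(m (k + 2) + m k) / m (k + 1)], the factor of the recurrence at [k + 1], which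
    is the same for both solutions. *)
Lemma alpha_recurrence k :
  alphaR (k + 1) + (alphaR k)^-1 = alphaL (k + 1) + (alphaL k)^-1.
Proof.
rewrite /alphaR /alphaL !invf_div.
have r1 := slopeR_gt0 (k + 1); have l1 := slopeL_gt0 (k + 1).
rewrite -!mulrDl.
suff : (slopeR (k + 1 + 1) + slopeR k) * slopeL (k + 1) =
       (slopeL (k + 1 + 1) + slopeL k) * slopeR (k + 1).
  by move=> h; apply/eqP; rewrite eqr_div ?(lt0r_neq0 r1) ?(lt0r_neq0 l1)//; exact/eqP.
(* Of the four sign patterns of [k] and [k + 1], the second is impossible and the third is [k = -1],
   where the recurrence is taken at the exceptional index 0. *)
have [[k0 e1 e2 e3]|[k0 e1 e2 e3]] := slope_succ k;
  have [[k1 f1 f2 f3]|[k1 f1 f2 f3]] := slope_succ (k + 1).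
- by rewrite f1 f2 e1 e2 e3; ring.
- by rewrite intrD in k1; lra.
- have k1' : (k%:~R : R) = -1 by rewrite intrD in k1; lra.
  by rewrite f1 f2 e1 e2 e3 k1'; ring.
- by rewrite f1 f2 e1 e2 e3; ring.
Qed.

(** Consecutive values of the sequence differ by at most 2, and each value is at least [mag]. *)
Lemma alphaR_bound k : `|alphaR k - 1| <= 2 / mag R k.
Proof.
have r0 := slopeR_gt0 k; have m0 := mag_gt0 R k; have h := mag_le_slopeR k.
have -> : alphaR k - 1 = (slopeR (k + 1) - slopeR k) / slopeR k.
  by rewrite /alphaR; field; rewrite gt_eqF.
rewrite normrM normfV (gtr0_norm r0).
apply: ler_pM => //; [by rewrite invr_ge0 ltW| |by rewrite lef_pV2].
by have [[_ -> _ _]|[_ -> _ _]] := slope_succ k; rewrite addrAC subrr add0r ?normrN ger0_norm//; lra.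
Qed.

Lemma alphaL_bound k : `|alphaL k - 1| <= 2 / mag R k.
Proof.
have r0 := slopeL_gt0 k; have m0 := mag_gt0 R k; have h := mag_le_slopeL k.
have -> : alphaL k - 1 = (slopeL (k + 1) - slopeL k) / slopeL k.
  by rewrite /alphaL; field; rewrite gt_eqF.
rewrite normrM normfV (gtr0_norm r0).
apply: ler_pM => //; [by rewrite invr_ge0 ltW| |by rewrite lef_pV2].
by have [[_ _ -> _]|[_ _ -> _]] := slope_succ k; rewrite addrAC subrr add0r ?normrN ger0_norm//; lra.
Qed.

(** For [k >= 0] equality would mean [slopeL k = 2 * slopeR k], that is [40 + 2 * k = 80 + 2 * k];
    negative [k] is symmetric. *)
Lemma alpha_neq k : alphaR k != alphaL k.
Proof.
have r0 := slopeR_gt0 k; have l0 := slopeL_gt0 k.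
rewrite /alphaR /alphaL eqr_div ?(lt0r_neq0 r0) ?(lt0r_neq0 l0)//.
have m40 := mag_ge40 R k; have hr := mag_le_slopeR k; have hl := mag_le_slopeL k.
apply/eqP.
have [[k0 -> -> e]|[k0 -> -> e]] := slope_succ k.
  have e' : slopeR k = mag R k by rewrite /slopeR ger0_norm// subrr mul0r addr0.
  have e'' : mag R k = 40 + k%:~R by rewrite /mag ger0_norm.
  by rewrite e e' e''; lra.
have e' : slopeL k = mag R k by rewrite /slopeL ler0_norm; lra.
have e'' : mag R k = 40 - k%:~R by rewrite /mag ler0_norm; lra.
by rewrite e e' e''; lra.
Qed.

(** [bendP] and [bendQ] solve [1 + 2 * dilat + P + Q = alphaR] and [1 + 2 * dilat + P - Q = alphaL],
    the one-sided slopes prescribed in the middle of the gap. *)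
Definition bendP k : R := (alphaR k + alphaL k) / 2 - 1 - 2 * dilat k.
Definition bendQ k : R := (alphaR k - alphaL k) / 2.

Definition broken : int -> R -> R := gapfam bendP bendQ.
Definition smooth : int -> R -> R := gapfam (fun=> 0) (fun=> 0).

Lemma broken_family : gap_family broken.
Proof.
apply: gapfam_family => k; have := alphaR_bound k; have := alphaL_bound k;
  have := dilat_bound k; rewrite !ler_norml => /andP[? ?] /andP[? ?] /andP[? ?].
  by rewrite /bendP; apply/andP; split; lra.
by rewrite /bendQ; apply/andP; split; lra.
Qed.

Lemma smooth_family : gap_family smooth.
Proof.
by apply: gapfam_family => k; rewrite normr0 divr_ge0// ltW// mag_gt0.
Qed.

Definition on_gap k x := exists n : int, n%:~R < sc k x < n%:~R + 1.

Lemma gap_dichotomy x : (forall k, exists n : int, sc k x = n%:~R) \/ exists k, on_gap k x.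
Proof.
have [//|/existsNP[k hk]] := pselect (forall k, exists n : int, sc k x = n%:~R).
  by left.
right; exists k, (Num.floor (sc k x)).
have /andP[f1 f2] := floor_itv (sc k x); rewrite intrD in f2.
rewrite f2 andbT lt_neqAle f1 andbT; apply/eqP => e.
by apply: hk; exists (Num.floor (sc k x)).
Qed.

Lemma center_on_gap k x : center (sc k x) -> on_gap k x.
Proof. by move=> [n e]; exists n; rewrite e; apply/andP; lra. Qed.

Definition singular x := exists k, center (sc k x).

Lemma sderiv_broken x : ~ singular x -> exists d, sderiv setT (gmap broken) x d.
Proof.
move=> ns; have [ints|[k [n hn]]] := gap_dichotomy x.
  exists 1; apply: (sderiv_gmap_flat broken_family _ ints) => k n.
  exact: sderiv_gapfam_int.
have nc : ~ center (sc k x) by move=> h; apply: ns; exists k.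
have [d hd] := sderiv_gapfam bendP bendQ k nc.
by eexists; apply: (sderiv_gmap_gap broken_family hn hd).
Qed.

Lemma sderiv_smooth x : exists d, sderiv setT (gmap smooth) x d.
Proof.
have [ints|[k [n hn]]] := gap_dichotomy x.
  exists 1; apply: (sderiv_gmap_flat smooth_family _ ints) => k n.
  exact: sderiv_gapfam_int.
have hd : sderiv setT (smooth k) (sc k x)
    (wt R k * (dilat k * ramp' (sc k x) + 0 + 0)).
  apply: (@sderiv_eq_near _ _ _ (fun u => wt R k * (dilat k * ramp u + 0 + 0)) _ _ 1) => //.
    by move=> u v _ _ _ _; rewrite /smooth /gapfam; ring.
  apply/sderivZ/sderivD; last exact: sderiv_cst.
  by apply: sderivD; [apply/sderivZ; exact: sderiv_ramp|exact: sderiv_cst].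
by eexists; apply: (sderiv_gmap_gap smooth_family hn hd).
Qed.

Lemma sderiv_broken_center k x : center (sc k x) ->
  sderiv [set u | x <= u] (gmap broken) x (alphaR k) /\
  sderiv [set u | u <= x] (gmap broken) x (alphaL k).
Proof.
move=> c; have [n hn] := center_on_gap c; have w0 := wt_gt0 R k.
have w1 : 0 < (wt R k)^-1 by rewrite invr_gt0.
have [hr hl] := sderiv_gapfam_center bendP bendQ k c; split.
  have -> : alphaR k = 1 + (wt R k)^-1 * (wt R k * (2 * dilat k + bendP k + bendQ k)).
    by rewrite mulrA mulVf ?gt_eqF// mul1r /bendP /bendQ; lra.
  apply: sderiv_subset (sderiv_gmap_gap broken_family hn hr).
  by move=> u /= xu; rewrite lerDl mulr_ge0 ?subr_ge0// ltW.
have -> : alphaL k = 1 + (wt R k)^-1 * (wt R k * (2 * dilat k + bendP k - bendQ k)).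
  by rewrite mulrA mulVf ?gt_eqF// mul1r /bendP /bendQ; lra.
apply: sderiv_subset (sderiv_gmap_gap broken_family hn hl).
by move=> u /= xu; rewrite gerDl pmulr_rle0// subr_le0.
Qed.

(** [ramp] fixes 1/2 and [wiggle] vanishes there. Middles are thus sent to middles, which is why the
    breaks form a single orbit on the circle. *)
Lemma psi_broken_half k : psi broken k 2^-1 = 2^-1.
Proof.
apply: (mulfI (lt0r_neq0 (wt_gt0 R (k + 1)))); rewrite psiE.
rewrite /broken /gapfam ramp_half wiggle_half normr0 !mulr0 !addr0 /dilat.
by field; rewrite gt_eqF ?wt_gt0.
Qed.

Lemma center_gmap k x : center (sc (k + 1) (gmap broken x)) <-> center (sc k x).
Proof.
rewrite (sc_gmap broken_family).
have e (n : int) : psi broken k (n%:~R + 2^-1) = n%:~R + 2^-1.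
  by rewrite addrC (psi_addz broken_family) psi_broken_half.
split=> -[n hn]; exists n; last by rewrite hn e.
have [g [gK _]] := psi_bij broken_family k.
by apply: (can_inj gK); rewrite hn e.
Qed.

Lemma singular_gmap x : singular (gmap broken x) <-> singular x.
Proof.
split=> -[k hk]; last by exists (k + 1); exact/center_gmap.
by exists (k - 1); apply/center_gmap; rewrite subrK.
Qed.

Section Kick.
Variable Gi : R -> R.
Hypothesis GiK : cancel Gi (gmap broken).
Hypothesis Gi_lip : forall u v, `|Gi u - Gi v| <= 2 * `|u - v|.

Definition kick x : R := gmap broken x + Gi x - 2 * x.

(* At a singular point the one-sided derivatives [alpha (k + 1)] of G and
   [(alpha k)^-1] of its inverse add up to the same value on both sides. *)
Lemma sderiv_kick x : exists d, sderiv setT kick x d.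
Proof.
have Ge := gmap_near_id broken_family.
have mono u v : u <= v -> Gi u <= Gi v.
  move=> uv; rewrite leNgt; apply/negP => /(near_id_lt Ge); rewrite !GiK; lra.
have lin A : sderiv A (fun u => - (2 * u)) x (- (2 * 1)).
  by apply/sderivN/sderivZ; exact: sderiv_id.
have [sx|nsx] := pselect (singular x); last first.
  have [d hd] := sderiv_broken nsx.
  have nsx' : ~ singular (Gi x) by move/singular_gmap; rewrite GiK.
  have [d' hd'] := sderiv_broken nsx'; have d'0 := near_id_sderiv_gt0 Ge hd'.
  have h := sderiv_inv (@ltr0Sn R 1) GiK d'0 Gi_lip hd'.
  eexists; apply: sderivD (lin _); apply: sderivD hd _; exact: sderiv_subset h.
have [k hk] : exists k, center (sc k (Gi x)) by apply/singular_gmap; rewrite GiK.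
have hk1 : center (sc (k + 1) x) by rewrite -[x]GiK; exact/center_gmap.
have [Gr Gl] := sderiv_broken_center hk1; have [Hr Hl] := sderiv_broken_center hk.
have ar : 0 < alphaR k by rewrite divr_gt0 ?slopeR_gt0.
have al : 0 < alphaL k by rewrite divr_gt0 ?slopeL_gt0.
have Hr' := sderiv_inv (@ltr0Sn R 1) GiK ar Gi_lip Hr.
have Hl' := sderiv_inv (@ltr0Sn R 1) GiK al Gi_lip Hl.
exists (alphaR (k + 1) + (alphaR k)^-1 + - (2 * 1)); apply: sderiv_glue.
  apply: sderivD (lin _); apply: sderivD Gr _.
  by apply: sderiv_subset Hr' => u /=; exact: mono.
rewrite alpha_recurrence; apply: sderivD (lin _); apply: sderivD Gl _.
by apply: sderiv_subset Hl' => u /=; exact: mono.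
Qed.

End Kick.
End Families.

(** * Topological conjugacy between two gap families *)

Section Conjugacy.
Variable R : realType.
Implicit Types (phi : R -> R) (k : int) (x u s : R).

Definition gap_homeo phi :=
  [/\ {mono phi : u v / u <= v}, phi 0 = 0, (forall s (n : int), phi (s + n%:~R) = phi s + n%:~R) &
      exists phi', cancel phi phi' /\ cancel phi' phi].

Lemma gap_homeo_comp phi phi2 : gap_homeo phi -> gap_homeo phi2 -> gap_homeo (phi \o phi2).
Proof.
move=> [m0 z0 a0 [g [g1 g2]]] [m1 z1 a1 [h [h1 h2]]]; split=> [u v|||] /=.
- by rewrite m0 m1.
- by rewrite z1.
- by move=> s n; rewrite a1 a0.
- by exists (h \o g); split; [exact: can_comp|exact: can_comp].
Qed.

Lemma gap_homeo_inv phi phi' : gap_homeo phi -> cancel phi phi' -> cancel phi' phi ->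
  gap_homeo phi'.
Proof.
move=> [m0 z0 a0 _] h1 h2; split=> [u v|||].
- by rewrite -m0 !h2.
- by rewrite -{1}z0 h1.
- by move=> s n; rewrite -{1}(h2 s) -a0 h1.
- by exists phi.
Qed.

Lemma gap_homeo_id : gap_homeo id.
Proof. by split=> //; exists id. Qed.

Lemma gap_homeo_int phi (n : int) : gap_homeo phi -> phi n%:~R = n%:~R.
Proof. by move=> [_ z a _]; rewrite -[in LHS](add0r n%:~R) a z add0r. Qed.

Lemma gap_homeo_psi b k : gap_family b -> gap_homeo (psi b k).
Proof.
move=> gb; split.
- exact/le_mono/(psi_lt gb).
- by have := psi_int gb k 0.
- by move=> s n; exact: psi_addz.
- exact: psi_bij.
Qed.

(** Gaps never return to themselves, so the identity may be chosen on the gap 0 and transported by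
    the two families, forwards and backwards. *)
Lemma gap_conjugacy b c : gap_family b -> gap_family c ->
  exists eta : int -> R -> R, (forall k, gap_homeo (eta k)) /\
    forall k s, eta (k + 1) (psi b k s) = psi c k (eta k s).
Proof.
move=> gb gc.
have [B hB] := choice (psi_bij gb); have [C hC] := choice (psi_bij gc).
pose up := fix up n := if n is m.+1 then psi c (Posz m) \o up m \o B (Posz m) else id.
pose down := fix down n := if n is m.+1 then C (Negz m) \o down m \o psi b (Negz m) else id.
have hup n : gap_homeo (up n).
  elim: n => [|n IH] /=; first exact: gap_homeo_id.
  apply: gap_homeo_comp; first by apply: gap_homeo_comp IH; exact: gap_homeo_psi.
  have [h1 h2] := hB (Posz n); exact: gap_homeo_inv (gap_homeo_psi _ gb) h1 h2.
have hdown n : gap_homeo (down n).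
  elim: n => [|n IH] /=; first exact: gap_homeo_id.
  apply: gap_homeo_comp; last exact: gap_homeo_psi.
  apply: gap_homeo_comp IH.
  have [h1 h2] := hC (Negz n); exact: gap_homeo_inv (gap_homeo_psi _ gc) h1 h2.
(* [Negz n] lies [n + 1] steps before the gap 0. *)
exists (fun k => if k is Negz n then down n.+1 else up `|k|%N).
split=> [[n|n]|[n|n] s]; [exact: hup|exact: hdown| |].
  have -> : Posz n + 1 = Posz n.+1 by lia.
  by have [h1 _] := hB (Posz n); rewrite /= h1.
have [_ h2] := hC (Negz n); rewrite [RHS]h2.
case: n {h2} => [|n]; first by have -> : Negz 0 + 1 = Posz 0 by lia.
by have -> : Negz n.+1 + 1 = Negz n by lia.
Qed.

Lemma coord_inj x u : hc x = hc u -> (forall k, sc k x = sc k u) -> x = u.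
Proof.
by move=> e h; rewrite -(coordE x) -(coordE u) e; congr pt; apply/funext => k.
Qed.

Definition fill (eta : int -> R -> R) x : R := pt (hc x) (fun k => eta k (sc k x)).

Lemma coord_fill eta x : (forall k, gap_homeo (eta k)) ->
  hc (fill eta x) = hc x /\ forall k, sc k (fill eta x) = eta k (sc k x).
Proof.
move=> he; apply: coord_pt; apply: valid_fill (coord_valid x).
  by move=> k n; exact: gap_homeo_int.
by move=> k u v uv; have [-> _ _ _] := he k.
Qed.

Lemma fill_le eta x u : (forall k, gap_homeo (eta k)) -> x <= u -> fill eta x <= fill eta u.
Proof.
move=> he xu; have v y : valid (hc y) (fun k => eta k (sc k y)).
  apply: valid_fill (coord_valid y); first by move=> k n; exact: gap_homeo_int.
  by move=> k w z wz; have [-> _ _ _] := he k.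
rewrite /fill /pt lerD//; first by rewrite ler_wpM2l ?slack_ge0 ?ler_hc.
apply: ler_zsum; [exact: dominated_valid (v x)|exact: dominated_valid (v u)|].
by move=> k; rewrite ler_wpM2l ?wt_ge0//; have [-> _ _ _] := he k; exact: ler_sc.
Qed.

(** [fill eta] keeps the level and acts on each gap coordinate separately, so inverses, integer
    translations and the conjugacy are all checked coordinate by coordinate. *)
Lemma gmap_conjugate b c : gap_family b -> gap_family c ->
  exists h hi : R -> R, [/\ cancel h hi, cancel hi h, {mono h : u v / u <= v},
    (forall x (m : int), h (x + m%:~R) = h x + m%:~R) &
    forall x, h (gmap b x) = gmap c (h x)].
Proof.
move=> gb gc; have [eta [he hc1]] := gap_conjugacy gb gc.
have /choice[ei hi] : forall k, exists g, cancel (eta k) g /\ cancel g (eta k).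
  by move=> k; have [] := he k.
have hei k : gap_homeo (ei k) by have [h1 h2] := hi k; exact: gap_homeo_inv (he k) h1 h2.
have K1 : cancel (fill eta) (fill ei).
  move=> x; have [e1 e2] := coord_fill (fill eta x) hei; have [e3 e4] := coord_fill x he.
  by apply: coord_inj => [|k]; rewrite ?e1 ?e2 ?e3 ?e4//; have [-> _] := hi k.
have K2 : cancel (fill ei) (fill eta).
  move=> x; have [e1 e2] := coord_fill (fill ei x) he; have [e3 e4] := coord_fill x hei.
  by apply: coord_inj => [|k]; rewrite ?e1 ?e2 ?e3 ?e4//; have [_ ->] := hi k.
exists (fill eta), (fill ei); split=> //.
- apply/le_mono => u v uv; rewrite lt_neqAle fill_le ?ltW// andbT.
  by apply/eqP => /(can_inj K1) e; move: uv; rewrite e ltxx.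
- move=> x m; have [e1 e2] := coord_fill (x + m%:~R) he; have [e3 e4] := coord_fill x he.
  have [e5 e6] := coord_addz x m; have [e7 e8] := coord_addz (fill eta x) m.
  apply: coord_inj => [|k]; first by rewrite e1 e5 e7 e3.
  by rewrite e2 e6 e8 e4; have [_ _ -> _] := he k.
- move=> x; have [e1 e2] := coord_fill (gmap b x) he; have [e3 e4] := coord_fill x he.
  apply: coord_inj => [|k]; first by rewrite e1 !hc_gmap// e3.
  by rewrite e2 -[k](subrK 1) !sc_gmap// hc1 e4.
Qed.

Lemma mono_bij_continuous (h hi : R -> R) : {mono h : u v / u <= v} -> cancel hi h ->
  continuous h.
Proof.
move=> mh K x; apply/cvgrPdist_lt => e e0.
have mlt : {mono h : u v / u < v} by exact: leW_mono.
have l : hi (h x - e) < x by rewrite -mlt K; lra.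
have r : x < hi (h x + e) by rewrite -mlt K; lra.
near=> u.
have u1 : hi (h x - e) < u by near: u; exact: lt_nbhsr.
have u2 : u < hi (h x + e) by near: u; exact: lt_nbhsl.
rewrite -mlt K in u1; rewrite -mlt K in u2; rewrite ltr_norml; apply/andP; lra.
Unshelve. all: by end_near. Qed.

End Conjugacy.

(** * Density of forward orbits of the rotation *)

Section Density.
Variable R : realType.
Implicit Types (x y p q e : R).

(** Pigeonhole: two of [N + 1] fractional parts share one of [N] boxes of width [N^-1 < e].
    Irrationality makes their difference nonzero. *)
Lemma small_rotation e : 0 < e -> exists (n : nat) (m : int),
  (0 < n)%N /\ 0 < `|n%:R * rho R + m%:~R| < e.
Proof.
move=> e0; pose N := (Num.truncn e^-1).+1.
have N0 : 0 < N%:R :> R by rewrite ltr0n.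
have Ne : N%:R^-1 < e.
  by rewrite invf_plt ?posrE//; exact: truncnS_gt.
pose fr (i : nat) : R := i%:R * rho R - (Num.floor (i%:R * rho R))%:~R.
have fr01 i : 0 <= fr i < 1.
  by have /andP[h1 h2] := floor_itv (i%:R * rho R); rewrite intrD in h2; rewrite /fr; apply/andP; lra.
have box i : (Num.truncn (N%:R * fr i) < N)%N.
  have /andP[h1 h2] := fr01 i; rewrite truncn_lt_nat; last by rewrite mulr_ge0.
  by rewrite gtr_pMr.
pose f (i : 'I_N.+1) : 'I_N := Ordinal (box i).
have /injectivePn [i [j ij fij]] : ~~ injectiveb f.
  by apply/negP => /injectiveP/leq_card; rewrite !card_ord ltnn.
have {fij} : Num.truncn (N%:R * fr i) = Num.truncn (N%:R * fr j) by case: fij.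
have main (a b : nat) : (a < b)%N -> Num.truncn (N%:R * fr a) = Num.truncn (N%:R * fr b) ->
    exists (n : nat) (m : int), (0 < n)%N /\ 0 < `|n%:R * rho R + m%:~R| < e.
  move=> ab E; exists (b - a)%N.
  exists (Num.floor (a%:R * rho R) - Num.floor (b%:R * rho R)); split; first by rewrite subn_gt0.
  have -> : (b - a)%:R * rho R + (Num.floor (a%:R * rho R) - Num.floor (b%:R * rho R))%:~R
     = fr b - fr a.
    by rewrite natrB ?(ltnW ab)// intrB /fr; ring.
  apply/andP; split.
    rewrite normr_gt0; apply/eqP; rewrite /fr => h.
    have : ((Posz b - Posz a)%:~R : R) * rho R =
       (Num.floor (b%:R * rho R) - Num.floor (a%:R * rho R))%:~R.
      by rewrite !intrB -!pmulrn mulrBl; lra.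
    by move/rho_irrational; lia.
  apply: lt_trans Ne.
  have nn c : 0 <= N%:R * fr c by rewrite mulr_ge0//; have /andP[] := fr01 c.
  have /andP[a1 a2] := truncn_itv (nn a); have /andP[b1 b2] := truncn_itv (nn b).
  rewrite E in a1 a2; rewrite -natr1 in a2 b2.
  rewrite -(ltr_pM2l N0) divff ?gt_eqF// -{1}(gtr0_norm N0) -normrM mulrBr.
  by rewrite ltr_norml; apply/andP; lra.
move=> E; have [h|h|h] := ltngtP i j.
- exact: main h E.
- exact: main h (esym E).
- by move/eqP: ij; case; exact: val_inj.
Qed.

(** Multiples of a step shorter than [q - p] cannot jump over the interval. The sign of the step is
    not controlled and [n] must be positive, so the walk starts at an integer translate of [y] below
    [p] or above [q] accordingly. *)
Lemma rotation_dense y p q : p < q -> exists (n : nat) (m : int),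
  (0 < n)%N /\ p < y + n%:R * rho R + m%:~R < q.
Proof.
move=> pq; have qp : 0 < q - p by rewrite subr_gt0.
have [n [m [n0 /andP[d0 dq]]]] := small_rotation qp.
set d := n%:R * rho R + m%:~R in d0 dq.
have [dp|dn] := ltP 0 d.
  rewrite (gtr0_norm dp) in dq.
  pose M := - (Num.floor (y - p) + 1).
  have yM : y + M%:~R < p.
    have /andP[_] := floor_itv (y - p); rewrite /M mulrNz; lra.
  pose j := (Num.truncn ((p - (y + M%:~R)) / d)).+1.
  exists (j * n)%N, (M + m * Posz j); split; first by rewrite muln_gt0 n0.
  have nn : 0 <= (p - (y + M%:~R)) / d by rewrite divr_ge0; lra.
  have /andP[j1 j2] := truncn_itv nn.
  have -> : y + (j * n)%:R * rho R + (M + m * Posz j)%:~R = y + M%:~R + j%:R * d.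
    by rewrite natrM intrD intrM -pmulrn /d; ring.
  rewrite ltr_pdivrMr// in j2; rewrite ler_pdivlMr// in j1.
  rewrite /j -natr1 mulrDl mul1r; rewrite -natr1 mulrDl mul1r in j2.
  by apply/andP; lra.
have {}dn : d < 0 by rewrite lt_neqAle dn andbT -normr_gt0.
rewrite (ltr0_norm dn) in dq.
pose M := Num.floor (q - y) + 1.
have yM : q < y + M%:~R.
  have /andP[_] := floor_itv (q - y); rewrite /M; lra.
pose j := (Num.truncn ((y + M%:~R - q) / - d)).+1.
exists (j * n)%N, (M + m * Posz j); split; first by rewrite muln_gt0 n0.
have nd : 0 < - d by rewrite oppr_gt0.
have nn : 0 <= (y + M%:~R - q) / - d by rewrite divr_ge0; lra.
have /andP[j1 j2] := truncn_itv nn.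
have -> : y + (j * n)%:R * rho R + (M + m * Posz j)%:~R = y + M%:~R + j%:R * d.
  by rewrite natrM intrD intrM -pmulrn /d; ring.
rewrite ltr_pdivrMr// in j2; rewrite ler_pdivlMr// in j1.
rewrite /j -natr1 mulrDl mul1r; rewrite -natr1 mulrDl mul1r in j2.
by apply/andP; lra.
Qed.

End Density.

(** * The circle: projection, lifts and compactness *)

Section Circle.
Variable R : realType.
Local Notation T := (circle R).
Implicit Types (x u v : R) (t : T) (G F : R -> R).

Lemma T_proj0 : T_proj 0 = 0 :> T.
Proof. by rewrite -[0 in LHS](subrr 0) T_projB subrr. Qed.

Lemma T_projN x : T_proj (- x) = - T_proj x :> T.
Proof. by rewrite -[- x]sub0r T_projB T_proj0 sub0r. Qed.

Lemma T_projD x u : T_proj (x + u) = T_proj x + T_proj u :> T.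
Proof. by rewrite -[u in LHS]opprK T_projB T_projN opprK. Qed.

Lemma T_proj_int x (m : int) : T_proj (x + m%:~R) = T_proj x.
Proof. by apply/T_proj_eq; rewrite addrAC subrr add0r intr_int. Qed.

Lemma T_proj_eqP x u : T_proj x = T_proj u -> exists m : int, x = u + m%:~R.
Proof.
by move/T_proj_eq/intrP => [m h]; exists m; rewrite -h addrC subrK.
Qed.

Lemma T_proj_surj t : exists x, t = T_proj x.
Proof. by exists (T_rep t); rewrite T_repK. Qed.

Lemma T_rep_proj x : exists m : int, T_rep (T_proj x) = x + m%:~R.
Proof. by apply: T_proj_eqP; rewrite T_repK. Qed.

Lemma T_rep_small x : `|x| < 2^-1 -> T_rep (T_proj x) = x.
Proof.
rewrite ltr_norml => /andP[x1 x2]; have [m h] := T_rep_proj x.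
have := T_rep_itv (T_proj x); rewrite h => /andP[h1 h2].
have l : (-1)%:~R < m%:~R :> R by rewrite mulrNz; lra.
have r : m%:~R < 1%:~R :> R by rewrite /=; lra.
rewrite !ltr_int in l r; have -> : m = 0 by lia.
by rewrite addr0.
Qed.

Lemma T_proj_continuous : continuous (@T_proj R).
Proof. exact: pi_continuous. Qed.

(** The projection is open, because the saturation of a ball is the union of its integer
    translates. *)
Lemma nbhs_T x (A : set T) : nbhs (T_proj x) A <-> \forall u \near x, A (T_proj u).
Proof.
split; first exact: T_proj_continuous.
move=> [e /= e0 H]; rewrite nbhsE /=; exists (@T_proj R @` ball x e); last first.
  by move=> _ [u ux <-]; apply: H.
split; last by exists x => //; exact: ballxx.
change (open (@T_proj R @^-1` (@T_proj R @` ball x e))).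
have -> : @T_proj R @^-1` (@T_proj R @` ball x e) =
    \bigcup_(m : int) (fun u => u + m%:~R) @^-1` (ball x e).
  apply/seteqP; split=> u /=.
    by move=> [v vx /T_proj_eqP[m h]]; exists m => //=; rewrite -h.
  by move=> [m _ /= h]; exists (u + m%:~R) => //; exact: T_proj_int.
apply: bigcup_open => m _; apply: open_comp; last exact: ball_open.
by move=> v _; apply: cvgD; [exact: cvg_id|exact: cvg_cst].
Qed.

Lemma nbhs_T_ball x (U : set T) : nbhs (T_proj x) U ->
  exists2 e : R, 0 < e & forall u, `|u - x| < e -> U (T_proj u).
Proof.
move/nbhs_T => [e /= e0 H]; exists e => // u ux; apply: H => /=.
by rewrite distrC.
Qed.

Lemma ball_nbhs_T x (e : R) (U : set T) : 0 < e ->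
  (forall u, `|u - x| < e -> U (T_proj u)) -> nbhs (T_proj x) U.
Proof.
by move=> e0 H; apply/nbhs_T; exists e => // u /=; rewrite distrC => /H.
Qed.

Definition tmap G t : T := T_proj (G (T_rep t)).

Definition addz G := forall x (m : int), G (x + m%:~R) = G x + m%:~R.

Lemma tmapE G x : addz G -> tmap G (T_proj x) = T_proj (G x).
Proof.
by move=> aG; have [m h] := T_rep_proj x; rewrite /tmap h aG T_proj_int.
Qed.

Lemma iter_tmap G n x : addz G -> iter n (tmap G) (T_proj x) = T_proj (iter n G x).
Proof. by move=> aG; elim: n => //= n ->; rewrite tmapE. Qed.

Lemma continuous_T (Z : topologicalType) (f : T -> Z) :
  continuous (fun x => f (T_proj x)) -> continuous f.
Proof.
move=> cf t; have [x ->] := T_proj_surj t => A fA; apply/nbhs_T; exact: cf.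
Qed.

Lemma tmap_continuous G : addz G -> continuous G -> continuous (tmap G).
Proof.
move=> aG cG; apply: continuous_T.
have -> : (fun x => tmap G (T_proj x)) = @T_proj R \o G.
  by apply/funext => x; rewrite tmapE.
by move=> x; apply: continuous_comp; [exact: cG|exact: T_proj_continuous].
Qed.

Lemma tmap_lift G : addz G -> continuous G -> T_lift G (tmap G).
Proof. by move=> aG cG; split=> // x; rewrite tmapE. Qed.

Lemma tmap_cancel G F : addz G -> cancel G F -> cancel (tmap G) (tmap F).
Proof.
move=> aG K t; rewrite {2}/tmap; have [m h] := T_rep_proj (G (T_rep t)).
by rewrite /tmap h -aG K T_proj_int T_repK.
Qed.

Lemma addz_inv G F : addz G -> cancel G F -> cancel F G -> addz F.
Proof. by move=> aG K1 K2 x m; rewrite -{1}(K2 x) -aG K1. Qed.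

Lemma int_valued_constant F : continuous F -> (forall x, F x \is a Num.int) ->
  forall x u, F x = F u.
Proof.
move=> cF iF; suff H x u : x <= u -> F x = F u.
  by move=> x u; have [/H//|/ltW/H] := leP x u.
move=> xu; apply/eqP; apply/negPn/negP => ne.
have [a /= ha] := intrP (iF x); have [b /= hb] := intrP (iF u).
(* Distinct integers are at least 1 apart, so this half-integer would be a value of [F]. *)
have [||c _] := @IVT _ F x u (Num.min (F x) (F u) + 2^-1) xu.
- exact: continuous_subspaceT.
- have h : 1 <= `|F x - F u|.
    rewrite ha hb -intrB -intr_norm -[1]/(1%:~R) ler_int.
    by move: ne; rewrite ha hb eqr_int; lia.
  have [l|l] := leP (F x) (F u).
    by rewrite ler0_norm ?subr_le0// in h; apply/andP; lra.
  by rewrite gtr0_norm ?subr_gt0// in h; apply/andP; lra.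
have [z /= hz] := intrP (iF c).
have [k ->] : exists k : int, Num.min (F x) (F u) = k%:~R.
  by have [_|_] := leP (F x) (F u); [exists a|exists b].
rewrite hz => e; have : ((z - k) * 2)%:~R = 1%:~R :> R by rewrite intrM intrB e /=; lra.
by move/eqP; rewrite eqr_int; lia.
Qed.

Lemma T_lift_unique G F g : T_lift G g -> T_lift F g ->
  exists m : int, forall x, F x = G x + m%:~R.
Proof.
move=> [cG hG] [cF hF].
have iFG x : F x - G x \is a Num.int by apply/T_proj_eq; rewrite hG hF.
have [m hm] := intrP (iFG 0); exists m => x.
have c : continuous (fun x => F x - G x) by move=> z; apply: cvgB; [exact: cF|exact: cG].
by rewrite -hm (int_valued_constant c iFG 0 x) addrC subrK.
Qed.

Lemma T_compact : compact [set: T].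
Proof.
have -> : [set: T] = @T_proj R @` `[0, 1]%classic.
  apply/seteqP; split=> // t _; have [x ->] := T_proj_surj t.
  exists (x - (Num.floor x)%:~R); last by rewrite -mulrNz T_proj_int.
  by have /andP[] := floor_itv x; rewrite intrD /= in_itv /=; lra.
apply: continuous_compact; last exact: segment_compact.
exact/continuous_subspaceT/T_proj_continuous.
Qed.

End Circle.

(** * Dynamics on the minimal Cantor set *)

Section DenjoyDynamics.
Variable R : realType.
Local Notation T := (circle R).
Implicit Types (x u v : R) (t : T).

Definition locconst x := exists2 e : R, 0 < e & forall u, `|u - x| < e -> hc u = hc x.

(** The Cantor set is described as the set of growth of the collapse [hc], which avoids any
    reference to the endpoints of gaps. *)
Definition denjoy_set : set T := [set t | exists x, t = T_proj x /\ ~ locconst x].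

Lemma locconst_addz x (m : int) : locconst x -> locconst (x + m%:~R).
Proof.
move=> [e e0 H]; exists e => // u ux; have [-> _] := coord_addz x m.
have [h _] := coord_addz (u - m%:~R) m; rewrite subrK in h; rewrite h H//.
by have -> : u - m%:~R - x = u - (x + m%:~R) by ring.
Qed.

Lemma denjoy_setE x : denjoy_set (T_proj x) <-> ~ locconst x.
Proof.
split=> [[u [e nu]] lx|nx]; last by exists x.
by have [m h] := T_proj_eqP (esym e); apply: nu; rewrite h; exact: locconst_addz.
Qed.

Lemma on_gap_locconst k x : on_gap k x -> locconst x.
Proof.
move=> [n hn]; have [r r0 win] := gap_window hn; exists r => // u /win hu.
by have [] := sc_gap hn hu.
Qed.

Lemma exists_center : exists x, sc 0 x = 2^-1 :> R.
Proof.
pose s k : R := lo 0 k + 2^-1 * (hi 0 k - lo 0 k).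
have v : valid 0 s.
  by apply: valid_convex (@valid_lo R 0) (@valid_hi R 0); apply/andP; lra.
exists (pt 0 s); have [_ ->] := coord_pt v.
by rewrite /s /lo /hi mul0r subr0 ceil0 floor0; lra.
Qed.

Section Dynamics.
Variables (b : int -> R -> R) (Gi : R -> R).
Hypothesis gb : gap_family b.
Let G := gmap b.
Hypotheses (GK : cancel G Gi) (GiK : cancel Gi G).
Hypothesis Gi_lip : forall u v, `|Gi u - Gi v| <= 2 * `|u - v|.
Let g := tmap G.

Let aG : addz G. Proof. exact: gmap_addz. Qed.

Lemma hc_iter n x : hc (iter n G x) = hc x + n%:R * rho R.
Proof.
elim: n => [|n IH] /=; first by rewrite mul0r addr0.
by rewrite hc_gmap// IH -natr1; ring.
Qed.

Lemma hc_iterD n x (m : int) :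
  hc (iter n G x + m%:~R) = hc x + n%:R * rho R + m%:~R.
Proof. by have [-> _] := coord_addz (iter n G x) m; rewrite hc_iter. Qed.

(** A return would make [n * rho] an integer. Only the levels of [u] and [x] need to agree, so this
    excludes periodic points and also returns to a gap. *)
Lemma no_period n x u (m : int) : (0 < n)%N -> hc u = hc x ->
  iter n G x <> u + m%:~R.
Proof.
move=> n0 e h; have := hc_iter n x; rewrite h.
have [-> _] := coord_addz u m; rewrite e => h'.
have : (Posz n)%:~R * rho R = m%:~R by rewrite -pmulrn; lra.
by move/rho_irrational => h''; move: n0; lia.
Qed.

(** Close to [x] there is a point [u] of another level. The rotation brings the level of [z]
    strictly between the two, and monotonicity of [hc] then places the iterate between [u] and
    [x]. *)
Lemma recurrence x z e : ~ locconst x -> 0 < e ->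
  exists (n : nat) (m : int), (0 < n)%N /\ `|iter n G z + m%:~R - x| < e.
Proof.
move=> nx e0; have [u ue ux] : exists2 u, `|u - x| < e & hc u <> hc x.
  apply: contrapT => h; apply: nx; exists e => // u ue.
  by apply: contrapT => hu; apply: h; exists u.
have [l|l|//] := ltgtP (hc u) (hc x).
  have [n [m [n0]]] := rotation_dense (hc z) l.
  rewrite -hc_iterD => /andP[/hc_lt h1 /hc_lt h2]; exists n, m; split=> //.
  by move: ue; rewrite !ltr_norml => /andP[? ?]; apply/andP; lra.
have [n [m [n0]]] := rotation_dense (hc z) l.
rewrite -hc_iterD => /andP[/hc_lt h1 /hc_lt h2]; exists n, m; split=> //.
by move: ue; rewrite !ltr_norml => /andP[? ?]; apply/andP; lra.
Qed.

Lemma locconst_gmap x : locconst (G x) <-> locconst x.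
Proof.
split=> -[e e0 H]; exists (e / 2); rewrite ?divr_gt0// => u ux.
  have := H (G u); rewrite !hc_gmap// => h.
  apply: (addIr (rho R)); apply: h.
  by apply: le_lt_trans (near_id_lip _ _ (gmap_near_id gb)) _; lra.
have := H (Gi u); rewrite -{1}(GK x) => h.
rewrite -[u]GiK !hc_gmap// h//.
by apply: le_lt_trans (Gi_lip _ _) _; lra.
Qed.

Lemma locconst_iter n x : locconst (iter n G x) <-> locconst x.
Proof. by elim: n => //= n IH; split=> [/locconst_gmap/IH|/IH/locconst_gmap]. Qed.

(** Either [hc] is constant on the whole segment, or some iterate of the middle of gap 0 has a level
    strictly between those of the ends. *)
Lemma locconst_dense u v : u < v -> exists2 w, u < w < v & locconst w.
Proof.
move=> uv; have := ler_hc (ltW uv); rewrite le_eqVlt => /predU1P[e|l].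
  exists ((u + v) / 2); first by apply/andP; lra.
  have c w : u <= w <= v -> hc w = hc u.
    move=> /andP[/ler_hc h1 /ler_hc h2]; apply/eqP; rewrite eq_le h1 andbT.
    by rewrite -e in h2.
  exists ((v - u) / 2) => [|w]; first by lra.
  by rewrite ltr_norml => /andP[? ?]; rewrite !c//; apply/andP; lra.
have [z hz] := exists_center; have lz : locconst z.
  by apply: (@on_gap_locconst 0); exists 0; rewrite hz /=; apply/andP; lra.
have [n [m [n0]]] := rotation_dense (hc z) l.
rewrite -hc_iterD => /andP[/hc_lt h1 /hc_lt h2].
exists (iter n G z + m%:~R); first by rewrite h1.
exact/locconst_addz/locconst_iter.
Qed.

Lemma nonwandering_denjoy : nonwandering g = denjoy_set.
Proof.
apply/seteqP; split=> t; have [x ->] := T_proj_surj t.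
  move=> nw; apply/denjoy_setE => -[e e0 H].
  have [|n [n0 [s [[r [u ux <-]] <-]]]] := nw [set s | exists2 u, `|u - x| < e & T_proj u = s].
    by apply: (ball_nbhs_T e0) => u ux; exists u.
  move=> [v vx]; rewrite /g iter_tmap// => /esym/T_proj_eqP[m].
  by apply: no_period => //; rewrite !H.
move=> /denjoy_setE nx U /nbhs_T_ball[e e0 H].
have [n [m [n0 h]]] := recurrence x nx e0; exists n; split=> //.
exists (T_proj (iter n G x + m%:~R)); split; last exact: H.
exists (T_proj x); first by apply: H; rewrite subrr normr0.
by rewrite /g iter_tmap// T_proj_int.
Qed.

Lemma denjoy_closed : closed denjoy_set.
Proof.
move=> t; have [x ->] := T_proj_surj t => cl; apply/denjoy_setE => -[e e0 H].
have [|s [+ [u ux us]]] := cl [set s | exists2 u, `|u - x| < e & T_proj u = s].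
  by apply: (ball_nbhs_T e0) => u ux; exists u.
rewrite -us => /denjoy_setE; apply; exists (e - `|u - x|); first by rewrite subr_gt0.
move=> v vu; rewrite !H//.
have := ler_normD (v - u) (u - x); have -> : v - u + (u - x) = v - x by ring.
by lra.
Qed.

(** The witness is the upper end of the gap at level 0: no point above it has level 0, since [hi] is
    the largest admissible family. *)
Lemma denjoy_nonempty : denjoy_set !=set0.
Proof.
exists (T_proj (pt 0 (hi 0))); apply/denjoy_setE => -[e e0 H].
set x := pt 0 (hi 0) in H; have [h0 _] := coord_pt (@valid_hi R 0).
have /H hu : `|x + e / 2 - x| < e by rewrite addrAC subrr add0r gtr0_norm; lra.
have vu := coord_valid (x + e / 2); rewrite hu h0 in vu.
have : pt 0 (fun k => sc k (x + e / 2)) <= x.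
  rewrite /x /pt lerD2l; apply: ler_zsum => [||k].
  - exact: dominated_valid vu.
  - exact: dominated_valid (@valid_hi R 0).
  - rewrite ler_wpM2l ?wt_ge0// /hi -intrD1.
    have /andP[_ f] := floor_itv (0 - k%:~R * rho R); have [_] := vu k (Num.floor (0 - k%:~R * rho R) + 1).
    exact.
have := coordE (x + e / 2); rewrite hu h0 => ->; lra.
Qed.

(** A point of the set is approached by its own forward iterates, which stay in the set and differ
    from it by [no_period]. *)
Lemma denjoy_perfect : perfect_set denjoy_set.
Proof.
split; first exact: denjoy_closed.
apply/seteqP; split=> t.
  by move=> lt; apply: denjoy_closed => U /lt[s [_ Ks Us]]; exists s.
have [x ->] := T_proj_surj t => /denjoy_setE nx U /nbhs_T_ball[e e0 H].
have [n [m [n0 h]]] := recurrence x nx e0.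
exists (T_proj (iter n G x + m%:~R)); split; last exact: H.
- apply/eqP; rewrite T_proj_int => /T_proj_eqP[m']; exact: no_period.
- by rewrite T_proj_int; apply/denjoy_setE => /locconst_iter.
Qed.

(** Two distinct points are separated by cutting the circle at [w1] and [w2], taken outside the set
    in the two arcs that join them; the two open arcs so obtained cover the set. *)
Lemma denjoy_disconnected : totally_disconnected denjoy_set.
Proof.
move=> t Kt; apply/seteqP; split; last first.
  by move=> _ ->; exact: connected_component_refl.
move=> z [C [Ct CK conC] Cz] /=.
have [x tx] := T_proj_surj t; have [y' zy'] := T_proj_surj z.
pose y := y' - (Num.floor (y' - x))%:~R.
have zy : z = T_proj y by rewrite /y -mulrNz T_proj_int.
have /andP[f1 f2] := floor_itv (y' - x); rewrite intrD in f2.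
have xy : x <= y by rewrite /y; lra.
move: xy; rewrite le_eqVlt => /predU1P[xy|xy]; first by rewrite tx xy.
have yx1 : y < x + 1 by rewrite /y; lra.
have [w1 /andP[xw wy] lw1] := locconst_dense xy.
have [w2 /andP[yw wx] lw2] := locconst_dense yx1.
pose arc (p q : R) : set T := [set s | exists2 w, p < w < q & s = T_proj w].
have arc_open p q : open (arc p q).
  rewrite openE => s [w /andP[pw wq] ->]; apply/nbhs_T; near=> u.
  exists u => //; apply/andP; split; near: u; [exact: lt_nbhsr|exact: lt_nbhsl].
have cover s : denjoy_set s -> arc w1 w2 s \/ arc w2 (w1 + 1) s.
  have [v' sv'] := T_proj_surj s; pose v := v' - (Num.floor (v' - w1))%:~R.
  have sv : s = T_proj v by rewrite /v -mulrNz T_proj_int.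
  have /andP[g1 g2] := floor_itv (v' - w1); rewrite intrD in g2.
  have wv : w1 <= v < w1 + 1 by rewrite /v; apply/andP; lra.
  rewrite sv => /denjoy_setE nv; move: wv => /andP[]; rewrite le_eqVlt => /predU1P[e|wv] vw.
    by exfalso; apply: nv; rewrite -e.
  have [l|l|e] := ltgtP v w2; last by exfalso; apply: nv; rewrite e.
    by left; exists v => //; rewrite wv.
  by right; exists v => //; rewrite l.
have disj s : arc w1 w2 s -> arc w2 (w1 + 1) s -> False.
  move=> [u /andP[u1 u2] ->] [v /andP[v1 v2]] /T_proj_eqP[m h].
  have m1 : (-1)%:~R < m%:~R :> R by rewrite mulrNz; lra.
  have m2 : m%:~R < 0%:~R :> R by rewrite /=; lra.
  by rewrite !ltr_int in m1 m2; lia.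
have : C `&` arc w1 w2 = C.
  apply: conC.
  - by exists z; split=> //; exists y => //; rewrite wy.
  - by exists (arc w1 w2).
  - exists (~` arc w2 (w1 + 1)); first exact: open_closedC.
    apply/seteqP; split=> s [Cs h]; split=> //; first by move/(disj _ h).
    by have [//|] := cover s (CK _ Cs).
move=> e; have [_ at1] : (C `&` arc w1 w2) t by rewrite e.
exfalso; apply: disj at1 _; exists (x + 1); first by apply/andP; lra.
by rewrite tx (T_proj_int x 1).
Unshelve. all: by end_near. Qed.

(** By [recurrence], the forward orbit of any point accumulates at every point of the set; a closed
    set stable under [g] contains these limits. *)
Lemma denjoy_minimal : minimal_on g denjoy_set.
Proof.
split.
  apply/seteqP; split=> t.
    move=> [s + <-]; have [x ->] := T_proj_surj s.
    by rewrite /g tmapE// => /denjoy_setE nx; apply/denjoy_setE => /locconst_gmap.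
  have [x ->] := T_proj_surj t => /denjoy_setE nx.
  exists (T_proj (Gi x)); last by rewrite /g tmapE// GiK.
  by apply/denjoy_setE; rewrite -locconst_gmap GiK.
move=> M clM [s Ms] MK gM; apply/seteqP; split=> // t.
have [x ->] := T_proj_surj t => /denjoy_setE nx.
apply: clM => U /nbhs_T_ball[e e0 H].
have [z sz] := T_proj_surj s; have [n [m [n0 h]]] := recurrence z nx e0.
exists (T_proj (iter n G z + m%:~R)); split; last exact: H.
rewrite T_proj_int -iter_tmap// -sz; elim: n {n0 h} => //= n IH.
by apply: gM; exists (iter n (tmap G) s).
Qed.

(** By [pt_growth] the level differs from the point by a bounded amount, and it increases by exactly
    [rho] at each step; the error of the mean is at most [1 / n]. *)
Lemma rotation_gmap : continuous G -> rotation_number g (T_proj (rho R)).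
Proof.
move=> cG; exists G, (rho R); split=> // [|x]; first exact: tmap_lift.
have [B hB] := pt_growth R.
have hx v : hc v + B <= v <= hc v + B + 1.
  by have := hB _ _ (coord_valid v); rewrite coordE.
apply/cvgrPdist_lt => e e0; near=> n.
have n0 : 0 < n%:R :> R by rewrite ltr0n; near: n; exact: nbhs_infty_gt.
have en : e^-1 < n%:R by near: n; exact: nbhs_infty_gtr.
have -> : rho R - (iter n G x - x) / n%:R = (n%:R * rho R - (iter n G x - x)) / n%:R.
  by field; rewrite gt_eqF.
rewrite normrM normfV (gtr0_norm n0) ltr_pdivrMr//.
have h1 := hx x; have h2 := hx (iter n G x); rewrite hc_iter in h2.
have en' : 1 < e * n%:R by rewrite mulrC -ltr_pdivrMr// div1r.
apply: le_lt_trans en'; rewrite ler_norml.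
by move: h1 h2 => /andP[? ?] /andP[? ?]; apply/andP; lra.
Unshelve. all: by end_near. Qed.

End Dynamics.

Lemma rho_angle : irrational_angle (T_proj (rho R)).
Proof.
move=> a /esym/T_proj_eqP[m h] [q _ qa]; apply: (@pi_irrationnal R).
exists (q + m%:~R) => //; rewrite rmorphD /= ratr_int qa.
by rewrite -h.
Qed.

End DenjoyDynamics.

(** * Differentials in the plane *)

Section PlaneCalculus.
Variable R : realType.
Implicit Types (z v : R * R) (Phi : R -> R).

Definition plane_form (p q : R) z : R := p * z.1 + q * z.2.

Lemma continuous_plane_form p q : continuous (plane_form p q).
Proof.
move=> z; apply: cvgD; apply: cvgM; [exact: cvg_cst|exact: cvg_fst|exact: cvg_cst|exact: cvg_snd].
Qed.

Lemma plane_form_linear p q : linear (plane_form p q).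
Proof.
by move=> k u v; rewrite /plane_form /= /GRing.scale /=; ring.
Qed.

HB.instance Definition _ p q :=
  GRing.isLinear.Build R (R * R)%type R _ (plane_form p q) (plane_form_linear p q).

Lemma is_diff_plane_form p q z : is_diff z (plane_form p q) (plane_form p q).
Proof.
apply: DiffDef.
  exact/linear_differentiable/continuous_plane_form.
by apply: diff_lin; exact: continuous_plane_form.
Qed.

(** Both components of the lift, and of the lift of its inverse, have this shape, so one computation
    covers the four of them. *)
Lemma is_diff_comb Phi (Phi' : R -> R) (a b c p q : R) z :
  (forall x : R, is_derive x 1 Phi (Phi' x)) ->
  is_diff z (fun w => plane_form a b w + c * Phi (plane_form p q w))
    (fun v => plane_form a b v + c * (Phi' (plane_form p q z) * plane_form p q v)).
Proof.
move=> dPhi.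
have hP : is_diff (plane_form p q z) Phi (fun t : R => Phi' (plane_form p q z) * t).
  have [h1 h2] : differentiable Phi (plane_form p q z) /\ 'd Phi (plane_form p q z) =
      (fun t : R => Phi' (plane_form p q z) * t) :> (R -> R).
    split; first by have [] := is_derive_diffE 0 (dPhi (plane_form p q z)).
    by apply/funext => t; have [_ ->] := is_derive_diffE t (dPhi (plane_form p q z)); rewrite mulrC.
  exact: DiffDef.
have h := is_diff_comp (is_diff_plane_form p q z) hP.
exact: (is_diffD (is_diff_plane_form a b z) (is_diffZ c h)).
Qed.

Lemma C1_pair (F1 F2 : R * R -> R) (d1 d2 : R * R -> R * R -> R) :
  (forall z, is_diff z F1 (d1 z)) -> (forall z, is_diff z F2 (d2 z)) ->
  (forall v, continuous (d1^~ v)) -> (forall v, continuous (d2^~ v)) ->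
  C1 (fun z => (F1 z, F2 z)) /\
  forall z v, 'd (fun z => (F1 z, F2 z)) z v = (d1 z v, d2 z v).
Proof.
move=> h1 h2 c1 c2.
have dE z v : 'd (fun z => (F1 z, F2 z)) z v = (d1 z v, d2 z v).
  by have h := is_diff_pair (h1 z) (h2 z); rewrite (@diff_val _ _ _ _ _ _ _ h).
split=> //; split=> [z|v].
  by have h := is_diff_pair (h1 z) (h2 z); exact: ex_diff.
have -> : (fun z => 'd (fun z => (F1 z, F2 z)) z v) = (fun z => (d1 z v, d2 z v)).
  by apply/funext => z; exact: dE.
by move=> z; exact: (cvg_pair (c1 v z) (c2 v z)).
Qed.

Lemma continuous_comb Phi (a b c p q : R) : continuous Phi ->
  continuous (fun w => plane_form a b w + c * Phi (plane_form p q w)).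
Proof.
move=> cP z; apply: cvgD; first exact: continuous_plane_form.
apply: cvgM; first exact: cvg_cst.
apply: (@continuous_comp _ _ _ (plane_form p q) Phi); first exact: continuous_plane_form.
exact: cP.
Qed.

End PlaneCalculus.

(** * The symplectic twist map of the annulus *)

Section Annulus.
Variable R : realType.
Local Notation T := (circle R).
Local Notation A := (annulus R).

Definition pmap (F : R -> R) (t : T) : R := F (T_rep t).

Definition zperiodic (F : R -> R) := forall x (m : int), F (x + m%:~R) = F x.

Lemma pmapE F x : zperiodic F -> pmap F (T_proj x) = F x.
Proof. by move=> pF; have [m h] := T_rep_proj x; rewrite /pmap h pF. Qed.

Lemma pmap_continuous F : zperiodic F -> continuous F -> continuous (pmap F).
Proof.
move=> pF cF; apply: continuous_T.
by have -> : (fun x => pmap F (T_proj x)) = F by apply/funext => x; exact: pmapE.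
Qed.

Lemma A_proj_surj (z : A) : exists w, z = A_proj w.
Proof.
by case: z => t r; exists (T_rep t, r); rewrite /A_proj T_repK.
Qed.

(** Continuity may be tested upstairs because the covering is open; the factor [X] will be the time
    of an isotopy. *)
Lemma continuous_annulus (X Z : topologicalType) (f : X * A -> Z) :
  continuous (fun w : X * (R * R) => f (w.1, A_proj w.2)) -> continuous f.
Proof.
move=> cf [a z] B; have [[x r] ->] := A_proj_surj z.
move=> /(cf (a, (x, r))) [[U V] /= [Ua [[V1 V2] /= [V1x V2r] V12]] UV].
exists (U, (@T_proj R @` V1) `*` V2).
  split=> //=; exists (@T_proj R @` V1, V2) => //=; split=> //=.
  by apply/nbhs_T; apply: filterS V1x => u V1u; exists u.
move=> [a' [t' r']] /= [Ua' [[u V1u <-] V2r']].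
exact: (UV (a', (u, r')) (conj Ua' (V12 (u, r') (conj V1u V2r')))).
Qed.

Variables (Phi Phi' : R -> R).
Hypotheses (dPhi : forall x : R, is_derive x 1 Phi (Phi' x))
  (cPhi' : continuous Phi') (pPhi : zperiodic Phi).

Let cPhi : continuous Phi.
Proof.
by move=> x; apply: differentiable_continuous; apply/derivable1_diffP; have [] := dPhi x.
Qed.

(** A horizontal shear followed by a vertical one, both scaled by [t]: time 1 is the map sought,
    time 0 the identity, and each time is a diffeomorphism with inverse [unshear t]. *)
Definition shear (t : R) (z : A) : A :=
  (z.1 + T_proj (t * z.2), z.2 + t * pmap Phi (z.1 + T_proj (t * z.2))).

Definition unshear (t : R) (z : A) : A :=
  (z.1 - T_proj (t * (z.2 - t * pmap Phi z.1)), z.2 - t * pmap Phi z.1).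

Lemma shearK t : cancel (shear t) (unshear t).
Proof.
by move=> [th r]; rewrite /shear /unshear /= addrK addrK.
Qed.

Lemma unshearK t : cancel (unshear t) (shear t).
Proof.
by move=> [th r]; rewrite /shear /unshear /= !subrK.
Qed.

(** The vanishing term gives the first component the shape required by [is_diff_comb]. *)
Definition shear_lift t (z : R * R) : R * R :=
  (plane_form 1 t z + 0 * Phi (plane_form 0 0 z),
   plane_form 0 1 z + t * Phi (plane_form 1 t z)).

Definition unshear_lift t (z : R * R) : R * R :=
  (plane_form 1 (- t) z + t ^+ 2 * Phi (plane_form 1 0 z),
   plane_form 0 1 z + (- t) * Phi (plane_form 1 0 z)).

Lemma shear_liftE t z : A_proj (shear_lift t z) = shear t (A_proj z).
Proof.
case: z => x r; rewrite /shear /A_proj /shear_lift /plane_form /=.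
by rewrite -T_projD pmapE// !mul1r mul0r addr0 mul0r add0r.
Qed.

Lemma unshear_liftE t z : A_proj (unshear_lift t z) = unshear t (A_proj z).
Proof.
case: z => x r; rewrite /unshear /A_proj /unshear_lift /plane_form /=.
rewrite pmapE// !mul1r !mul0r addr0 add0r mulNr -T_projB; congr (T_proj _, _); ring.
Qed.

Definition comb_d (a b c p q : R) (z v : R * R) : R :=
  plane_form a b v + c * (Phi' (plane_form p q z) * plane_form p q v).

Lemma continuous_comb_d a b c p q v : continuous ((comb_d a b c p q)^~ v).
Proof.
move=> z; apply: cvgD; first exact: cvg_cst.
apply: cvgM; first exact: cvg_cst; apply: cvgM; last exact: cvg_cst.
apply: (@continuous_comp _ _ _ (plane_form p q) Phi'); first exact: continuous_plane_form.
exact: cPhi'.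
Qed.

Lemma shear_lift_C1 t : C1 (shear_lift t) /\ forall z v, 'd (shear_lift t) z v =
  (comb_d 1 t 0 0 0 z v, comb_d 0 1 t 1 t z v).
Proof.
by apply: C1_pair => [z|z|v|v]; try exact: is_diff_comb; exact: continuous_comb_d.
Qed.

Lemma unshear_lift_C1 t : C1 (unshear_lift t).
Proof.
have [] := @C1_pair R (fun z => (unshear_lift t z).1) (fun z => (unshear_lift t z).2)
  (comb_d 1 (- t) (t ^+ 2) 1 0) (comb_d 0 1 (- t) 1 0) => //.
- by move=> z; exact: is_diff_comb.
- by move=> z; exact: is_diff_comb.
- by move=> v; exact: continuous_comb_d.
- by move=> v; exact: continuous_comb_d.
Qed.

Lemma shear_lift_continuous t : continuous (shear_lift t).
Proof.
have c1 := @continuous_comb R Phi 1 t 0 0 0 cPhi; have c2 := @continuous_comb R Phi 0 1 t 1 t cPhi.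
by move=> z; exact: (cvg_pair (c1 z) (c2 z)).
Qed.

Lemma unshear_lift_continuous t : continuous (unshear_lift t).
Proof.
have c1 := @continuous_comb R Phi 1 (- t) (t ^+ 2) 1 0 cPhi.
have c2 := @continuous_comb R Phi 0 1 (- t) 1 0 cPhi.
by move=> z; exact: (cvg_pair (c1 z) (c2 z)).
Qed.

Lemma A_lift_shear t : A_lift (shear_lift t) (shear t).
Proof. split; [exact: shear_lift_continuous|exact: shear_liftE]. Qed.

Lemma shear_diffeo t : diffeo (@A_C1 R) (shear t).
Proof.
exists (unshear t); split; [exact: shearK|exact: unshearK| |].
  by exists (shear_lift t); split; [exact: A_lift_shear|have [] := shear_lift_C1 t].
exists (unshear_lift t); split; last exact: unshear_lift_C1.
split; [exact: unshear_lift_continuous|exact: unshear_liftE].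
Qed.

Lemma shear_symplectic t : symplectic (shear t).
Proof.
exists (shear_lift t); have [h1 h2] := shear_lift_C1 t; split=> //.
  exact: A_lift_shear.
by move=> z u v; rewrite !h2 /omega /comb_d /plane_form /=; ring.
Qed.

Lemma shear0 : shear 0 = id.
Proof.
apply/funext => -[th r]; rewrite /shear /= !mul0r addr0.
by rewrite -[th in LHS]T_repK -T_projD addr0 T_repK.
Qed.

Lemma shear_isotopy : isotopic_to_id (shear 1).
Proof.
exists shear; split=> //; last exact: shear0.
  apply: continuous_subspaceT; apply: continuous_annulus => -[t [x r]].
  have e : (fun w : R * (R * R) => shear w.1 (A_proj w.2)) =
     (fun w => (T_proj (w.2.1 + w.1 * w.2.2), w.2.2 + w.1 * Phi (w.2.1 + w.1 * w.2.2))).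
    apply/funext => -[t' z]; rewrite /= -shear_liftE /A_proj /shear_lift /plane_form /=.
    by rewrite !mul1r mul0r addr0 mul0r add0r.
  rewrite e.
  have c1 : (fun w : R * (R * R) => w.2.1 + w.1 * w.2.2) @ (t, (x, r)) --> x + t * r.
    have c2 : (fun w : R * (R * R) => w.2) @ (t, (x, r)) --> (x, r) by exact: cvg_snd.
    apply: cvgD; first exact: (cvg_comp _ _ c2 cvg_fst).
    by apply: cvgM; [exact: cvg_fst|exact: (cvg_comp _ _ c2 cvg_snd)].
  have c3 : (fun w : R * (R * R) => w.2.2) @ (t, (x, r)) --> r.
    have c2 : (fun w : R * (R * R) => w.2) @ (t, (x, r)) --> (x, r) by exact: cvg_snd.
    exact: (cvg_comp _ _ c2 cvg_snd).
  have d1 := cvg_comp _ _ c1 (@T_proj_continuous R (x + t * r)).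
  have d2 : (fun w : R * (R * R) => w.2.2 + w.1 * Phi (w.2.1 + w.1 * w.2.2)) @
      (t, (x, r)) --> r + t * Phi (x + t * r).
    apply: cvgD; first exact: c3.
    by apply: cvgM; [exact: cvg_fst|exact: (cvg_comp _ _ c1 (@cPhi (x + t * r)))].
  exact: (cvg_pair d1 d2).
by move=> t _; exact: shear_diffeo.
Qed.

Lemma affine_diffeo (a : R) : diffeo (@C1 R _ _) (fun r : R => a + r).
Proof.
have cdiff (c : R) : C1 (fun r : R => c + r).
  apply: (sderiv_C1 (F' := fun=> 0 + 1) _).1 => x.
  by apply: sderivD; [exact: sderiv_cst|exact: sderiv_id].
exists (fun r => - a + r); split=> //.
- by move=> r; rewrite addKr.
- by move=> r; rewrite addNKr.
Qed.

(** For an arbitrary lift, [phi r - (theta + r)] is continuous and integer-valued, hence constant: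
    [phi] is a translation. *)
Lemma shear_twist : pos_twist_map (shear 1).
Proof.
split; [exact: shear_diffeo|exact: shear_isotopy|].
move=> F [cF hF] theta phi.
have lift r : T_proj (phi r) = T_proj (theta + r).
  by have := hF (theta, r); rewrite -shear_liftE /A_proj /shear_lift /plane_form /=
    => -[-> _]; rewrite !mul1r mul0r addr0.
have cphi : continuous phi.
  move=> r; apply: (@continuous_comp _ _ _ (fun s : R => F (theta, s)) fst); last exact: cvg_fst.
  apply: (@continuous_comp _ _ _ (fun s : R => (theta, s)) F); last exact: cF.
  have p1 : (fun=> theta) @ r --> theta by exact: cvg_cst.
  have p2 : (fun s : R => s) @ r --> r by exact: cvg_id.
  exact: (cvg_pair p1 p2).
have c : continuous (fun r => phi r - (theta + r)).
  move=> r; apply: cvgB; first exact: cphi.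
  by apply: cvgD; [exact: cvg_cst|exact: cvg_id].
have e : phi = (fun r => phi 0 + r).
  apply/funext => r.
  have h : phi r - (theta + r) = phi 0 - (theta + 0).
    exact: (int_valued_constant c (fun s => (T_proj_eq _ _).1 (lift s)) r 0).
  by move: (phi r) (phi 0) h => a b h; lra.
rewrite e; split; last exact: affine_diffeo.
by move=> r s rs; rewrite ltrD2l.
Qed.

End Annulus.

(** * Graphs are essential: invariance of the degree *)

Section Essential.
Variable R : realType.
Local Notation T := (circle R).
Local Notation A := (annulus R).
Implicit Types (x y : R) (p q : T).

Lemma nbhs_T_near p x (e : R) : 0 < e -> p = T_proj x ->
  \forall t \near p, exists2 u, t = T_proj u & `|u - x| < e.
Proof.
by move=> e0 ->; apply: (ball_nbhs_T e0) => u ux; exists u.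
Qed.

Lemma T_cvgB (X : Type) (F : set_system X) {FF : Filter F} (a b : X -> T) p q :
  a @ F --> p -> b @ F --> q -> (fun w => a w - b w) @ F --> p - q.
Proof.
have [x ->] := T_proj_surj p; have [y ->] := T_proj_surj q => ap bq.
rewrite -T_projB => U /nbhs_T_ball[e e0 H].
have e2 : 0 < e / 2 by rewrite divr_gt0.
have na := ap _ (nbhs_T_near e2 (erefl _)); have nb := bq _ (nbhs_T_near e2 (erefl _)).
change (F [set w | U (a w - b w)]).
apply: (@filterS2 _ F _ _ _ _ _ na nb) => w /= [u aw ux] [v bw vy].
rewrite /= aw bw -T_projB; apply: H.
have -> : u - v - (x - y) = (u - x) - (v - y) by ring.
by rewrite (le_lt_trans (ler_normB _ _))// [e]splitr ltrD.
Qed.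

(** The bound stays away from 1/2, where [T_rep] jumps. *)
Definition small_angle p := exists2 r : R, `|r| < 4^-1 & p = T_proj r.

Lemma small_angle_near0 : \forall t \near (0 : T), small_angle t.
Proof.
apply: filterS (nbhs_T_near (_ : 0 < 4^-1 :> R) (esym (T_proj0 R))) => [t [u -> u0]|].
  by exists u => //; rewrite -[u]subr0.
by rewrite invr_gt0.
Qed.

Lemma T_rep_cvg (X : Type) (F : set_system X) {FF : Filter F} (a : X -> T) p :
  small_angle p -> a @ F --> p -> (fun w => T_rep (a w)) @ F --> T_rep p.
Proof.
move=> [r r4 ->] ap; have r2 : `|r| < 2^-1 by lra.
rewrite T_rep_small//; apply/cvgrPdist_lt => e e0.
have m0 : 0 < Num.min e 4^-1 by rewrite lt_min; apply/andP; split; [exact: e0|lra].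
have na := ap _ (nbhs_T_near m0 (erefl _)).
near=> w.
have [u aw] : exists2 u, a w = T_proj u & `|u - r| < Num.min e 4^-1 by near: w; exact: na.
rewrite lt_min => /andP[ue u4]; rewrite aw T_rep_small 1?distrC//.
have := ler_normD (u - r) r; rewrite subrK; lra.
Unshelve. all: by end_near. Qed.

Definition degree_one_lift (c : T -> T) := exists L : R -> R,
  [/\ continuous L, (forall x, T_proj (L x) = c (T_proj x)) & forall x, L (x + 1) = L x + 1].

(** The small difference of the loops has a continuous periodic lift through [T_rep]; adding it to a
    lift of [c] lifts [c'] with the same increment over a period. *)
Lemma degree_one_perturb (c c' : T -> T) : continuous c -> continuous c' ->
  (forall p, small_angle (c' p - c p)) -> degree_one_lift c -> degree_one_lift c'.
Proof.
move=> cc cc' sm [L [cL hL L1]].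
exists (fun x => L x + T_rep (c' (T_proj x) - c (T_proj x))); split.
- move=> x; apply: cvgD; first exact: cL.
  apply: T_rep_cvg; first exact: sm.
  apply: T_cvgB.
    exact: (cvg_comp _ _ (@T_proj_continuous R x) (cc' (T_proj x))).
  exact: (cvg_comp _ _ (@T_proj_continuous R x) (cc (T_proj x))).
- by move=> x; rewrite T_projD T_repK hL addrC subrK.
- by move=> x; rewrite L1 (T_proj_int x 1) addrAC.
Qed.

Lemma degree_one_nonconstant (c : T -> T) p : (forall q, c q = p) -> ~ degree_one_lift c.
Proof.
move=> cp [L [cL hL L1]]; have [y py] := T_proj_surj p.
have c' : continuous (fun x => L x - y) by move=> x; apply: cvgB; [exact: cL|exact: cvg_cst].
have i x : L x - y \is a Num.int by apply/T_proj_eq; rewrite hL cp.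
have := int_valued_constant c' i (0 + 1) 0; rewrite L1; lra.
Qed.

Lemma homotopy_degree (h : R -> T -> A) :
  {within `[0, 1]%classic `*` [set: T], continuous (fun tx : R * T => h tx.1 tx.2)} ->
  degree_one_lift (fun p => (h 0 p).1) -> degree_one_lift (fun p => (h 1 p).1).
Proof.
move=> /subspace_continuousP ch d0; set I : set R := `[0, 1]%classic in ch.
have chT t p : I t ->
    (fun tx : R * T => (h tx.1 tx.2).1) @ within (I `*` setT) (nbhs (t, p)) --> (h t p).1.
  move=> It; exact: (cvg_comp _ _ (ch (t, p) (conj It Logic.I)) cvg_fst).
have ct t : I t -> continuous (fun p => (h t p).1).
  move=> It p U /(chT t p It); rewrite /= /within /= => -[[V W] /= [Vt Wp] VW].
  apply: filterS Wp => q Wq; apply: (VW (t, q)); last by split.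
  by split=> //=; exact: nbhs_singleton.
have tube t : I t -> exists2 d : R, 0 < d & forall s, I s -> `|s - t| < d ->
    forall p, small_angle ((h s p).1 - (h t p).1).
  (* Compactness of the circle makes the time step [d] uniform in the point [p]. *)
  move=> It; have /compact_near_coveringP cov := @T_compact R.
  pose P s p := I s -> small_angle ((h s p).1 - (h t p).1).
  have /= := cov R (nbhs t) P _ _; case=> [p _|d /= d0' H].
    have c1 := chT t p It.
    have c2 : (fun tx : R * T => (h t tx.2).1) @ within (I `*` setT) (nbhs (t, p)) --> (h t p).1.
      apply: cvg_within_filter.
      have s2 : (fun tx : R * T => tx.2) @ (t, p) --> p by exact: cvg_snd.
      have c3 := ct t It p; exact: (cvg_comp _ _ s2 c3).
    have c4 : (fun tx : R * T => (h tx.1 tx.2).1 - (h t tx.2).1)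
        @ within (I `*` setT) (nbhs (t, p)) --> (0 : T).
      by rewrite -[X in _ --> X](subrr (h t p).1); exact: T_cvgB c1 c2.
    move: (c4 _ small_angle_near0).
    rewrite /= /within /= => -[[V W] /= [Vt Wp] VW].
    exists (W, V) => //= -[q s] /= [Wq Vs] Is; exact: (VW (s, q)).
  exists d => // s Is st p; apply: H => //=.
  by rewrite distrC.
have [del hdel] : exists del : R -> R, forall t, I t -> 0 < del t /\ forall s, I s ->
    `|s - t| < del t -> forall p, small_angle ((h s p).1 - (h t p).1).
  have /choice[del hd] : forall t, exists d : R, I t -> 0 < d /\ forall s, I s ->
      `|s - t| < d -> forall p, small_angle ((h s p).1 - (h t p).1).
    move=> t; have [It|nIt] := pselect (I t); last by exists 0.
    by have [d d0' H] := tube t It; exists d.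
  by exists del.
have small_sym p q : small_angle (p - q) -> small_angle (q - p).
  by move=> [r r4 e]; exists (- r); rewrite ?normrN// T_projN -e opprB.
pose D t := degree_one_lift (fun p => (h t p).1).
have prop t s : I t -> I s -> `|s - t| < del t -> (D t <-> D s).
  move=> It Is st; have [_ H] := hdel t It.
  split; apply: degree_one_perturb; try exact: ct.
    exact: H.
  by move=> p; apply: small_sym; exact: H.
have I0 : I 0 by rewrite /I /= in_itv /= lexx ler01.
have I1 : I 1 by rewrite /I /= in_itv /= lexx ler01.
have conI : connected I by exact: segment_connected.
(* Having degree one is constant on each ball of radius [del t] in [I]; the set of such times is
   open and closed in the connected segment. *)
pose B := I `&` [set t | D t].
have openU (Q : R -> Prop) : open (\bigcup_(t in I `&` [set t | Q t]) ball t (del t)).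
  by apply: bigcup_open => t _; exact: ball_open.
suff e : B = I by have [] : B 1 by rewrite e.
apply: conI.
- by exists 0.
- exists (\bigcup_(t in I `&` [set t | D t]) ball t (del t)); first exact: openU.
  apply/seteqP; split=> t [It].
    by move=> Dt; split=> //; exists t => //; apply: ballxx; have [] := hdel t It.
  by move=> [s [Is Ds]] st; split=> //=; apply/(prop s t) => //; rewrite distrC.
- exists (~` \bigcup_(t in I `&` [set t | ~ D t]) ball t (del t)).
    exact/open_closedC/openU.
  apply/seteqP; split=> t [It] H; split=> //=.
    by move=> [s [Is nDs]] st; apply: nDs; apply/(prop s t) => //; rewrite distrC.
  apply: contrapT => nDt; apply: H; exists t => //.
  by apply: ballxx; have [] := hdel t It.
Qed.

Lemma graph_essential (gamma : T -> R) : continuous gamma -> essential_curve (graph_of gamma).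
Proof.
move=> cg; exists (fun p => (p, gamma p)); split.
- by move=> p; exact: (cvg_pair (@cvg_id _ _) (cg p)).
- by move=> p q [].
- apply/seteqP; split=> [_ [p _ <-]//|[p r] /= e]; exists p => //.
  by congr (_, _); exact: esym e.
move=> [h [ch h0 [z hz]]].
have d1 : degree_one_lift (fun p => (h 1 p).1).
  apply: homotopy_degree ch _; exists id; split=> [x|x|//]; first exact: cvg_id.
  by rewrite h0.
by apply: degree_one_nonconstant d1 => q; rewrite hz.
Qed.

End Essential.

(** * Regularity read on the circle *)

Section CircleRegularity.
Variable R : realType.
Local Notation T := (circle R).
Implicit Types (F : R -> R) (x d : R).

Lemma C1_at_sderiv F x d : zperiodic F -> sderiv setT F x d -> C1_at (pmap F) (T_proj x).
Proof.
move=> pF h; exists d => u v ux vx uv; apply/cvgrPdist_le => e e0.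
have [r r0 H] := h _ e0.
have m0 : 0 < Num.min r 4^-1 by rewrite lt_min; apply/andP; split; [exact: r0|lra].
have nu := ux _ (nbhs_T_near m0 (erefl _)); have nv := vx _ (nbhs_T_near m0 (erefl _)).
near=> n.
have [a ua] : exists2 a, u n = T_proj a & `|a - x| < Num.min r 4^-1 by near: n; exact: nu.
rewrite lt_min => /andP[ar a4].
have [b vb] : exists2 a, v n = T_proj a & `|a - x| < Num.min r 4^-1 by near: n; exact: nv.
rewrite lt_min => /andP[br b4].
have ab0 : a - b != 0.
  by apply/eqP => ab; apply: (uv n); rewrite ua vb (_ : a = b)//; lra.
have ab2 : `|a - b| < 2^-1.
  by move: a4 b4; rewrite !ltr_norml => /andP[? ?] /andP[? ?]; apply/andP; lra.
rewrite ua vb !pmapE// -T_projB T_rep_small//.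
have -> : d - (F a - F b) / (a - b) = - ((F a - F b - d * (a - b)) / (a - b)) by field.
rewrite normrN normrM normfV ler_pdivrMr ?normr_gt0//.
exact: H.
Unshelve. all: by end_near. Qed.

Lemma sderiv_right_derivative F x d : zperiodic F -> sderiv [set u | x <= u] F x d ->
  right_derivative (pmap F) (T_proj x) d.
Proof.
move=> pF h; apply/cvgrPdist_le => e e0; have [r r0 H] := h _ e0.
near=> s.
have s0 : 0 < s by near: s; exact: nbhs_right_gt.
have sr : s < r by near: s; exact: nbhs_right_lt.
rewrite -T_projD !pmapE//.
have -> : d - (F (x + s) - F x) / s = - ((F (x + s) - F x - d * s) / s).
  by field; rewrite gt_eqF.
have xs : x + s - x = s by ring.
rewrite normrN normrM normfV ler_pdivrMr ?normr_gt0 ?gt_eqF//.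
have := H (x + s) x; rewrite xs subrr normr0 /= lerDl (gtr0_norm s0).
by apply=> //; exact: ltW.
Unshelve. all: by end_near. Qed.

Lemma sderiv_left_derivative F x d : zperiodic F -> sderiv [set u | u <= x] F x d ->
  left_derivative (pmap F) (T_proj x) d.
Proof.
move=> pF h; apply/cvgrPdist_le => e e0; have [r r0 H] := h _ e0.
near=> s.
have s0 : s < 0 by near: s; exact: nbhs_left_lt.
have sr : - r < s by near: s; apply: nbhs_left_gt; rewrite oppr_lt0.
rewrite -T_projD !pmapE//.
have -> : d - (F (x + s) - F x) / s = - ((F (x + s) - F x - d * s) / s).
  by field; rewrite lt_eqF.
have xs : x + s - x = s by ring.
rewrite normrN normrM normfV ler_pdivrMr ?normr_gt0 ?lt_eqF//.
have := H (x + s) x; rewrite xs subrr normr0 /= gerDl (ltr0_norm s0).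
by move: (ltW s0) => s0' Hs; apply: Hs => //; lra.
Unshelve. all: by end_near. Qed.

(** Taking one of the two sequences constant at the point turns the [C1_at] quotient into an
    ordinary one, whose limit is then the same from both sides. *)
Lemma C1_at_one_sided (gamma : T -> R) x dl dr : C1_at gamma (T_proj x) ->
  left_derivative gamma (T_proj x) dl -> right_derivative gamma (T_proj x) dr -> dl = dr.
Proof.
move=> [d h] hl hr.
(* Starting at 1/3 keeps the increments below 1/2, where [T_rep] inverts the projection. *)
pose s (n : nat) : R := n.+3%:R^-1.
have s0 n : 0 < s n by rewrite invr_gt0.
have s2 n : `|s n| < 2^-1 by rewrite gtr0_norm// ltf_pV2 ?posrE// ltr_nat.
have cs : s @ \oo --> (0 : R).
  apply/cvgrPdist_lt => e e0; near=> n.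
  rewrite sub0r normrN gtr0_norm// invf_plt ?posrE//.
  by near: n; exists (Num.truncn e^-1) => // n /= hn; apply: lt_le_trans (truncnS_gt _) _;
    rewrite ler_nat ltnS (leq_trans hn)// (leq_trans (leqnSn n)).
have lim (w : nat -> R) : w @ \oo --> (0 : R) -> (forall n, w n != 0) -> (forall n, `|w n| < 2^-1) ->
   (fun n => (gamma (T_proj x + T_proj (w n)) - gamma (T_proj x)) / w n) @ \oo --> d.
  move=> cw w0 w2.
  have c1 : (fun n => T_proj (x + w n)) @ \oo --> T_proj x.
    have c2 : (fun n => x + w n) @ \oo --> x.
      by rewrite -[X in _ --> X]addr0; apply: cvgD => //; exact: cvg_cst.
    exact: (cvg_comp _ _ c2 (@T_proj_continuous R x)).
  have c2 : (fun n : nat => T_proj x) @ \oo --> T_proj x by exact: cvg_cst.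
  have := h _ _ c1 c2.
  have -> : (fun n => (gamma (T_proj (x + w n)) - gamma (T_proj x)) /
      T_rep (T_proj (x + w n) - T_proj x)) =
    (fun n => (gamma (T_proj x + T_proj (w n)) - gamma (T_proj x)) / w n).
    apply/funext => n; rewrite -T_projB.
    have -> : x + w n - x = w n by ring.
    by rewrite T_rep_small// T_projD.
  apply=> n /T_proj_eqP[m]; move/eqP; rewrite -subr_eq0 => /eqP e.
  have : T_proj (w n) = T_proj 0 by apply/T_proj_eq; rewrite subr0 (_ : w n = m%:~R) ?intr_int//; lra.
  move/(congr1 (@T_rep R)); rewrite !T_rep_small ?normr0// => wn0.
  by move: (w0 n); rewrite wn0 eqxx.
have cl := lim (fun n => - s n).
have cr := lim s cs (fun n => lt0r_neq0 (s0 n)) s2.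
have {}cl : (fun n => (gamma (T_proj x + T_proj (- s n)) - gamma (T_proj x)) / - s n) @ \oo --> d.
  apply: cl => [|n|n]; last by rewrite normrN.
    by rewrite -oppr0; exact: cvgN.
  by rewrite oppr_eq0 lt0r_neq0.
have er : dr = d.
  apply: (cvg_unique _ _ cr) => //.
  have /cvg_at_rightP := hr; apply; split=> //.
have el : dl = d.
  apply: (cvg_unique _ _ cl) => //.
  have /cvg_at_leftP := hl; apply; split=> [n|]; first by rewrite oppr_lt0.
  by rewrite -oppr0; exact: cvgN.
by rewrite el er.
Unshelve. all: by end_near. Qed.

End CircleRegularity.

(** * The Denjoy counter-example and the final assembly *)

Section DenjoyExample.
Variable R : realType.
Local Notation T := (circle R).

Lemma C1_of_sderiv (F : R -> R) : (forall x, exists d, sderiv setT F x d) ->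
  exists F' : R -> R, [/\ (forall x, sderiv setT F x (F' x)), C1 F & continuous F'].
Proof.
by move=> /choice[F' hF']; exists F'; have [] := sderiv_C1 hF'; split.
Qed.

Lemma sderiv_continuousT (F : R -> R) : (forall x, exists d, sderiv setT F x d) -> continuous F.
Proof.
move=> h x; have [d hd] := h x; apply: differentiable_continuous.
by have [] := is_derive_diffE 0 (sderiv_is_derive hd).
Qed.

Lemma denjoy_smooth (Gi : R -> R) : cancel (gmap (@smooth R)) Gi ->
  cancel Gi (gmap (@smooth R)) -> (forall u v, `|Gi u - Gi v| <= 2 * `|u - v|) ->
  denjoy_counterexample (tmap (gmap (@smooth R))).
Proof.
set G := gmap _ => GK GiK Gi_lip; have gs := @smooth_family R.
have aG : addz G by exact: gmap_addz.
have aGi : addz Gi := addz_inv aG GK GiK.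
have [G' [dG C1G _]] := C1_of_sderiv (@sderiv_smooth R).
have G'0 x : 0 < G' x := near_id_sderiv_gt0 (gmap_near_id gs) (dG x).
have cG := sderiv_continuousT (@sderiv_smooth R).
have dGi x : exists d, sderiv setT Gi x d.
  by eexists; exact: sderiv_inv (@ltr0Sn R 1) GiK (G'0 _) Gi_lip (dG _).
have [_ [_ C1Gi _]] := C1_of_sderiv dGi; have cGi := sderiv_continuousT dGi.
split.
- exists (tmap Gi); split; [exact: tmap_cancel|exact: tmap_cancel| |].
    by exists G; split; [exact: tmap_lift|exact: C1G].
  by exists Gi; split; [exact: tmap_lift|exact: C1Gi].
- move=> F lF x; have [m hm] := T_lift_unique (tmap_lift aG cG) lF.
  have dF : sderiv setT F x (G' x).
    by apply: (sderiv_eq_near ltr01) (dG x) => u v _ _ _ _; rewrite !hm opprD addrACA subrr addr0.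
  by rewrite derive1E (@derive_val _ _ _ _ _ _ _ (sderiv_is_derive dF)).
- by exists (T_proj (rho R)); split; [exact: rotation_gmap|exact: rho_angle].
exists (@denjoy_set R); split.
(* The middle of the gap 0 lies outside the set; [exists_center] rules out the default value of
   [xget]. *)
- split=> // /(_ (T_proj (xget 0 (fun x : R => sc 0 x = 2^-1))) Logic.I).
  have [x hx] := exists_center R; case: xgetP => [y _ hy|/(_ x)//].
  move/denjoy_setE; apply; apply: (@on_gap_locconst _ 0); exists 0.
  by rewrite hy; apply/andP; lra.
- exact: nonwandering_denjoy gs.
- split.
  + exact: denjoy_nonempty.
  + by apply: (subclosed_compact (@denjoy_closed R) (@T_compact R)).
  + exact: denjoy_perfect gs GK GiK Gi_lip.
  + exact: denjoy_disconnected gs GK GiK Gi_lip.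
- exact: denjoy_minimal gs GK GiK Gi_lip.
Qed.

End DenjoyExample.

Theorem theorem1 (R : realType) :
  exists (f : annulus R -> annulus R) (Gamma : set (annulus R))
         (gamma : circle R -> R),
    [/\ twist_map f, symplectic f,
        essential_curve Gamma, f @` Gamma = Gamma &
        continuous gamma /\ Gamma = graph_of gamma] /\
    [/\ (forall z, Gamma z -> forall n, (0 < n)%N -> iter n f z <> z),
        (exists g : circle R -> circle R,
           denjoy_counterexample g /\ C0_conjugated_on Gamma f g) &
        (exists p : annulus R, Gamma p /\
           forall theta : circle R,
             let on_orbit := (fst @` full_orbit f p) theta in
             (C1_at gamma theta <-> ~ on_orbit) /\
             (on_orbit -> exists dl dr : R,
                [/\ left_derivative gamma theta dl,
                    right_derivative gamma theta dr & dl <> dr]))].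
Proof.
have gb := @broken_family R; have gs := @smooth_family R.
set G := gmap (@broken R); pose G0 := gmap (@smooth R).
have [Gi [GK GiK Gi_lip]] := near_id_bij (gmap_near_id gb).
have {}GK : cancel G Gi by []; have {}GiK : cancel Gi G by [].
have [Gi0 [G0K Gi0K Gi0_lip]] := near_id_bij (gmap_near_id gs).
have [h [hi [hK hiK hmono hz hG]]] := gmap_conjugate gb gs.
have aG : addz G by exact: gmap_addz.
have aGi : addz Gi := addz_inv aG GK GiK.
have aG0 : addz G0 by exact: gmap_addz.
pose Phi := kick Gi.
have [Phi' [dPhi' _ cPhi']] := C1_of_sderiv (sderiv_kick GiK Gi_lip).
have dPhi (x : R) : is_derive x 1 Phi (Phi' x) := sderiv_is_derive (dPhi' x).
have pPhi : zperiodic Phi by move=> x m; rewrite /Phi /kick -/G aG aGi; ring.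
pose F x := G x - x.
have pF : zperiodic F by move=> x m; rewrite /F aG; ring.
have cG : continuous G.
  by apply: lip_continuous => u v; exact: (near_id_lip _ _ (gmap_near_id gb)).
have cF : continuous F by move=> x; apply: cvgB; [exact: cG|exact: cvg_id].
pose f := shear Phi 1; pose gamma := pmap F; pose Gamma := graph_of gamma.
have cgamma : continuous gamma by exact: pmap_continuous.
pose P x : annulus R := (T_proj x, gamma (T_proj x)).
have GammaP z : Gamma z -> exists x, z = P x.
  case: z => th r; rewrite /Gamma /graph_of /= => ->.
  by have [x ->] := T_proj_surj th; exists x.
(* The height [G x - x] moves [x] to [G x], and the kick there, [G (G x) + x - 2 * G x], turns it
   into [G (G x) - G x]. *)
have fP x : f (P x) = P (G x).
  rewrite /f /shear /P /= /gamma pmapE// mul1r -T_projD.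
  have -> : x + F x = G x by rewrite /F; ring.
  rewrite !pmapE// mul1r /Phi /kick -/G GK /F; congr (_, _); ring.
have fnP n x : iter n f (P x) = P (iter n G x) by elim: n => //= n ->; rewrite fP.
have GnK n : cancel (iter n Gi) (iter n G).
  by move=> x; elim: n x => // n IH x; rewrite iterSr iterS GiK IH.
have fK := shearK Phi 1.
have fnI n : injective (iter n f) by elim: n => //= n IH u v /(can_inj fK)/IH.
have PI x (m : int) : P (x + m%:~R) = P x by rewrite /P T_proj_int.
have sing_addz x (m : int) : singular x -> singular (x + m%:~R).
  move=> [k [n hn]]; exists k, (n + m); have [_ ->] := coord_addz x m.
  by rewrite hn intrD; ring.
have sing_iter n x : singular (iter n G x) <-> singular x.
  by elim: n => //= n IH; split=> [/singular_gmap/IH|/IH/singular_gmap].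
have [x0 hx0] := exists_center R.
have sing0 : singular x0 by exists 0, 0; rewrite hx0 add0r.
have sc_iter n k x (m : int) : sc k x = m%:~R + 2^-1 ->
    sc (k + Posz n) (iter n G x) = m%:~R + 2^-1.
  move=> hk; elim: n => [|n IH]; first by rewrite addr0.
  have -> : k + Posz n.+1 = k + Posz n + 1 by lia.
  by rewrite /= (sc_gmap gb) IH [m%:~R + _]addrC (psi_addz gb) psi_broken_half.
(* A break in the gap [k] is, up to an integer, the [k]-th iterate of [x0], because both have the
   same half-integer as coordinate [k] and [sc_inj] applies. *)
have orbitE x : (fst @` full_orbit f (P x0)) (T_proj x) <-> singular x.
  split.
    move=> [q [n [->|qn]]].
      rewrite fnP /= => /esym/T_proj_eqP[m ->].
      by apply: sing_addz; apply/sing_iter.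
    have -> : q = P (iter n Gi x0) by apply: (fnI n); rewrite qn fnP GnK.
    move=> /= /esym/T_proj_eqP[m ->]; apply: sing_addz.
    by apply/(sing_iter n); rewrite GnK.
  move=> [k [m hm]]; exists (P x) => //; case: k hm => n hn.
    exists n; left; rewrite fnP -[RHS](PI _ m); congr P.
    have e : sc (Posz n) (iter n G x0) = 0%:~R + 2^-1.
      by rewrite -[Posz n]add0r; apply: sc_iter; rewrite hx0 add0r.
    have [_ e'] := coord_addz (iter n G x0) m.
    have hm : m%:~R < sc (Posz n) (iter n G x0 + m%:~R) < m%:~R + 1.
      by rewrite e' e; apply/andP; lra.
    by apply: (sc_inj hm); rewrite hn e' e; ring.
  (* For the gap [-(n + 1)], [n + 1] forward steps lead to the gap 0, hence to a translate of
     [x0]. *)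
  exists n.+1; right; rewrite fnP -(PI x0 m); congr P.
  have [_ e'] := coord_addz x0 m.
  have hm : m%:~R < sc 0 (x0 + m%:~R) < m%:~R + 1 by rewrite e' hx0; apply/andP; lra.
  apply: (sc_inj hm); rewrite e' hx0.
  have -> : 0 = Negz n + Posz n.+1 by lia.
  by rewrite (sc_iter _ _ _ _ hn) addrC.
have one_sided x : singular x -> exists dl dr : R,
    [/\ left_derivative gamma (T_proj x) dl, right_derivative gamma (T_proj x) dr & dl <> dr].
  move=> [k /sderiv_broken_center[hr hl]].
  exists (alphaL R k - 1), (alphaR R k - 1); split.
  - exact/(sderiv_left_derivative pF)/(sderivD hl)/sderivN/sderiv_id.
  - exact/(sderiv_right_derivative pF)/(sderivD hr)/sderivN/sderiv_id.
  - by move/addIr/esym/eqP; rewrite (negPf (alpha_neq R k)).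
exists f, Gamma, gamma; split; split=> //.
- by left; exact: (shear_twist dPhi cPhi' pPhi).
- exact: (shear_symplectic dPhi cPhi' pPhi).
- exact: graph_essential.
- apply/seteqP; split=> z.
    by move=> [_ /GammaP[x ->] <-]; rewrite fP.
  by move=> /GammaP[x ->]; exists (P (Gi x)) => //; rewrite fP GiK.
- move=> _ /GammaP[x ->] n n0; rewrite fnP => -[/T_proj_eqP[m]].
  by move=> + _; exact: (no_period gb n0 (erefl (hc x))).
- exists (tmap G0); split; first exact: denjoy_smooth G0K Gi0K Gi0_lip.
  have hiz : addz hi := addz_inv hz hK hiK.
  have ch : continuous (tmap h) by apply: tmap_continuous => //; exact: mono_bij_continuous hmono hiK.
  have himono : {mono hi : u v / u <= v} by move=> u v; rewrite -hmono !hiK.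
  have chi : continuous (tmap hi).
    by apply: tmap_continuous => //; exact: mono_bij_continuous himono hK.
  (* The conjugacy is the first projection, a homeomorphism from the graph onto the circle, followed
     by the circle map induced by [h]. *)
  exists (fun z => tmap h z.1); split; last first.
    by move=> _ /GammaP[x ->]; rewrite fP /P /= !tmapE// hG.
  split.
    apply: continuous_subspaceT => -[t r].
    have c1 : (fun w : circle R * R => w.1) @ (t, r) --> t by exact: cvg_fst.
    exact: (cvg_comp _ _ c1 (ch t)).
  exists (fun t => (tmap hi t, gamma (tmap hi t))); split=> //.
  + move=> t; have c2 := cvg_comp _ _ (chi t) (cgamma (tmap hi t)).
    exact: (cvg_pair (chi t) c2).
  + by move=> t; exact: tmap_cancel.
  + move=> z; rewrite inE => /GammaP[x ->] /=; rewrite (tmap_cancel hz hK)//.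
- exists (P x0); split=> // theta; have [x ->] := T_proj_surj theta.
  move=> on_orbit; have orbE : on_orbit <-> singular x by exact: orbitE.
  split; last by move/orbE/one_sided.
  (* On the orbit, [C1_at] would force the distinct one-sided derivatives to agree; off it, [G] is
     strictly differentiable. *)
  split=> [c /orbE/one_sided[dl [dr [hl hr]]]|nsx].
    by apply; exact: C1_at_one_sided c hl hr.
  have [d hd] : exists d, sderiv setT G x d.
    by apply: sderiv_broken => /orbE.
  apply: (@C1_at_sderiv _ F x (d + - 1)) => //.
  exact/(sderivD hd)/sderivN/sderiv_id.
Qed.
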